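(* Let $p\in\mathcal{P}(\mathbb{R}^n)$ satisfy $p\in\mathcal{A}\cap\mathcal{N}$ and $p^->1$ (the case $p^+=\infty$ is allowed). Then there exists a constant $c>0$, depending only on $(p')^+$, $[p]_{\mathcal{A}}$, $[p]_{\mathcal{N}}$ and $n$, such that for every $f\in L^{p(\cdot)}(\mathbb{R}^n)$ $$\|Mf\|_{p(\cdot)}\le c\,\|f\|_{p(\cdot)}.$$
   Context: Variable exponents: $\mathcal{P}(\mathbb{R}^n)$ is the set of measurable functions $p:\mathbb{R}^n\to[1,\infty]$. Put $p^-=\operatorname{ess\,inf}_{x\in\mathbb{R}^n}p(x)$ and $p^+=\operatorname{ess\,sup}_{x\in\mathbb{R}^n}p(x)$. The conjugate exponent $p'\in\mathcal{P}(\mathbb{R}^n)$ is defined by $\frac1{p(x)}+\frac1{p'(x)}=1$ (with $\frac1\infty=0$), and $(p')^+=\operatorname{ess\,sup} p'$. Spaces: for measurable $f$ on $\mathbb{R}^n$ let $\rho_{p(\cdot)}(f)=\int_{\mathbb{R}^n}|f(x)|^{p(x)}\,dx$, with the convention $t^\infty=0$ for $t\in[0,1]$ and $t^\infty=\infty$ for $t>1$. Let $\|f\|_{p(\cdot)}=\inf\{\lambda>0:\rho_{p(\cdot)}(f/\lambda)\le1\}$, and let $L^{p(\cdot)}(\mathbb{R}^n)$ be the set of measurable $f$ with $\|f\|_{p(\cdot)}<\infty$. Cubes are taken with sides parallel to the coordinate axes; $|Q|$ is the Lebesgue measure of $Q$ and $\mathbf{1}_Q$ its indicator function. Hardy-Littlewood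 maximal operator: $Mf(x)=\sup_{Q\ni x}\frac1{|Q|}\int_Q|f(y)|\,dy$, the supremum being over all cubes $Q\subset\mathbb{R}^n$ containing $x$. Muckenhoupt condition: $p\in\mathcal{A}$ means $$[p]_{\mathcal{A}}=\sup_Q\frac{\|\mathbf{1}_Q\|_{p(\cdot)}\,\|\mathbf{1}_Q\|_{p'(\cdot)}}{|Q|}<\infty,$$ the supremum being over all cubes $Q\subset\mathbb{R}^n$. Nekvinda condition: $p\in\mathcal{N}$ means there exists $p_\infty\in[1,\infty]$ such that the constant function $1$ belongs to $L^{s(\cdot)}(\mathbb{R}^n)$, where $s\in\mathcal{P}(\mathbb{R}^n)$ is defined by $\frac1{s(x)}=\left|\frac1{p(x)}-\frac1{p_\infty}\right|$ (with $s(x)=\infty$ when the right-hand side is $0$). In that case $[p]_{\mathcal{N}}=\|1\|_{s(\cdot)}$. *)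

(* Defs.v *)
From HB Require Import structures.
From mathcomp Require Import all_boot all_order all_algebra.
From mathcomp Require Import all_classical all_reals all_analysis.
From mathcomp Require Import measurable_realfun ess_sup_inf.

Set Implicit Arguments.
Unset Strict Implicit.
Unset Printing Implicit Defensive.

Import Order.TTheory GRing.Theory Num.Theory.
Import numFieldNormedType.Exports.

Local Open Scope classical_set_scope.
Local Open Scope ring_scope.
Local Open Scope ereal_scope.

(* [borel_lebesgue] is the n-fold product of the one-dimensional Lebesgue
   measure, transported along R * R^n -> R^(n+1). [lebesgue_n] is its
   completion, defined on the Caratheodory sigma-algebra (the Lebesgue
   measurable sets of R^n); this is how the library obtains
   [completed_lebesgue_measure] in dimension 1. *)

Section product_cons.
Context (R : realType) (n : nat).
Notation RT := (measurableTypeR R).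

Definition tcons (z : RT * n.-tuple RT) : n.+1.-tuple RT :=
  [tuple of z.1 :: z.2].

Lemma measurable_tcons : measurable_fun setT tcons.
Proof. exact: measurable_cons measurable_fst measurable_snd. Qed.

Variable mu : {sigma_finite_measure set (n.-tuple RT) -> \bar R}.

Definition product_cons : set (n.+1.-tuple RT) -> \bar R :=
  pushforward (@lebesgue_measure R \x mu) tcons.

Let product_cons0 : product_cons set0 = 0.
Proof. by rewrite /product_cons /pushforward preimage_set0 measure0. Qed.

Let product_cons_ge0 A : 0 <= product_cons A.
Proof. by rewrite /product_cons /pushforward; exact: measure_ge0. Qed.

Let product_cons_sigma_additive : semi_sigma_additive product_cons.
Proof.
move=> F mF tF mUF; rewrite /product_cons /pushforward preimage_bigcup.
apply: measure_semi_sigma_additive.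
- by move=> k; rewrite -[X in measurable X]setTI; exact: measurable_tcons.
- apply/trivIsetP => /= i j _ _ ij; rewrite -preimage_setI.
  by move/trivIsetP : tF => /(_ _ _ _ _ ij) ->//; rewrite preimage_set0.
- rewrite -preimage_bigcup -[X in measurable X]setTI.
  exact: measurable_tcons.
Qed.

HB.instance Definition _ := isMeasure.Build _ _ _ product_cons
  product_cons0 product_cons_ge0 product_cons_sigma_additive.

Lemma product_consE (A : set RT) (B : set (n.-tuple RT)) :
  measurable A -> measurable B ->
  product_cons [set t | A (thead t) /\ B [tuple of behead t]] =
  lebesgue_measure A * mu B.
Proof.
move=> mA mB; rewrite -product_measure1E// /product_cons /pushforward.
congr (_ _); apply/seteqP; split => -[a t] /=; rewrite theadE.
  by move=> [Aa]; rewrite (_ : [tuple of _] = t)//; exact/val_inj.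
by move=> [Aa Bt]; split => //; rewrite (_ : [tuple of _] = t)//; exact/val_inj.
Qed.

Lemma measurable_thead_behead (A : set RT) (B : set (n.-tuple RT)) :
  measurable A -> measurable B ->
  measurable [set t : n.+1.-tuple RT | A (thead t) /\ B [tuple of behead t]].
Proof.
move=> mA mB; apply: measurableI.
  by rewrite -[X in measurable X]setTI; exact: measurable_tnth.
by rewrite -[X in measurable X]setTI; exact: measurable_behead.
Qed.

Let product_cons_sigma_finite : sigma_finite setT product_cons.
Proof.
have /sigma_finiteP[F [TF ndF Foo]] := sigma_finiteT (@lebesgue_measure R).
have /sigma_finiteP[G [TG ndG Goo]] := sigma_finiteT mu.
exists (fun k => [set t | F k (thead t) /\ G k [tuple of behead t]]).
  apply/seteqP; split => // t _.
  have : setT (thead t) by [].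
  have : setT ([tuple of behead t] : n.-tuple RT) by [].
  rewrite TF TG => -[i _ Gi] [j _ Fj]; exists (maxn i j) => //; split.
    by apply: subsetPset Fj; exact/ndF/leq_maxr.
  by apply: subsetPset Gi; exact/ndG/leq_maxl.
move=> k; have [mF Fk] := Foo k; have [mG Gk] := Goo k.
split; first exact: measurable_thead_behead.
by rewrite product_consE// lte_mul_pinfty// ge0_fin_numE.
Qed.

HB.instance Definition _ := Measure_isSigmaFinite.Build _ _ _ product_cons
  product_cons_sigma_finite.

End product_cons.

Fixpoint borel_lebesgue (R : realType) (n : nat) :
    {sigma_finite_measure set (n.-tuple (measurableTypeR R)) -> \bar R} :=
  if n is m.+1 then product_cons (borel_lebesgue R m)
  else dirac [tuple].

Definition Rn (R : realType) (n : nat) :=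
  caratheodory_type ((borel_lebesgue R n)^*)%mu.

HB.instance Definition _ (R : realType) (n : nat) := Measurable.on (Rn R n).

Definition lebesgue_n (R : realType) (n : nat) : set (Rn R n) -> \bar R :=
  @completed_measure_extension _ _ _ (borel_lebesgue R n).
HB.instance Definition _ (R : realType) (n : nat) :=
  Measure.on (@lebesgue_n R n).

Lemma sigmaT_finite_lebesgue_n (R : realType) (n : nat) :
  sigma_finite setT (@lebesgue_n R n).
Proof. exact/completed_measure_extension_sigma_finite/sigma_finiteT. Qed.

HB.instance Definition _ (R : realType) (n : nat) :=
  @Measure_isSigmaFinite.Build _ _ _ (@lebesgue_n R n)
    (@sigmaT_finite_lebesgue_n R n).

(* Functions on R^n are extended-real valued, so that [maximal f] has the same
   type as [f]. Cubes are closed; open or half-open ones give the same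
   maximal function and the same norms. *)

Section maximal.
Context (R : realType) (n : nat).
Implicit Types (f : Rn R n -> \bar R) (x : Rn R n).

Definition cube (a : n.-tuple R) (l : R) : set (Rn R n) :=
  [set x | forall i : 'I_n, (tnth a i <= tnth x i <= tnth a i + l)%R].

Definition cubes : set (set (Rn R n)) :=
  [set Q | exists a : n.-tuple R, exists2 l : R, (0 < l)%R & Q = cube a l].

Definition maximal f x : \bar R :=
  ereal_sup [set (\int[@lebesgue_n R n]_(y in Q) `|f y|) / lebesgue_n Q |
    Q in [set Q | cubes Q /\ Q x]].

End maximal.

Lemma cube_cons (R : realType) n (a : n.+1.-tuple R) l :
  (cube a l : set (n.+1.-tuple (measurableTypeR R))) =
  [set t | [set` `[thead a, (thead a + l)%R]] (thead t) /\
    cube [tuple of behead a] l ([tuple of behead t] : n.-tuple _)].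
Proof.
have tb T (u : n.+1.-tuple T) j :
    tnth [tuple of behead u] j = tnth u (lift ord0 j).
  by rewrite [in RHS](tuple_eta u) tnthS.
apply/seteqP; split => t /=.
  by move=> H; split=> [|i]; [rewrite in_itv/=; exact: H|rewrite !tb; exact: H].
move=> [H1 H2] i; case: (unliftP ord0 i) => [j ->|->].
  by rewrite -!tb; exact: H2.
by move: H1; rewrite in_itv.
Qed.

Lemma cubeE (R : realType) n (a : n.-tuple R) l : (0 <= l)%R ->
  measurable (cube a l : set (n.-tuple (measurableTypeR R))) /\
  borel_lebesgue R n (cube a l) = (l ^+ n)%:E.
Proof.
move=> l0; elim: n a => [a|n IH a].
  rewrite (_ : cube _ _ = setT); last by apply/seteqP; split => // t _ [].
  by split => //=; rewrite diracT.
have [mc vc] := IH [tuple of behead a].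
rewrite cube_cons; split.
  by apply: (@measurable_thead_behead R n _ (cube [tuple of behead a] l)).
apply: etrans.
  by apply: (@product_consE _ _ (borel_lebesgue R n) _
    (cube [tuple of behead a] l)).
rewrite vc lebesgue_measure_itv /= lte_fin exprS EFinM; congr (_ * _).
move: l0; rewrite le_eqVlt => /orP[/eqP <-|l0]; first by rewrite addr0 ltxx.
by rewrite ltrDl l0 -EFinB addrAC subrr add0r.
Qed.

Lemma lebesgue_cube (R : realType) n (a : n.-tuple R) l : (0 <= l)%R ->
  measurable (cube a l) /\ lebesgue_n (cube a l) = (l ^+ n)%:E.
Proof.
move=> l0; have [m v] := cubeE a l0; split.
  exact: caratheodory_measurable_mu_ext.
by rewrite -v; exact: measurable_mu_extE.
Qed.

Section variable_lebesgue.
Context (R : realType) (n : nat).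
Notation mu := (@lebesgue_n R n).
Implicit Types (p : Rn R n -> \bar R) (f : Rn R n -> \bar R).

Definition variable_exponent p :=
  measurable_fun [set: Rn R n] p /\ forall x, 1 <= p x.

(* t^p for t in [0, +oo] and p in [1, +oo]; [poweR] only has real exponents. *)
Definition epow (t p : \bar R) : \bar R :=
  if p is r%:E then poweR t r else if t <= 1 then 0 else +oo.

Definition modular p f : \bar R := \int[mu]_x epow `|f x| (p x).

Definition lux_norm p f : \bar R :=
  ereal_inf [set l%:E | l in
    [set l : R | (0 < l)%R /\ modular p (fun x => f x / l%:E) <= 1]].

Definition Lvar p : set (Rn R n -> \bar R) :=
  [set f | measurable_fun [set: Rn R n] f /\ lux_norm p f < +oo].

(* See [hoelder_conjugateP]: 1/p + 1/p' = 1, with 1/oo = 0. *)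
Definition conj_exponent p : Rn R n -> \bar R :=
  fun x => hoelder_conjugate (p x).

Definition muckenhoupt_const p : \bar R :=
  ereal_sup [set lux_norm p (EFin \o \1_Q) *
                 lux_norm (conj_exponent p) (EFin \o \1_Q) / mu Q |
    Q in @cubes R n].

Definition muckenhoupt p := muckenhoupt_const p < +oo.

(* In [\bar R], [+oo^-1 = 0] and [0^-1 = +oo]. *)
Definition nekvinda_exponent p (q : \bar R) : Rn R n -> \bar R :=
  fun x => `|(p x)^-1 - q^-1|^-1.

Definition nekvinda_limits p : set (\bar R) :=
  [set q | 1 <= q /\ Lvar (nekvinda_exponent p q) (cst 1)].

Definition nekvinda p := nekvinda_limits p !=set0.

(* [nekvinda_limits p] has at most one element: if it contained q and q' with
   d = |1/q - 1/q'| > 0, then one of the two exponents |1/p(x) - 1/q|^-1,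
   |1/p(x) - 1/q'|^-1 would be at most 2/d at every x, so that no constant on
   R^n, n > 0, could lie in both spaces. The choice made by [get] is thus
   irrelevant. *)
Definition nekvinda_const p : \bar R :=
  lux_norm (nekvinda_exponent p (get (nekvinda_limits p))) (cst 1).

End variable_lebesgue.

(* Main.v *)
Require Import Defs.
From HB Require Import structures.
From mathcomp Require Import all_boot all_order all_algebra.
From mathcomp Require Import all_classical all_reals all_analysis.
From mathcomp Require Import measurable_realfun ess_sup_inf.
From mathcomp Require Import ring lra.

(** Put [y = 1/p]. Since [p'] is essentially bounded, [0 <= y <= 1/r] almost
    everywhere for some [r > 1], and [rpow t y] is [t^p]. By homogeneity it is
    enough to find [C], depending on the three constants, such that the modular
    of [Mf / C] is at most 1 whenever the modular of [f] is at most 1. Cubes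
    with rational corners and sides suffice, up to a factor [2^n], and monotone
    convergence reduces the claim to a maximum [M] of finitely many means.

    Large values of [M]. Let [Q] be a cube of measure [v <= 1] and [a] the mean
    of [y] over [Q]. Jensen's inequality for the logarithm shows that the norms
    of the indicator of [Q] are at least [v^a / e] and [v^(1-a) / e]
    ([rpow_mean_lower]), so the Muckenhoupt condition makes them comparable to
    these powers of [v] ([muckenhoupt_local]). For such a cube the weight
    [w = u^p'] with [u = max(1, c v^-(1-a))] is doubling with respect to large
    subsets of the dyadic descendants of [Q] ([dual_doubling]), hence satisfies
    a reverse Hoelder inequality ([reverse_holder]). This improves the dual
    condition from the reciprocal exponent [1 - y] to [1 - q y] for some
    [q > 1] ([dual_gain]) and yields a Jensen inequality with a gain
    ([jensen_gain]): if the mean [F] of [f] over [Q] is large, then the integral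
    of [(k F)^p] over [Q] is at most [|Q|] times the [q]-th power of the mean of
    [f^(p/q)]. As [q > 1], these right-hand sides can be summed over all levels
    [al 2^k] of [M] and over disjoint cubes selected by Vitali's argument
    ([max_mean_bound]); the cubes with a large mean are automatically small, so
    this controls [M] where it exceeds a fixed level ([local_maximal_bound]).

    Bounded values of [M]. The Nekvinda condition provides [g] in ]0, 1] such
    that [g^s] is integrable, where [1/s = |y - yi|]. For [t <= 1] one has
    [(g t)^p <= t^pi + g^s] with [pi = 1/yi], and symmetrically, so that up to
    an integrable error the variable exponent may be replaced by the constant
    [pi], for which the claim is the classical maximal inequality
    ([far_maximal_bound]). *)

Set Implicit Arguments.
Unset Strict Implicit.
Unset Printing Implicit Defensive.

Import Order.TTheory GRing.Theory Num.Theory.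
Import numFieldNormedType.Exports.

Local Open Scope classical_set_scope.
Local Open Scope ring_scope.
Local Open Scope ereal_scope.

(** * Powers with a reciprocal exponent *)

Section real_powers.
Context {R : realType}.
Local Open Scope ring_scope.

Lemma ler_powR_le1 (t a b : R) : 0 <= t <= 1 -> 0 < a -> a <= b ->
  t `^ b <= t `^ a.
Proof.
move=> /andP[t0 t1] a0 ab; have [->|tn0] := eqVneq t 0.
  by rewrite !powR0// gt_eqF// (lt_le_trans a0).
rewrite /powR (negbTE tn0) ler_expR; apply: ler_wnM2r => //.
exact: ln_le0.
Qed.

Lemma powR_young (th X Y : R) : 0 <= th <= 1 -> 0 <= X -> 0 <= Y ->
  X `^ th * Y `^ (1 - th) <= th * X + (1 - th) * Y.
Proof.
move=> /andP[th0 th1] X0 Y0; have [->|thn0] := eqVneq th 0.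
  by rewrite powRr0 subr0 powRr1// mul0r !mul1r add0r.
have [->|thn1] := eqVneq th 1.
  by rewrite subrr powRr0 powRr1// mul0r mulr1 mul1r addr0.
have {thn0}th0 : 0 < th by rewrite lt_def thn0.
have {thn1}th1 : 0 < 1 - th by rewrite subr_gt0 lt_def eq_sym thn1.
have := @conjugate_powR R (X `^ th) (Y `^ (1 - th)) th^-1 (1 - th)^-1.
rewrite !powR_ge0 !invr_gt0 th0 th1 !invrK => /(_ isT isT isT isT).
rewrite addrC subrK => /(_ erefl) /le_trans; apply.
by rewrite -!powRrM !divff ?gt_eqF// !powRr1// mulrC (mulrC Y).
Qed.

Lemma gt0_powRD (x a b : R) : 0 < x -> x `^ (a + b) = x `^ a * x `^ b.
Proof. by move=> x0; rewrite powRD// (gt_eqF x0) implybT. Qed.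

End real_powers.

Section rpow.
Context {R : realType}.
Implicit Types (t s u y z v c a k th L q : R).

(** [t^p] in terms of the reciprocal [y = 1/p], with the convention of the
    modular for [p = +oo]. In the variable [y] duality is [y |-> 1 - y], and
    [y] times the logarithm of [t^p] is the logarithm of [t]. *)
Definition rpow t y : \bar R :=
  if y == 0%R then (if (t <= 1)%R then 0 else +oo) else (t `^ y^-1)%:E.

Lemma rpow_ge0 t y : 0 <= rpow t y.
Proof.
rewrite /rpow; case: ifP => _; last by rewrite lee_fin powR_ge0.
by case: ifP.
Qed.

Lemma rpowE t y : (0 < y)%R -> rpow t y = (t `^ y^-1)%:E.
Proof. by move=> y0; rewrite /rpow gt_eqF. Qed.

Lemma rpow0l y : rpow 0 y = 0.
Proof.
rewrite /rpow; case: eqP => [_|/eqP y0]; first by rewrite ler01.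
by rewrite powR0 ?invr_eq0.
Qed.

Lemma rpow1 t : (0 <= t)%R -> rpow t 1 = t%:E.
Proof. by move=> t0; rewrite rpowE// invr1 powRr1. Qed.

Lemma le_rpow s t y : (0 <= y)%R -> (0 <= s)%R -> (s <= t)%R ->
  rpow s y <= rpow t y.
Proof.
move=> y0 s0 st; rewrite /rpow; case: ifP => y00.
  case: ifPn => s1; case: ifPn => t1 //.
  by move: s1; rewrite (le_trans st).
rewrite lee_fin ge0_ler_powR ?invr_ge0// nnegrE//.
exact: le_trans st.
Qed.

Lemma rpow_le t y : (0 <= t <= 1)%R -> (0 <= y <= 1)%R -> rpow t y <= t%:E.
Proof.
move=> /andP[t0 t1] /andP[y0 y1]; rewrite /rpow; case: ifPn => y00.
  by rewrite t1 lee_fin.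
have {}y0 : (0 < y)%R by rewrite lt_def y00.
rewrite lee_fin -[leRHS]powRr1//; apply: ler_powR_le1 => //; first by rewrite t0.
by rewrite invf_ge1.
Qed.

Lemma rpow_le1 t y : (0 <= t <= 1)%R -> (0 <= y <= 1)%R -> rpow t y <= 1.
Proof.
move=> t01 y01; apply: le_trans (rpow_le t01 y01) _.
by rewrite lee_fin; case/andP: t01.
Qed.

Lemma rpow_ge1 t y : (1 < t)%R -> (0 <= y <= 1)%R -> t%:E <= rpow t y.
Proof.
move=> t1 /andP[y0 y1]; rewrite /rpow; case: ifPn => y00.
  by rewrite (leNgt t) t1 leey.
have {}y0 : (0 < y)%R by rewrite lt_def y00.
by rewrite lee_fin le1r_powR ?(ltW t1)// invf_ge1.
Qed.

(** Exponents are at least 1, so a contraction of [t] gains a full factor: a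
    modular bounded by a constant becomes bounded by 1 after rescaling. *)
Lemma rpow_scale k t y : (0 < k <= 1)%R -> (0 <= t)%R -> (0 <= y <= 1)%R ->
  rpow (k * t) y <= k%:E * rpow t y.
Proof.
move=> /andP[k0 k1] t0 /andP[y0 y1]; have kt0 : (0 <= k * t)%R by rewrite mulr_ge0// ltW.
rewrite /rpow; case: ifPn => y00.
  case: (leP t 1%R) => t1; last by rewrite mulry gtr0_sg// mul1e leey.
  by rewrite mulr_ile1// ?mule0// ltW.
have {}y0 : (0 < y)%R by rewrite lt_def y00.
rewrite lee_fin powRM// ?(ltW k0)// ler_wpM2r ?powR_ge0//.
rewrite -[leRHS]powRr1 ?(ltW k0)//; apply: ler_powR_le1 => //.
  by rewrite (ltW k0).
by rewrite invf_ge1.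
Qed.

(** Dilations cost a bounded factor only where the exponent [1/y] is bounded,
    which is the case for the dual exponent. *)
Lemma rpow_scale_up k t y (P : R) : (1 <= k)%R -> (0 <= t)%R ->
  (0 < P)%R -> (P^-1 <= y)%R -> rpow (k * t) y <= (k `^ P)%:E * rpow t y.
Proof.
move=> k1 t0 P0 Py; have y0 : (0 < y)%R by rewrite (lt_le_trans _ Py)// invr_gt0.
have k0 : (0 <= k)%R by rewrite (le_trans _ k1).
rewrite !rpowE// lee_fin powRM// ler_wpM2r ?powR_ge0// ler_powR//.
by rewrite -[leRHS]invrK lef_pV2// posrE// invr_gt0.
Qed.

(** Young's inequality for the conjugate exponents [1/z] and [1/(1 - z)]; at
    the end points one of the two terms is infinite unless its base is at most 1. *)
Lemma rpow_young s t z : (0 <= s)%R -> (0 <= t)%R -> (0 <= z <= 1)%R ->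
  (s * t)%:E <= rpow s z + rpow t (1 - z).
Proof.
move=> s0 t0 /andP[z0 z1]; have [->|zn0] := eqVneq z 0%R.
  rewrite subr0 rpow1// /rpow eqxx; case: ifPn => s1.
    by rewrite add0e lee_fin ler_piMl.
  by rewrite addye// leey.
have [->|zn1] := eqVneq z 1%R.
  rewrite subrr rpow1// /rpow eqxx; case: ifPn => t1.
    by rewrite adde0 lee_fin ler_piMr.
  by rewrite addey// leey.
have {zn0}z0 : (0 < z)%R by rewrite lt_def zn0.
have {zn1}z1 : (0 < 1 - z)%R by rewrite subr_gt0 lt_def eq_sym zn1.
rewrite !rpowE// -EFinD lee_fin.
have := @powR_young R z (s `^ z^-1) (t `^ (1 - z)^-1).
rewrite -!powRrM !mulVf ?gt_eqF// !powRr1// !powR_ge0 (ltW z0).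
rewrite -[(z <= 1)%R]subr_ge0 (ltW z1) => /(_ isT isT isT) /le_trans; apply.
apply: lerD; rewrite ler_piMl ?powR_ge0//.
  by rewrite -subr_ge0 ltW.
by rewrite gerBl ltW.
Qed.

(** Geometric interpolation between the bases [c v^-a] and [c], followed by the
    weighted arithmetic-geometric inequality; the powers of [v] are chosen so
    that both terms balance when integrated over a set of measure [v]. *)
Lemma rpow_interp th v a c y : (0 <= th <= 1)%R -> (0 < v <= 1)%R ->
  (0 <= a)%R -> (0 < c <= 1)%R -> (0 <= y)%R ->
  rpow (c * v `^ (- (th * a))) y <=
  (v `^ (- th) * (th * v))%:E * rpow (c * v `^ (- a)) y +
  (v `^ (- th) * (1 - th))%:E.
Proof.
move=> /andP[th0 th1] /andP[v0 v1] a0 /andP[c0 c1] y0.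
have vth : (v `^ (- (th * a)) <= v `^ (- a))%R.
  rewrite !powRN lef_pV2 ?posrE ?powR_gt0//.
  rewrite /powR gt_eqF// ler_expR; apply: ler_wnM2r; first exact: ln_le0.
  by rewrite ler_piMl.
have v0' : (0 <= v `^ (- th))%R by rewrite powR_ge0.
have r0 : 0 <= (v `^ (- th) * (1 - th))%:E by rewrite lee_fin mulr_ge0// subr_ge0.
have [->|yn0] := eqVneq y 0%R.
  rewrite /rpow eqxx; case: (leP (c * v `^ (- a))%R 1%R) => H.
    rewrite mule0 add0e (_ : (c * v `^ (- (th * a)) <= 1)%R)//.
    by apply: le_trans H; rewrite ler_wpM2l// ltW.
  have [->|thn0] := eqVneq th 0%R.
    rewrite mul0r oppr0 powRr0 mulr1 c1 mul1r mul0r mul0e add0e.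
    by rewrite addr0 mul1r lee_fin ler01.
  have {thn0}th0 : (0 < th)%R by rewrite lt_def thn0.
  rewrite gt0_muley ?lte_fin ?mulr_gt0 ?powR_gt0//.
  by rewrite addye// leey.
have {yn0}y0 : (0 < y)%R by rewrite lt_def yn0.
rewrite !rpowE// -EFinM -EFinD lee_fin.
set X := ((c * v `^ (- a)) `^ y^-1)%R.
have X0 : (0 <= X)%R by exact: powR_ge0.
apply: (@le_trans _ _ (X `^ th)%R).
  rewrite /X powRAC; apply: ge0_ler_powR; rewrite ?invr_ge0 ?nnegrE ?(ltW y0) ?powR_ge0//.
    by rewrite mulr_ge0 ?powR_ge0// ltW.
  rewrite powRM ?powR_ge0 ?(ltW c0)// -powRrM mulNr mulrC.
  rewrite [(a * th)%R]mulrC [leRHS]mulrC ler_wpM2l ?powR_ge0//.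
  have [->|thn0] := eqVneq th 0%R; first by rewrite powRr0.
  rewrite -[leLHS]powRr1 ?(ltW c0)//; apply: ler_powR_le1 => //.
    by rewrite (ltW c0).
  by rewrite lt_def thn0.
have := @powR_young R th (v * X)%R 1%R.
rewrite powR1 mulr1 th0 th1 mulr_ge0 ?(ltW v0)// ler01 => /(_ isT isT isT).
rewrite powRM ?(ltW v0)// => H.
rewrite -(ler_pM2l (powR_gt0 th v0)); apply: (le_trans H).
rewrite mulr1 mulrDr -!mulrA !(mulrA (v `^ th)%R) -powRD; last first.
  by rewrite subrr eqxx /= gt_eqF.
by rewrite subrr powRr0 !mul1r.
Qed.

(** This is [ln X <= X - 1] for [X = v L^(1/y)], multiplied by [y]. The left
    side is affine in [y], so it can be averaged over a set. *)
Lemma rpow_ln L v y : (1 <= L)%R -> (0 < v)%R -> (0 <= y <= 1)%R ->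
  (ln L + y * ln v)%:E <= v%:E * rpow L y.
Proof.
move=> L1 v0 /andP[y0 y1]; have L0 : (0 < L)%R by rewrite (lt_le_trans _ L1).
have [->|yn0] := eqVneq y 0%R.
  rewrite /rpow eqxx mul0r addr0; case: ifPn => L1'.
    by rewrite mule0 lee_fin ln_le0.
  by rewrite mulry gtr0_sg// mul1e leey.
have {yn0}y0 : (0 < y)%R by rewrite lt_def yn0.
rewrite rpowE// -EFinM lee_fin.
set X := (v * L `^ y^-1)%R; have X0 : (0 < X)%R by rewrite mulr_gt0// powR_gt0.
have -> : (ln L + y * ln v = y * ln X)%R.
  rewrite /X lnM ?posrE ?powR_gt0// ln_powR mulrDr mulrA divff ?gt_eqF// mul1r.
  by rewrite addrC.
have lnX : (ln X <= X - 1)%R.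
  by have := @le_ln1Dx R (X - 1); rewrite addrCA subrr addr0; apply; lra.
apply: (@le_trans _ _ (y * X)%R).
  by rewrite ler_pM2l// (le_trans lnX)// gerBl.
by rewrite ler_piMl// ltW.
Qed.

Lemma le_rpow_exp_le1 t y z : (0 <= t <= 1)%R -> (0 <= y)%R -> (y <= z)%R ->
  rpow t y <= rpow t z.
Proof.
move=> t01 y0 yz; have [->|yn0] := eqVneq y 0%R.
  by rewrite {1}/rpow eqxx; case/andP: t01 => _ ->; exact: rpow_ge0.
have {yn0}y0 : (0 < y)%R by rewrite lt_def yn0.
rewrite !rpowE ?(lt_le_trans y0)// lee_fin; apply: ler_powR_le1 => //.
  by rewrite invr_gt0 (lt_le_trans y0).
by rewrite lef_pV2// posrE (lt_le_trans y0).
Qed.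

(** Change of exponent at the cost of an error that depends only on the
    difference of the reciprocals: Young's inequality with weights [z/y] and
    [1 - z/y]. For [y <= z] the power of a base at most 1 just grows. *)
Lemma rpow_perturb k t y z : (0 <= k <= 1)%R -> (0 <= t <= 1)%R ->
  (0 <= y)%R -> (0 <= z)%R ->
  rpow (k * t) y <= rpow t z + rpow k `|y - z|%R.
Proof.
move=> /andP[k0 k1] /andP[t0 t1] y0 z0.
have kt0 : (0 <= k * t)%R by exact: mulr_ge0.
have kt : (k * t <= t)%R by rewrite ler_piMl.
have [yz|zy] := leP y z.
  apply: (@le_trans _ _ (rpow t z)); last by rewrite leeDl// rpow_ge0.
  apply: (le_trans (le_rpow y0 kt0 kt)).
  by apply: le_rpow_exp_le1 => //; rewrite t0.
have {}y0 : (0 < y)%R by rewrite (le_lt_trans z0).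
rewrite gtr0_norm ?subr_gt0//.
have [z00|zn0] := eqVneq z 0%R.
  apply: (@le_trans _ _ (rpow k (y - z))); last by rewrite leeDr// rpow_ge0.
  by rewrite z00 subr0 le_rpow ?(ltW y0)// ler_piMr.
have {zn0}z0 : (0 < z)%R by rewrite lt_def zn0.
rewrite !rpowE ?subr_gt0// -EFinD lee_fin powRM//.
have zy1 : (0 <= z / y <= 1)%R.
  by rewrite divr_ge0 ?(ltW z0) ?(ltW y0)//= ler_pdivrMr// mul1r ltW.
have yz1 : (1 - z / y = (y - z) / y)%R by rewrite mulrBl divff ?gt_eqF.
have := powR_young zy1 (powR_ge0 t z^-1) (powR_ge0 k (y - z)^-1).
rewrite yz1 -!powRrM !mulrA !mulVf ?gt_eqF ?subr_gt0// !mul1r mulrC => /le_trans; apply.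
apply: lerD; rewrite ler_piMl ?powR_ge0//.
  by case/andP: zy1.
by rewrite -yz1 gerBl; case/andP: zy1.
Qed.

Lemma le_rpow_max s t u y : (0 <= u)%R -> (0 <= y)%R -> (u <= Num.max s t)%R ->
  rpow u y <= rpow s y + rpow t y.
Proof.
move=> u0 y0; case: (leP s t) => st us.
  by apply: (le_trans (le_rpow y0 u0 us)); rewrite leeDr// rpow_ge0.
by apply: (le_trans (le_rpow y0 u0 us)); rewrite leeDl// rpow_ge0.
Qed.

Lemma rpowM_exp t q y : (0 <= y)%R -> (0 < q)%R -> rpow t y < +oo ->
  rpow t (q * y) = (fine (rpow t (q * y)))%:E /\
  (fine (rpow t (q * y)) `^ q = fine (rpow t y))%R.
Proof.
move=> y0 q0; have [->|yn0] := eqVneq y 0%R.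
  rewrite mulr0 /rpow eqxx; case: ifP => // _ _; split => //=.
  by rewrite powR0// gt_eqF.
have {yn0}y0 : (0 < y)%R by rewrite lt_def yn0.
rewrite !rpowE ?mulr_gt0//= => _; split=> //.
by rewrite -powRrM invfM mulrAC mulVf ?mul1r// gt_eqF.
Qed.

End rpow.

Lemma measurable_rpow d (T : measurableType d) (R : realType) (f y : T -> R) :
  measurable_fun setT f -> measurable_fun setT y ->
  (forall x, 0 <= f x)%R -> (forall x, 0 <= y x)%R ->
  measurable_fun setT (fun x => rpow (f x) (y x)).
Proof.
move=> mf my f0 y0.
have minv : measurable_fun setT (fun x => (y x)^-1)%R.
  rewrite (_ : (fun x => (y x)^-1)%R = (fun x => y x `^ (-1))%R).
    exact: measurableT_comp (measurable_powR (-1)) my.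
  by apply/funext => x; rewrite powR_inv1.
rewrite /rpow; apply: measurable_fun_ifT.
- by apply: measurable_fun_eqr => //; exact: measurable_cst.
- apply: measurable_fun_ifT => //.
  by apply: measurable_fun_ler => //; exact: measurable_cst.
apply/measurable_EFinP; rewrite /powR; apply: measurable_fun_ifT.
- by apply: measurable_fun_eqr => //; exact: measurable_cst.
- rewrite (_ : (fun t => _) =
    (fun t => if (y t)^-1%R == 0%R then 1%R else 0%R : R)); last first.
    by apply/funext => t; case: ifP.
  apply: measurable_fun_ifT => //.
  by apply: measurable_fun_eqr => //; exact: minv.
apply: measurableT_comp => //; apply: measurable_funM => //.
by apply: measurableT_comp => //; exact: measurable_ln.
Qed.

(** * Jensen's inequality for a variable exponent *)

Section jensen.
Context d (T : measurableType d) (R : realType).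
Variable mu : {measure set T -> \bar R}.
Variables (D : set T) (v : R).
Hypotheses (mD : measurable D) (muD : mu D = v%:E) (v01 : (0 < v <= 1)%R).
Implicit Types (z f : T -> R) (a c q F G th : R).

Let v0 : (0 < v)%R. Proof. by case/andP: v01. Qed.
Let v1 : (v <= 1)%R. Proof. by case/andP: v01. Qed.

Lemma measurable_rpowc t z : measurable_fun setT z -> (forall x, 0 <= z x)%R ->
  (0 <= t)%R -> measurable_fun setT (fun x => rpow t (z x)).
Proof. by move=> mz z0 t0; apply: measurable_rpow. Qed.

(** The power [1 - th] of the measure is the gain of interpolation: the bound 1
    holds at [th = 1], and the trivial bound [v] at [th = 0]. *)
Lemma integral_rpow_interp z a c th :
  measurable_fun setT z -> (forall x, 0 <= z x)%R ->
  (0 <= a)%R -> (0 < c <= 1)%R -> (0 <= th <= 1)%R ->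
  \int[mu]_(x in D) rpow (c * v `^ (- a)) (z x) <= 1 ->
  \int[mu]_(x in D) rpow (c * v `^ (- (th * a))) (z x) <= (v `^ (1 - th))%:E.
Proof.
move=> mz z0 a0 c01 th01 H; have c0 : (0 <= c)%R by case/andP: c01 => /ltW.
have ct (t : R) : (0 <= c * v `^ t)%R by rewrite mulr_ge0// powR_ge0.
case/andP: (th01) => th0 th1.
apply: (@le_trans _ _ (\int[mu]_(x in D)
   ((v `^ (- th) * (th * v))%:E * rpow (c * v `^ (- a)) (z x) +
    (v `^ (- th) * (1 - th))%:E))).
  apply: ge0_le_integral => //.
  - by move=> x _; exact: rpow_ge0.
  - by apply: measurable_funTS; exact: measurable_rpowc.
  - apply: measurable_funTS; apply: emeasurable_funD => //.
    by apply: measurable_funeM; exact: measurable_rpowc.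
  - by move=> x _; exact: rpow_interp.
rewrite ge0_integralD//; last 3 first.
- by move=> x _; rewrite mule_ge0 ?rpow_ge0// lee_fin !mulr_ge0 ?powR_ge0 ?(ltW v0).
- apply: measurable_funTS.
  by apply: measurable_funeM; exact: measurable_rpowc.
- by move=> x _; rewrite lee_fin mulr_ge0 ?powR_ge0// subr_ge0.
rewrite ge0_integralZl//; last 3 first.
- by apply: measurable_funTS; exact: measurable_rpowc.
- by move=> x _; exact: rpow_ge0.
- by rewrite lee_fin !mulr_ge0 ?powR_ge0 ?(ltW v0).
rewrite integral_cst// muD -EFinM.
apply: (@le_trans _ _ ((v `^ (- th) * (th * v))%:E * 1 +
   (v `^ (- th) * (1 - th) * v)%:E)).
  by rewrite leeD2r// lee_wpmul2l// lee_fin !mulr_ge0 ?powR_ge0 ?(ltW v0).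
rewrite mule1 -EFinD lee_fin -mulrA -mulrDr -mulrDl addrCA subrr addr0 mul1r.
by rewrite gt0_powRD// powRr1 ?(ltW v0)// mulrC.
Qed.

(** Hoelder's inequality: [f] is tested against a constant whose dual modular
    is at most 1. *)
Lemma mean_dual_bound z f a c F :
  measurable_fun setT z -> (forall x, 0 <= z x <= 1)%R ->
  measurable_fun setT f -> (forall x, 0 <= f x)%R ->
  (0 < c)%R ->
  \int[mu]_(x in D) rpow (c * v `^ (- (1 - a))) (1 - z x) <= 1 ->
  \int[mu]_(x in D) rpow (f x) (z x) <= 1 ->
  \int[mu]_(x in D) (f x)%:E = (F * v)%:E ->
  (c / 2 * F <= v `^ (- a))%R.
Proof.
move=> mz z01 mf f0 c0 H1 H2 HF.
have z0 x : (0 <= z x)%R by case/andP: (z01 x).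
have z1 x : (0 <= 1 - z x)%R by rewrite subr_ge0; case/andP: (z01 x).
set s := (c * v `^ (- (1 - a)))%R in H1 *.
have s0 : (0 <= s)%R by rewrite mulr_ge0 ?(ltW c0)// powR_ge0.
have mz' : measurable_fun setT (fun x => 1 - z x)%R by exact: measurable_funB.
have : \int[mu]_(x in D) (s%:E * (f x)%:E) <= 1 + 1.
  apply: (@le_trans _ _ (\int[mu]_(x in D) (rpow (f x) (z x) + rpow s (1 - z x)))).
    apply: ge0_le_integral => //.
    - by move=> x _; rewrite lee_fin mulr_ge0.
    - apply: measurable_funTS; apply: measurable_funeM.
      exact/measurable_EFinP.
    - apply: measurable_funTS; apply: emeasurable_funD.
        exact: measurable_rpow.
      exact: measurable_rpowc.
    - by move=> x _; rewrite -EFinM mulrC; exact: rpow_young.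
  rewrite ge0_integralD//.
  - exact: leeD H2 H1.
  - by move=> x _; exact: rpow_ge0.
  - by apply: measurable_funTS; exact: measurable_rpow.
  - by move=> x _; exact: rpow_ge0.
  - by apply: measurable_funTS; exact: measurable_rpowc.
rewrite ge0_integralZl//; last 2 first.
- by apply: measurable_funTS; exact/measurable_EFinP.
- by move=> x _; rewrite lee_fin.
rewrite HF -EFinM -EFinD lee_fin /s.
have -> : (- (1 - a) = a + - 1)%R by ring.
rewrite gt0_powRD// powR_inv1 ?(ltW v0)// powRN => H.
have va0 := powR_gt0 a v0.
rewrite -(@ler_pM2l _ (2 * v `^ a))%R ?mulr_gt0//.
rewrite [leRHS]mulfK ?gt_eqF//.
rewrite (_ : 2 * v `^ a * (c / 2 * F) = c * (v `^ a / v) * (F * v))%R//.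
by field; rewrite gt_eqF.
Qed.

(** By [mean_dual_bound] the normalized mean [X = (c/2) F] lies between 1 and
    [v^-a], so [X = v^(-th a)] for some [th] in [0, 1], and interpolation bounds
    the left side by [v^(1 - th)]. On the other hand, testing [f] against the
    interpolated dual condition for [q z], at parameter [th/q], shows that [G]
    is at least [v^(-th/q)]; hence [v^(1 - th) <= v G^q]. *)
Lemma jensen_gain z f a c q F G :
  measurable_fun setT z -> (forall x, 0 <= z x)%R ->
  (1 <= q)%R -> (forall x, q * z x <= 1)%R ->
  measurable_fun setT f -> (forall x, 0 <= f x)%R ->
  (0 <= a)%R -> (q * a <= 1)%R -> (0 < c <= 1)%R ->
  \int[mu]_(x in D) rpow (c * v `^ (- a)) (z x) <= 1 ->
  \int[mu]_(x in D) rpow (c * v `^ (- (1 - a))) (1 - z x) <= 1 ->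
  \int[mu]_(x in D) rpow (c * v `^ (- (1 - q * a))) (1 - q * z x) <= 1 ->
  \int[mu]_(x in D) rpow (f x) (z x) <= 1 ->
  \int[mu]_(x in D) (f x)%:E = (F * v)%:E ->
  (2 / c <= F)%R ->
  \int[mu]_(x in D) rpow (f x) (q * z x) = (G * v)%:E ->
  \int[mu]_(x in D) rpow (c * (c / 2 * F)) (z x) <= (v * G `^ q)%:E.
Proof.
move=> mz z0 q1 qz1 mf f0 a0 qa1 c01 Hp Hd Hq Hf HF FC HG.
have [c0 c1] : (0 < c /\ c <= 1)%R by case/andP: c01.
have q0 : (0 < q)%R by rewrite (lt_le_trans _ q1).
have z1 x : (z x <= 1)%R by rewrite (le_trans _ (qz1 x))// ler_peMl.
have z01 x : (0 <= z x <= 1)%R by rewrite z0 z1.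
have X1 : (1 <= c / 2 * F)%R.
  rewrite -(@ler_pM2l _ (2 / c)) ?divr_gt0// mulr1 (le_trans FC)// le_eqVlt.
  by apply/orP; left; apply/eqP; field; rewrite gt_eqF.
have X0 : (0 < c / 2 * F)%R by rewrite (lt_le_trans _ X1).
have Xv := mean_dual_bound mz z01 mf f0 c0 Hd Hf HF.
have [th th01 Xth] : exists2 th : R, (0 <= th <= 1)%R &
    (c / 2 * F = v `^ (- (th * a)))%R.
  have [va1|va1] := eqVneq (v `^ (- a))%R 1%R.
    exists 0%R; first by rewrite lexx ler01.
    rewrite mul0r oppr0 powRr0; apply/eqP; rewrite eq_le X1 andbT.
    by rewrite (le_trans Xv)// va1.
  have L0 : (0 < ln (v `^ (- a)))%R.
    rewrite ln_gt0// lt_neqAle eq_sym va1/=.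
    exact: le_trans Xv.
  exists (ln (c / 2 * F) / ln (v `^ (- a)))%R.
    rewrite divr_ge0 ?(ltW L0) ?ln_ge0//= ler_pdivrMr// mul1r ler_ln// posrE//.
    by rewrite powR_gt0.
  apply: ln_inj; rewrite ?posrE ?powR_gt0//.
  move: L0; rewrite !ln_powR => L0.
  have an0 : a != 0%R by apply: contraTneq L0 => ->; rewrite oppr0 mul0r ltxx.
  have lvn0 : ln v != 0%R by apply: contraTneq L0 => ->; rewrite mulr0 ltxx.
  by field; rewrite an0 lvn0.
have [th0 th1] : (0 <= th /\ th <= 1)%R by case/andP: th01.
rewrite Xth; apply: le_trans (integral_rpow_interp mz z0 a0 c01 th01 Hp) _.
rewrite lee_fin.
rewrite gt0_powRD// powRr1 ?(ltW v0)// ler_pM2l//.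
(* the constant against which [f] is tested, from the dual condition for [q z] *)
set s := (c * v `^ (- ((th / q) * (1 - q * a))))%R.
have s0 : (0 <= s)%R by rewrite mulr_ge0 ?powR_ge0 ?(ltW c0).
have thq : (0 <= th / q <= 1)%R.
  by rewrite divr_ge0 ?(ltW q0)//= ler_pdivrMr// mul1r (le_trans th1).
have mqz : measurable_fun setT (fun x => q * z x)%R by exact: measurable_funM.
have mz' : measurable_fun setT (fun x => 1 - q * z x)%R by exact: measurable_funB.
have qz0 x : (0 <= q * z x)%R by rewrite mulr_ge0 ?(ltW q0).
have z1q x : (0 <= 1 - q * z x)%R by rewrite subr_ge0.
have Hs : \int[mu]_(x in D) rpow s (1 - q * z x) <= (v `^ (1 - th / q))%:E.
  have qa0 : (0 <= 1 - q * a)%R by rewrite subr_ge0.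
  exact: integral_rpow_interp mz' z1q qa0 c01 thq Hq.
have : \int[mu]_(x in D) (s%:E * (f x)%:E) <= (G * v)%:E + (v `^ (1 - th / q))%:E.
  apply: (@le_trans _ _ (\int[mu]_(x in D) (rpow (f x) (q * z x) + rpow s (1 - q * z x)))).
    apply: ge0_le_integral => //.
    - by move=> x _; rewrite lee_fin mulr_ge0.
    - apply: measurable_funTS; apply: measurable_funeM.
      exact/measurable_EFinP.
    - apply: measurable_funTS; apply: emeasurable_funD.
        exact: measurable_rpow.
      exact: measurable_rpowc.
    - by move=> x _; rewrite -EFinM mulrC; apply: rpow_young; rewrite ?qz0 ?qz1.
  rewrite ge0_integralD//.
  - by rewrite HG leeD.
  - by move=> x _; exact: rpow_ge0.
  - by apply: measurable_funTS; exact: measurable_rpow.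
  - by move=> x _; exact: rpow_ge0.
  - by apply: measurable_funTS; exact: measurable_rpowc.
rewrite ge0_integralZl//; last 2 first.
- by apply: measurable_funTS; exact/measurable_EFinP.
- by move=> x _; rewrite lee_fin.
rewrite HF -EFinM -EFinD lee_fin.
have -> : (s * (F * v) = 2 * v * v `^ (- (th / q)))%R.
  rewrite /s (_ : F = 2 / c * (c / 2 * F))%R; last first.
    by field; rewrite gt_eqF.
  rewrite Xth.
  rewrite (_ : - (th / q * (1 - q * a)) = - (th / q) + th * a)%R; last first.
    by field; rewrite gt_eqF.
  rewrite gt0_powRD// (powRN _ (th * a)).
  by field; rewrite !gt_eqF ?powR_gt0.
rewrite gt0_powRD// powRr1 ?(ltW v0)// => H.
have {}H : (v `^ (- (th / q)) <= G)%R.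
  by rewrite -(ler_pM2r v0); lra.
rewrite (_ : - th = - (th / q) * q)%R; last by field; rewrite gt_eqF.
rewrite powRrM; apply: ge0_ler_powR => //; rewrite ?nnegrE ?powR_ge0 ?(ltW q0)//.
by rewrite (le_trans _ H)// powR_ge0.
Qed.

End jensen.

(** * Reverse Hoelder inequality on a binary tree of sets *)

Section reverse_holder.
Context d (T : measurableType d) (R : realType).
Variable mu : {measure set T -> \bar R}.
Variables (N : seq bool -> set T) (V : R) (w : T -> R) (B C : R).
Hypotheses (mN : forall s, measurable (N s))
  (NU : forall s, N s = N (false :: s) `|` N (true :: s))
  (Ndisj : forall s, N (false :: s) `&` N (true :: s) = set0)
  (Nmu : forall s, mu (N s) = (V / 2 ^+ size s)%:E)
  (V0 : (0 < V)%R)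
  (mw : measurable_fun setT w) (w0 : forall x, (0 <= w x)%R)
  (wB : forall x, (w x <= B)%R) (C1 : (1 <= C)%R).
Hypothesis w_doubling : forall s E, measurable E -> E `<=` N s ->
  mu (N s) <= 2%:E * mu E ->
  \int[mu]_(x in N s) (w x)%:E <= C%:E * \int[mu]_(x in E) (w x)%:E.
Hypothesis N_dense : forall G, measurable G -> G `<=` N [::] -> 0 < mu G ->
  exists s, (3 / 4)%:E * mu (N s) <= mu (G `&` N s).

Local Notation W E := (\int[mu]_(x in E) (w x)%:E).
Let Wr E := fine (W E).
Let mr E := fine (mu E).

Let ok E := measurable E /\ E `<=` N [::].

Lemma node_sub s : N s `<=` N [::].
Proof.
elim: s => // b s; apply: subset_trans; rewrite [X in _ `<=` X]NU.
by case: b; [exact: subsetUr|exact: subsetUl].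
Qed.

Lemma okN s : ok (N s).
Proof. by split => //; exact: node_sub. Qed.

Lemma mwE D : measurable_fun D (fun x => (w x)%:E).
Proof. by apply: measurable_funTS; exact/measurable_EFinP. Qed.

#[local] Hint Resolve mwE okN : core.

Lemma muE E : ok E -> mu E = (mr E)%:E.
Proof.
move=> [mE EN]; rewrite /mr fineK// ge0_fin_numE//.
apply: (@le_lt_trans _ _ (mu (N [::]))); first by apply: le_measure; rewrite ?inE.
by rewrite Nmu ltry.
Qed.

Lemma WE E : ok E -> W E = (Wr E)%:E.
Proof.
move=> okE; have [mE EN] := okE.
rewrite /Wr fineK// ge0_fin_numE; last first.
  by apply: integral_ge0 => x _; rewrite lee_fin.
apply: (@le_lt_trans _ _ (\int[mu]_(x in E) B%:E)).
  by apply: ge0_le_integral => //; move=> x _; rewrite lee_fin.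
by rewrite integral_cst// (muE okE) -EFinM ltry.
Qed.

Lemma okU E F : ok E -> ok F -> ok (E `|` F).
Proof. by move=> [? ?] [? ?]; split; [exact: measurableU|rewrite subUset]. Qed.

Lemma okD E F : ok E -> ok F -> ok (E `\` F).
Proof.
move=> [mE EN] [mF FN]; split; first exact: measurableD.
by move=> x [/EN].
Qed.

Lemma WrU E F : ok E -> ok F -> E `&` F = set0 -> (Wr (E `|` F) = Wr E + Wr F)%R.
Proof.
move=> okE okF EF; apply: EFin_inj; rewrite EFinD -!WE//; last exact: okU.
have [mE _] := okE; have [mF _] := okF.
apply: ge0_integral_setU => //; first by move=> x _; rewrite lee_fin.
by apply/disj_set2P.
Qed.

Lemma mrU E F : ok E -> ok F -> E `&` F = set0 -> (mr (E `|` F) = mr E + mr F)%R.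
Proof.
move=> okE okF EF; apply: EFin_inj; rewrite EFinD -!muE//; last exact: okU.
have [mE _] := okE; have [mF _] := okF.
exact: measureU.
Qed.

Lemma Wr_ge0 E : (0 <= Wr E)%R.
Proof. by apply: fine_ge0; apply: integral_ge0 => x _; rewrite lee_fin. Qed.

Lemma mrN s : (mr (N s) = V / 2 ^+ size s)%R.
Proof. by rewrite /mr Nmu. Qed.

Lemma mrN_gt0 s : (0 < mr (N s))%R.
Proof. by rewrite mrN divr_gt0// exprn_gt0. Qed.

Lemma mr_child b s : (mr (N s) = 2 * mr (N (b :: s)))%R.
Proof.
by rewrite !mrN/= exprS; field; rewrite expf_neq0.
Qed.

Lemma Wr_node s : (Wr (N s) = Wr (N (false :: s)) + Wr (N (true :: s)))%R.
Proof. by rewrite -WrU -?NU. Qed.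

(** The Calderon-Zygmund stopping set: the maximal nodes below [s], up to depth
    [n], over which the mean of [w] exceeds [lam]. *)
Fixpoint stopping (lam : R) (n : nat) (s : seq bool) : set T :=
  if (lam * mr (N s) < Wr (N s))%R then N s
  else if n is m.+1 then
    stopping lam m (false :: s) `|` stopping lam m (true :: s)
  else set0.

Lemma stop_sub lam n s : stopping lam n s `<=` N s.
Proof.
elim: n s => [|n IH] s /=; case: ifP => _ //.
by rewrite [X in _ `<=` X]NU; apply: setUSS; exact: IH.
Qed.

Lemma ok_stop lam n s : ok (stopping lam n s).
Proof.
elim: n s => [|n IH] s /=; case: ifP => _ //; last exact: okU.
by split; [exact: measurable0|exact: sub0set].
Qed.

#[local] Hint Resolve ok_stop : core.

Lemma stop_disj lam lam' n s :
  stopping lam n (false :: s) `&` stopping lam' n (true :: s) = set0.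
Proof.
rewrite -subset0 -(Ndisj s); apply: setISS; exact: stop_sub.
Qed.

#[local] Hint Resolve stop_disj mrN_gt0 Wr_ge0 : core.

Lemma mr0 : mr set0 = 0%R.
Proof. by rewrite /mr measure0. Qed.
Lemma Wr0 : Wr set0 = 0%R.
Proof. by rewrite /Wr integral_set0. Qed.

Lemma stop_weak lam n s : (0 <= lam)%R ->
  (lam * mr (stopping lam n s) <= Wr (N s))%R.
Proof.
move=> l0; elim: n s => [|n IH] s /=; case: ifPn => h; rewrite ?(ltW h)//.
  by rewrite mr0 mulr0 Wr_ge0.
by rewrite mrU// mulrDr Wr_node lerD.
Qed.

Lemma Wr_mono E F : ok E -> ok F -> E `<=` F -> (Wr E <= Wr F)%R.
Proof.
move=> okE okF EF; rewrite -lee_fin -!WE//.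
have [mE _] := okE; have [mF _] := okF.
by apply: ge0_subset_integral => // x _; rewrite lee_fin.
Qed.

(** A maximal node for the level [lam] has [w]-mean at most [2 lam], since its
    parent has mean at most [lam]; by the weak type bound [stop_weak] the
    stopping set at level [4 lam] fills at most half of it, and doubling keeps a
    fixed part of the [w]-mass outside. *)
Lemma stop_decay lam n s : (0 < lam)%R -> (Wr (N s) <= 2 * lam * mr (N s))%R ->
  (Wr (stopping (4 * lam) n s) <= (1 - C^-1) * Wr (stopping lam n s))%R.
Proof.
move=> l0.
have heavy s' k : (Wr (N s') <= 2 * lam * mr (N s'))%R ->
    (Wr (stopping (4 * lam) k s') <= (1 - C^-1) * Wr (N s'))%R.
  move=> ls.
  have okS := ok_stop (4 * lam) k s'.
  have okD' := okD (okN s') okS.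
  have splitN : N s' = stopping (4 * lam) k s' `|` (N s' `\` stopping (4 * lam) k s').
    by rewrite setDUK//; exact: stop_sub.
  have disj : stopping (4 * lam) k s' `&` (N s' `\` stopping (4 * lam) k s') = set0.
    by rewrite setDIK.
  have mus : (mr (N s') = mr (stopping (4 * lam) k s') + mr (N s' `\` stopping (4 * lam) k s'))%R.
    by rewrite {1}splitN mrU.
  have Ws : (Wr (N s') = Wr (stopping (4 * lam) k s') + Wr (N s' `\` stopping (4 * lam) k s'))%R.
    by rewrite {1}splitN WrU.
  have half : (2 * mr (stopping (4 * lam) k s') <= mr (N s'))%R.
    have := @stop_weak (4 * lam)%R k s' (mulr_ge0 (ler0n _ 4) (ltW l0)).
    move/le_trans => /(_ _ ls); rewrite -[X in (X <= _)%R -> _]mulrA.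
    move=> H; rewrite -(ler_pM2l l0); lra.
  have : (Wr (N s') <= C * Wr (N s' `\` stopping (4 * lam) k s'))%R.
    rewrite -lee_fin EFinM -!WE//; apply: w_doubling.
    - by case: okD'.
    - exact: subDsetl.
    - rewrite !muE// -EFinM lee_fin; lra.
  rewrite -ler_pdivrMl ?(lt_le_trans ltr01)// => H.
  by rewrite mulrBl mul1r; lra.
elim: n s => [|n IH] s ls /=.
  case: ifPn => h4; case: ifPn => h1.
  - by have := heavy s 0%N ls; rewrite /= h4.
  - move: h1; rewrite -leNgt => h1.
    by have := mulr_gt0 l0 (mrN_gt0 s); lra.
  - rewrite Wr0 mulr_ge0// subr_ge0 invf_le1//.
    by rewrite (lt_le_trans ltr01).
  - by rewrite Wr0 mulr0.
case: ifPn => h4; case: ifPn => h1.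
- by have := heavy s n.+1 ls; rewrite /= h4.
- move: h1; rewrite -leNgt => h1.
  by have := mulr_gt0 l0 (mrN_gt0 s); lra.
- by have := heavy s n.+1 ls; rewrite /= (negbTE h4).
- rewrite !WrU// mulrDr; move: h1; rewrite -leNgt => h1.
  have H b : (Wr (N (b :: s)) <= 2 * lam * mr (N (b :: s)))%R.
    rewrite mulrAC -(mr_child b) mulrC (le_trans _ h1)//.
    apply: Wr_mono => //; rewrite [X in _ `<=` X]NU.
    by case: (b); [exact: subsetUr|exact: subsetUl].
  by apply: lerD; apply: IH.
Qed.

Let Om lam := \bigcup_n stopping lam n [::].

Lemma stop_incr lam n s : stopping lam n s `<=` stopping lam n.+1 s.
Proof.
elim: n s => [|n IH] s; rewrite [X in _ `<=` X]/=; case: ifPn => h; rewrite /= ?h ?(negbTE h)//.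
by apply: setUSS; exact: IH.
Qed.

Lemma okOm lam : ok (Om lam).
Proof.
split; first by apply: bigcupT_measurable => n; case: (ok_stop lam n [::]).
by apply: bigcup_sub => n _; exact: stop_sub.
Qed.

Lemma Om_heavy lam s : (lam * mr (N s) < Wr (N s))%R -> N s `<=` Om lam.
Proof.
move=> h; rewrite -[s]cats0 in h *.
(* the recursion started at [s'] stops at the heavy node [u ++ s'] at the latest *)
have gen (u s' : seq bool) : (lam * mr (N (u ++ s')) < Wr (N (u ++ s')))%R ->
    N (u ++ s') `<=` stopping lam (size u) s'.
  elim/last_ind: u s' => [|u b IH] s' /=; first by move=> ->.
  rewrite cat_rcons size_rcons => h' /=; case: ifPn => // _.
    apply: subset_trans (_ : N (b :: s') `<=` _).
      elim: (u) => //= c u' IHu; apply: subset_trans IHu.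
      rewrite [X in _ `<=` X]NU.
      by case: c; [exact: subsetUr|exact: subsetUl].
    by rewrite [X in _ `<=` X]NU; case: (b); [exact: subsetUr|exact: subsetUl].
  by case: b h' => /IH h'; [exact: subset_trans h' (@subsetUr _ _ _)|exact: subset_trans h' (@subsetUl _ _ _)].
by move=> x /(gen _ _ h) Hx; exists (size s).
Qed.

Lemma Om_decay lam rho (k : nat) n : (0 < lam)%R -> (Wr (N [::]) = lam * V)%R ->
  rho = (1 - C^-1)%R ->
  (Wr (stopping (lam * 4 ^+ k) n [::]) <= rho ^+ k * Wr (N [::]))%R.
Proof.
move=> l0 lV ->; elim: k => [|k IH].
  by rewrite mul1r; apply: Wr_mono => //; exact: stop_sub.
have rho0 : (0 <= 1 - C^-1)%R.
  by rewrite subr_ge0 invf_le1 ?(lt_le_trans ltr01).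
rewrite [((1 - C^-1) ^+ k.+1)%R]exprS -mulrA (le_trans _ (ler_wpM2l rho0 IH))//.
rewrite exprS mulrCA.
apply: stop_decay; first by rewrite mulr_gt0// exprn_gt0.
rewrite lV mrN/= divr1 ler_pM2r// mulrCA ler_peMr ?(ltW l0)//.
rewrite mulr_ege1// ?ler1n// exprn_ege1// ler1n//.
Qed.

Lemma W_Om lam rho (k : nat) : (0 < lam)%R -> (Wr (N [::]) = lam * V)%R ->
  rho = (1 - C^-1)%R ->
  W (Om (lam * 4 ^+ k)) <= (rho ^+ k * Wr (N [::]))%:E.
Proof.
move=> l0 lV rhoE.
have cv := @ge0_nondecreasing_set_cvg_integral _ T R
  (fun n => stopping (lam * 4 ^+ k) n [::]) (fun x => (w x)%:E) mu.
have {}cv : (W (stopping (lam * 4 ^+ k) n [::])) @[n --> \oo] --> W (Om (lam * 4 ^+ k)).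
  apply: cv => //.
  - apply/nondecreasing_seqP => n; apply/subsetPset; exact: stop_incr.
  - by move=> n; case: (ok_stop (lam * 4 ^+ k) n [::]).
  - by move=> n x _; rewrite lee_fin.
rewrite -(cvg_lim _ cv)//; apply: lime_le; first by apply/cvg_ex; eexists; exact: cv.
by apply: nearW => n; rewrite WE// lee_fin; exact: Om_decay.
Qed.

(** If [w] were larger on a set of positive measure, this set would fill three
    quarters of some node, whose mean would then exceed [lam]. *)
Lemma Om_ae lam : (0 < lam)%R ->
  {ae mu, forall x, N [::] x -> ~ Om lam x -> (w x <= 2 * lam)%R}.
Proof.
move=> l0; pose G := (N [::] `\` Om lam) `&` [set x | (2 * lam < w x)%R].
have mG : measurable G.
  apply: measurableI; first by apply: measurableD => //; case: (okOm lam).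
  rewrite -[X in measurable X]setTI.
  have := @measurable_fun_ltr _ T R setT (cst (2 * lam)%R) w (measurable_cst _) mw.
  by move/(_ measurableT [set true] I); congr measurable; apply/seteqP; split => x /=; rewrite ?in_itv//=.
have GN : G `<=` N [::] by move=> x [[]].
have okG : ok G by [].
have : mu G = 0.
  apply/eqP; apply: contraT => muG; exfalso.
  have {}muG : 0 < mu G by rewrite lt_def muG measure_ge0.
  have [s Hs] := N_dense mG GN muG.
  have okGs : ok (G `&` N s).
    by split; [exact: measurableI|move=> x [/GN]].
  have light : (Wr (N s) <= lam * mr (N s))%R.
    rewrite leNgt; apply/negP => /Om_heavy sub.
    have E0 : G `&` N s = set0.
      by rewrite -subset0 => x [[[_ ?] _] /sub].
    move: Hs; rewrite E0 measure0 (muE (okN s)) -EFinM lee_fin leNgt => /negP; apply.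
    by rewrite mulr_gt0.
  have heavy : (2 * lam * mr (G `&` N s) <= Wr (G `&` N s))%R.
    rewrite -lee_fin EFinM -muE// -WE//.
    rewrite -integral_cst; last by case: okGs.
    by apply: ge0_le_integral => //=; [case: okGs|move=> x _; rewrite lee_fin mulr_ge0// ltW|move=> x [[_ /ltW]]].
  have := Wr_mono okGs (okN s) (@subIsetr _ _ _).
  move: Hs; rewrite !muE// -EFinM lee_fin => Hs.
  have := mrN_gt0 s; set m := mr (N s) in Hs light *; set g := mr _ in Hs heavy * => m0 H.
  have : (2 * lam * (3 / 4 * m) <= lam * m)%R.
    by rewrite (le_trans _ light)// (le_trans _ H)// (le_trans _ heavy)// ler_pM2l// mulr_gt0.
  by have := mulr_gt0 l0 m0; lra.
move=> G0; exists G; split => // x /=.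
rewrite -[G x]notK => H Gx; apply: H => Nx Omx.
by rewrite leNgt; apply/negP => lw; apply: Gx; split.
Qed.

(** Layer decomposition along the levels [4^k lam]: the [w]-mass above the
    [k]-th level decays like [(1 - 1/C)^k], while [w^(1/m)] grows like
    [4^(k/m)], and [m >= 6 C] makes the product geometric. *)
Lemma reverse_holder (m : nat) : (0 < m)%N -> (6 * C <= m%:R)%R ->
  (0 < Wr (N [::]))%R ->
  \int[mu]_(x in N [::]) (w x `^ (1 + m%:R^-1))%:E <=
  ((2 + 16 * C) * (Wr (N [::]) / V) `^ (m%:R^-1) * Wr (N [::]))%:E.
Proof.
move=> m0 mC W0; set del := (m%:R^-1 : R)%R.
have del0 : (0 < del)%R by rewrite invr_gt0 ltr0n.
have del1 : (del <= 1)%R by rewrite invf_le1 ?ltr0n// ler1n.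
have C0 : (0 < C)%R by rewrite (lt_le_trans ltr01).
set lam := (Wr (N [::]) / V)%R.
have l0 : (0 < lam)%R by rewrite divr_gt0.
have lV : (Wr (N [::]) = lam * V)%R by rewrite /lam divfK// gt_eqF.
clearbody lam.
pose rho := (1 - C^-1)%R.
have rho0 : (0 <= rho)%R by rewrite subr_ge0 invf_le1.
pose L k := (lam * 4 ^+ k)%R.
have L0 k : (0 < L k)%R by rewrite mulr_gt0// exprn_gt0.
have [K KB] : exists K : nat, (B <= 2 * L K)%R.
  have [K HK] : exists K : nat, (B / lam <= K%:R)%R.
    exists (Num.truncn `|B / lam|%R).+1.
    by rewrite (le_trans (ler_norm _))// ltW// truncnS_gt.
  exists K; move: HK; rewrite ler_pdivrMr// => /le_trans; apply.
  have : (K%:R <= 4 ^+ K :> R)%R by rewrite -natrX ler_nat ltnW// ltn_expl.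
  rewrite -(ler_pM2r l0) => /le_trans; apply.
  by rewrite /L (mulrC lam) ler_peMl ?ler1n// mulr_ge0 ?exprn_ge0// ltW.
pose S (x : T) := ((2 * lam) `^ del * w x +
  \sum_(k < K) (2 * L k.+1) `^ del * (w x * \1_(Om (L k)) x))%R.
have S_ge0 x : (0 <= S x)%R.
  rewrite addr_ge0 ?mulr_ge0 ?powR_ge0// sumr_ge0// => k _.
  by rewrite !mulr_ge0 ?powR_ge0// indicE.
have aeS : {ae mu, forall x, N [::] x -> (w x `^ (1 + del))%:E <= (S x)%:E}.
  have H : {ae mu, forall x, forall k, N [::] x -> ~ Om (L k) x -> (w x <= 2 * L k)%R}.
    by apply: ae_foralln => k; exact: Om_ae.
  move: H; apply: filterS => x H Nx; rewrite lee_fin.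
  have [->|wn0] := eqVneq (w x) 0%R.
    by rewrite powR0 ?gt_eqF ?addr_gt0.
  have wx0 : (0 < w x)%R by rewrite lt_def wn0 w0.
  rewrite gt0_powRD// powRr1// [leLHS]mulrC /S.
  have gen (J : nat) : (w x <= 2 * L J)%R -> (w x `^ del * w x <=
      (2 * lam) `^ del * w x + \sum_(k < J) (2 * L k.+1) `^ del * (w x * \1_(Om (L k)) x))%R.
    elim: J => [|J IH] HJ.
      rewrite big_ord0 addr0 ler_pM2r//; apply: ge0_ler_powR; rewrite ?nnegrE ?(ltW del0)//.
        by rewrite mulr_ge0// ltW.
      by move: HJ; rewrite /L mulr1.
    have [/IH|wJ] := leP (w x) (2 * L J)%R.
      move=> /le_trans; apply; rewrite big_ord_recr/= addrA lerDl.
      by rewrite !mulr_ge0 ?powR_ge0// indicE.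
    have OJ : Om (L J) x.
      by apply: contrapT => /(H J Nx); rewrite leNgt wJ.
    rewrite big_ord_recr/= indicE mem_set// mulr1 addrA.
    apply: (@le_trans _ _ ((2 * L J.+1) `^ del * w x)%R).
      rewrite ler_pM2r//; apply: ge0_ler_powR; rewrite ?nnegrE ?(ltW del0)//.
      by rewrite mulr_ge0// ltW.
    rewrite lerDr addr_ge0 ?mulr_ge0 ?powR_ge0// sumr_ge0// => k _.
    by rewrite !mulr_ge0 ?powR_ge0// indicE.
  by apply: gen; exact: le_trans KB.
have mOm k : measurable (Om (L k)) by case: (okOm (L k)).
have mSk k : measurable_fun setT (fun x => (2 * L k.+1) `^ del * (w x * \1_(Om (L k)) x))%R.
  by apply: measurable_funM => //; apply: measurable_funM => //; exact: measurable_indic.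
apply: (@le_trans _ _ (\int[mu]_(x in N [::]) (S x)%:E)).
  apply: ae_ge0_le_integral => //.
  - by move=> x _; rewrite lee_fin powR_ge0.
  - apply: measurable_funTS; apply/measurable_EFinP.
    exact: measurableT_comp (measurable_powR _) mw.
  - by move=> x _; rewrite lee_fin.
  - apply: measurable_funTS; apply/measurable_EFinP; apply: measurable_funD.
      exact: measurable_funM.
    exact: measurable_sum.
have -> : \int[mu]_(x in N [::]) (S x)%:E = ((2 * lam) `^ del)%:E * W (N [::]) +
    \sum_(k < K) ((2 * L k.+1) `^ del)%:E * W (Om (L k)).
  rewrite /S; under eq_integral do rewrite EFinD EFinM -sumEFin.
  rewrite ge0_integralD//; last 4 first.
  - by move=> x _; rewrite -EFinM lee_fin mulr_ge0// powR_ge0.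
  - by apply: measurable_funTS; apply: measurable_funeM; exact/measurable_EFinP.
  - by move=> x _; apply: sume_ge0 => k _; rewrite lee_fin !mulr_ge0 ?powR_ge0// indicE.
  - apply: measurable_funTS; apply: emeasurable_sum => k.
    by apply/measurable_EFinP.
  rewrite ge0_integralZl//; last 2 first.
  - by move=> x _; rewrite lee_fin.
  - by rewrite lee_fin powR_ge0.
  congr (_ + _); rewrite ge0_integral_sum//; last 2 first.
  - by move=> k; apply: measurable_funTS; apply/measurable_EFinP.
  - by move=> k x _; rewrite lee_fin !mulr_ge0 ?powR_ge0// indicE.
  apply: eq_bigr => k _; under eq_integral do rewrite EFinM.
  rewrite ge0_integralZl//; last 3 first.
  - apply: measurable_funTS; apply/measurable_EFinP.
    by apply: measurable_funM => //; exact: measurable_indic.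
  - by move=> x _; rewrite lee_fin mulr_ge0// indicE.
  - by rewrite lee_fin powR_ge0.
  congr (_ * _); rewrite -[in RHS](setIidr (okOm (L k)).2) integral_mkcondr.
  apply: eq_integral => x _; rewrite /patch indicE.
  by case: ifP => _; rewrite ?mulr1 ?mulr0.
(* Bernoulli: [4 <= (1 + 1/(2C))^m] because [m >= 6C] *)
have fd : (4 `^ del <= 1 + (2 * C)^-1 :> R)%R.
  have -> : (1 + (2 * C)^-1 = ((1 + (2 * C)^-1) `^ m%:R) `^ del :> R)%R.
    by rewrite -powRrM divff ?powRr1// ?addr_ge0 ?invr_ge0 ?mulr_ge0 ?(ltW C0)// pnatr_eq0 -lt0n.
  apply: ge0_ler_powR; rewrite ?nnegrE ?powR_ge0 ?(ltW del0)//.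
  have x0 : (0 <= (2 * C)^-1)%R by rewrite invr_ge0 mulr_ge0 ?(ltW C0).
  rewrite powR_mulrn ?addr_ge0//.
  have bern (c : R) (j : nat) : (0 <= c -> 1 + j%:R * c <= (1 + c) ^+ j)%R.
    move=> c0; elim: j => [|j IH]; first by rewrite mul0r addr0 expr0.
    rewrite exprS; apply: (@le_trans _ _ ((1 + c) * (1 + j%:R * c))%R).
      rewrite -natr1; have : (0 <= c * (j%:R * c))%R by rewrite !mulr_ge0.
      by nra.
    by rewrite ler_wpM2l// addr_ge0.
  apply: le_trans (bern _ m x0).
  have : (6 * C * (2 * C)^-1 <= m%:R * (2 * C)^-1)%R by rewrite ler_wpM2r.
  have -> : (6 * C * (2 * C)^-1 = 3)%R by field; rewrite gt_eqF.
  by lra.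
have fdrho : (4 `^ del * rho <= 1 - (2 * C)^-1)%R.
  apply: le_trans (ler_wpM2r rho0 fd) _.
  rewrite /rho; set c := (C^-1)%R; have c0 : (0 <= c)%R by rewrite invr_ge0 ltW.
  have -> : ((2 * C)^-1 = c / 2)%R by rewrite invfM mulrC.
  by have := mulr_ge0 c0 c0; lra.
pose r := (1 - (2 * C)^-1)%R.
have r0 : (0 <= r)%R by apply: le_trans fdrho; rewrite mulr_ge0// powR_ge0.
have r1 : (1 - r = (2 * C)^-1)%R by rewrite /r opprB addrCA subrr addr0.
have geo (J : nat) : (\sum_(k < J) r ^+ k <= 2 * C)%R.
  have H : ((1 - r) * \sum_(k < J) r ^+ k = 1 - r ^+ J)%R.
    rewrite -[in RHS](expr1n _ J) subrXX; congr (_ * _)%R.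
    by apply: eq_bigr => k _; rewrite expr1n mul1r.
  have : ((1 - r) * \sum_(k < J) r ^+ k <= 1)%R by rewrite H gerBl exprn_ge0.
  by rewrite r1 ler_pdivrMl ?mulr_gt0// mulr1.
have twodel : (2 `^ del <= 2 :> R)%R.
  by rewrite -[leRHS]powRr1//; apply: ler_powR => //; rewrite ler1n.
have fourdel : (4 `^ del <= 4 :> R)%R.
  by rewrite -[leRHS]powRr1//; apply: ler_powR => //; rewrite ler1n.
set M := Wr (N [::]) in W0 lam l0 lV L L0 KB S S_ge0 aeS mOm mSk *.
have term (k : 'I_K) : ((2 * L k.+1) `^ del)%:E * W (Om (L k)) <=
    (8 * lam `^ del * M * r ^+ k)%:E.
  apply: (@le_trans _ _ (((2 * L k.+1) `^ del)%:E * (rho ^+ k * M)%:E)).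
    rewrite lee_wpmul2l ?lee_fin ?powR_ge0//.
    by apply: W_Om => //.
  rewrite -EFinM lee_fin /L.
  rewrite !powRM ?mulr_ge0 ?(ltW l0) ?exprn_ge0//.
  rewrite -powR_mulrn// powRAC powR_mulrn ?powR_ge0// exprS.
  have fr : ((4 `^ del) ^+ k * rho ^+ k <= r ^+ k :> R)%R.
    by rewrite -exprMn lerXn2r ?nnegrE ?mulr_ge0 ?powR_ge0.
  have lm : (0 <= lam `^ del * M)%R by rewrite mulr_ge0 ?powR_ge0 ?(ltW W0).
  have -> : (2 `^ del * (lam `^ del * (4 `^ del * (4 `^ del) ^+ k)) * (rho ^+ k * M) =
     (2 `^ del * 4 `^ del) * (lam `^ del * M) * ((4 `^ del) ^+ k * rho ^+ k))%R by ring.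
  have -> : (8 * lam `^ del * M = 8 * (lam `^ del * M))%R by rewrite mulrA.
  have p24 : (0 <= 2 `^ del * 4 `^ del :> R)%R by rewrite mulr_ge0 ?powR_ge0.
  apply: ler_pM => //.
  - exact: mulr_ge0.
  - by rewrite mulr_ge0 ?exprn_ge0 ?powR_ge0.
  rewrite ler_wpM2r// (_ : 8 = 2 * 4)%R; last by rewrite -natrM.
  by rewrite ler_pM ?powR_ge0.
apply: (@le_trans _ _ ((2 * lam `^ del * M)%:E + (\sum_(k < K) 8 * lam `^ del * M * r ^+ k)%:E)).
  apply: leeD.
    rewrite WE// -EFinM lee_fin powRM ?(ltW l0)// -!mulrA.
    by rewrite ler_wpM2r// mulr_ge0 ?powR_ge0 ?(ltW W0).
  by rewrite -sumEFin; apply: lee_sum => k _; exact: term.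
rewrite -EFinD lee_fin -mulr_sumr.
have lm : (0 <= lam `^ del * M)%R by rewrite mulr_ge0 ?powR_ge0 ?(ltW W0).
have := ler_wpM2l lm (geo K); set Sg := (\sum_(k < K) _)%R => H.
by lra.
Qed.

End reverse_holder.

(** * Dyadic boxes and density *)

Section boxes.
Context {R : realType}.
Local Notation RT := (measurableTypeR R).

Definition box n (a s : 'I_n -> R) : set (Rn R n) :=
  [set x | forall i : 'I_n, (a i <= tnth x i < a i + s i)%R].

Lemma box_cons n (a s : 'I_n.+1 -> R) :
  (box a s : set (n.+1.-tuple RT)) =
  [set t | [set` `[a ord0, (a ord0 + s ord0)%R[] (thead t) /\
    box (a \o lift ord0) (s \o lift ord0) ([tuple of behead t] : n.-tuple _)].
Proof.
have tb T (u : n.+1.-tuple T) j :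
    tnth [tuple of behead u] j = tnth u (lift ord0 j).
  by rewrite [in RHS](tuple_eta u) tnthS.
apply/seteqP; split => t /=.
  by move=> H; split=> [|i]; [rewrite in_itv/=; exact: H|rewrite !tb; exact: H].
move=> [H1 H2] i; case: (unliftP ord0 i) => [j ->|->].
  by rewrite -!tb; exact: H2.
by move: H1; rewrite in_itv.
Qed.

Lemma borel_boxE n (a s : 'I_n -> R) : (forall i, 0 <= s i)%R ->
  measurable (box a s : set (n.-tuple RT)) /\
  borel_lebesgue R n (box a s) = (\prod_i s i)%:E.
Proof.
elim: n a s => [|n IH] a s s0.
  rewrite (_ : box _ _ = setT); last by apply/seteqP; split => // t _ [].
  by split => //=; rewrite big_ord0 diracT.
have [mc vc] := IH (a \o lift ord0) (s \o lift ord0) (fun i => s0 _).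
rewrite box_cons; split.
  exact: (@measurable_thead_behead R n _ (box (a \o lift ord0) (s \o lift ord0))).
apply: etrans.
  exact: (@product_consE _ _ (borel_lebesgue R n) _
    (box (a \o lift ord0) (s \o lift ord0))).
rewrite vc lebesgue_measure_itv /= lte_fin big_ord_recl EFinM; congr (_ * _).
have := s0 ord0; rewrite le_eqVlt => /orP[/eqP <-|l0]; first by rewrite addr0 ltxx.
by rewrite ltrDl l0 -EFinB addrAC subrr add0r.
Qed.

Lemma lebesgue_box n (a s : 'I_n -> R) : (forall i, 0 <= s i)%R ->
  measurable (box a s) /\ lebesgue_n (box a s) = (\prod_i s i)%:E.
Proof.
move=> s0; have [m v] := borel_boxE a s0; split.
  exact: caratheodory_measurable_mu_ext.
by rewrite -v; exact: measurable_mu_extE.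
Qed.

Lemma measurable_borel n (A : set (n.-tuple RT)) :
  measurable A -> measurable (A : set (Rn R n)).
Proof. by move=> mA; exact: caratheodory_measurable_mu_ext. Qed.

Lemma measurable_coord n (i : 'I_n) (A : set RT) : measurable A ->
  measurable [set x : Rn R n | A (tnth x i)].
Proof.
move=> mA; apply: measurable_borel.
by have := measurable_tnth i measurableT mA; rewrite setTI.
Qed.

End boxes.

Section dyadic.
Context {R : realType} (n : nat).
Hypothesis n_gt0 : (0 < n)%N.
Variables (a : 'I_n -> R) (l : R).
Hypothesis l0 : (0 < l)%R.
Local Notation mu := (@lebesgue_n R n).

Fixpoint dyad_side (d : nat) (i : 'I_n) : R :=
  if d is d'.+1 then
    if (i == d' %% n :> nat)%N then (dyad_side d' i / 2)%R else dyad_side d' i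
  else l.

Fixpoint dyad_corner (s : seq bool) (i : 'I_n) : R :=
  if s is b :: s' then
    (dyad_corner s' i +
     if b && (i == size s' %% n :> nat)%N then dyad_side (size s') i / 2 else 0)%R
  else a i.

(** Nodes are obtained by halving the coordinates cyclically, so that they form
    a binary tree whose members have bounded eccentricity. The list of bits
    records the choices of halves, the most recent one first. *)
Definition dyad (s : seq bool) : set (Rn R n) :=
  box (dyad_corner s) (dyad_side (size s)).

Lemma dyad_side_gt0 d i : (0 < dyad_side d i)%R.
Proof. by elim: d => //= d IH; case: ifP => _ //; rewrite divr_gt0. Qed.

Lemma measurable_dyad s : measurable (dyad s).
Proof.
have [] // := @lebesgue_box R n (dyad_corner s) (dyad_side (size s)).
by move=> i; exact/ltW/dyad_side_gt0.
Qed.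

Lemma dyadU s : dyad s = dyad (false :: s) `|` dyad (true :: s).
Proof.
apply/seteqP; split => x /=.
  pose i0 := Ordinal (ltn_pmod (size s) n_gt0).
  move=> H; have [h|h] := ltP (tnth x i0) (dyad_corner s i0 + dyad_side (size s) i0 / 2)%R.
    left => i /=; rewrite addr0; case: ifPn => [/eqP ii0|_]; last exact: H.
    have -> : i = i0 by exact/val_inj.
    by rewrite h andbT; have /andP[] := H i0.
  right => i /=; case: ifPn => [/eqP ii0|_]; last by rewrite addr0; exact: H.
  have -> : i = i0 by exact/val_inj.
  by rewrite h/= -addrA -splitr; have /andP[] := H i0.
case=> H i; have := H i => /=.
  rewrite addr0; case: ifP => // _ /andP[-> /lt_le_trans] /=; apply.
  by rewrite lerD2l ler_pdivrMr// ler_peMr ?ler1n// ltW// dyad_side_gt0.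
case: ifP => _; last by rewrite addr0.
rewrite -addrA -splitr => /andP[+ ->]; rewrite andbT; apply: le_trans.
by rewrite lerDl divr_ge0// ltW// dyad_side_gt0.
Qed.

Lemma dyad_disj s : dyad (false :: s) `&` dyad (true :: s) = set0.
Proof.
rewrite -subset0 => x [H1 H2].
pose i0 := Ordinal (ltn_pmod (size s) n_gt0).
have := H1 i0; have := H2 i0 => /=; rewrite eqxx addr0 => /andP[h _] /andP[_].
by rewrite ltNge h.
Qed.

Lemma dyad_measure s : mu (dyad s) = (l ^+ n / 2 ^+ size s)%:E.
Proof.
have [|_ ->] := @lebesgue_box R n (dyad_corner s) (dyad_side (size s)).
  by move=> i; exact/ltW/dyad_side_gt0.
congr EFin; elim: (size s) => [|d IH] /=.
  by rewrite prodr_const card_ord divr1.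
pose i0 := Ordinal (ltn_pmod d n_gt0).
rewrite exprS invfM mulrCA -IH (bigD1 i0)//= [in RHS](bigD1 i0)//= eqxx.
rewrite [X in (X * _)%R]mulrC -mulrA; congr (_ * (_ * _))%R; apply: eq_bigr => i ii0.
by rewrite ifF//; apply: contraNF ii0 => /eqP ii0; apply/eqP/val_inj.
Qed.

(** After [q n + r] halvings the first [r] coordinates have been halved once
    more than the others. *)
Lemma dyad_side_level d : exists q r : nat, [/\ d = (q * n + r)%N, (r < n)%N &
  forall i : 'I_n, dyad_side d i = (l / 2 ^+ (q + (i < r)))%R].
Proof.
elim: d => [|d [q [r [dE rn IH]]]].
  by exists 0%N, 0%N; split => // i; rewrite /= expr0 divr1.
have dr : (d %% n = r)%N by rewrite dE modnMDl modn_small.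
have [rn1|rn1] := ltnP r.+1 n.
  exists q, r.+1; split => //; first by rewrite dE addnS.
  move=> i /=; rewrite dr IH; case: ifPn => [/eqP ->|ir].
    by rewrite ltnn ltnS leqnn addn0 addn1 exprS invfM [RHS]mulrA mulrAC.
  by rewrite [(i < r.+1)%N]ltnS [(i <= r)%N]leq_eqVlt (negbTE ir).
have nr : n = r.+1 by apply/eqP; rewrite eqn_leq rn1 rn.
exists q.+1, 0%N; split => //; first by rewrite dE mulSn {2}nr addn0 addnC addSn addnC.
move=> i /=; rewrite dr IH addn0; case: ifPn => [/eqP ->|ir].
  by rewrite ltnn addn0 exprS invfM [RHS]mulrA mulrAC.
have -> : (i < r)%N by have := ltn_ord i; rewrite {2}nr ltnS leq_eqVlt (negbTE ir).
by rewrite addn1.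
Qed.

(** Conditions known for cubes pass to nodes with a loss depending on [n] only. *)
Lemma dyad_sub_cube s : exists (b : n.-tuple R) (L : R),
  [/\ (0 < L)%R, (L <= l)%R, dyad s `<=` cube b L & (L ^+ n <= 2 ^+ n * (l ^+ n / 2 ^+ size s))%R].
Proof.
have [q [r [dE rn sE]]] := dyad_side_level (size s).
exists [tuple dyad_corner s i | i < n], (l / 2 ^+ q)%R; split.
- by rewrite divr_gt0// exprn_gt0.
- by rewrite ler_pdivrMr ?exprn_gt0// ler_peMr ?(ltW l0)// exprn_ege1// ler1n.
- move=> x H i; rewrite !tnth_mktuple; have /andP[-> /ltW /le_trans] /= := H i; apply.
  rewrite lerD2l sE ler_pM2l// lef_pV2 ?posrE ?exprn_gt0//.
  by rewrite ler_eXn2l ?ltr1n// leq_addr.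
rewrite exprMn exprVn -exprM mulrCA ler_pM2l ?exprn_gt0// dE.
rewrite -(@ler_pM2r _ (2 ^+ (q * n)))%R ?exprn_gt0// mulVf ?expf_neq0//.
have -> : (2 ^+ n / 2 ^+ (q * n + r) * 2 ^+ (q * n) = 2 ^+ n / 2 ^+ r :> R)%R.
  by rewrite exprD; field; rewrite !expf_neq0.
rewrite ler_pdivlMr ?exprn_gt0// mul1r.
by rewrite ler_eXn2l ?ltr1n// ltnW.
Qed.

Lemma dyad_small (eps : R) : (0 < eps)%R -> exists d, forall s, size s = d ->
  forall x y, dyad s x -> dyad s y -> forall i, (`|tnth x i - tnth y i| <= eps)%R.
Proof.
move=> e0; pose K := (Num.truncn `|l / eps|%R).+1.
exists (K * n)%N => s sE x y H1 H2 i.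
have [q [r [dE rn sdE]]] := dyad_side_level (size s).
have qK : q = K.
  have := dE; rewrite sE => /(congr1 (fun k => k %/ n)%N).
  by rewrite mulnK// divnMDl// divn_small// addn0.
have : (dyad_side (size s) i <= eps)%R.
  rewrite sdE qK ler_pdivrMr ?exprn_gt0// mulrC -ler_pdivrMr//.
  apply: (@le_trans _ _ (K%:R)%R).
    by rewrite (le_trans (ler_norm _))// ltW// truncnS_gt.
  apply: (@le_trans _ _ (2 ^+ K)%R).
    by rewrite -natrX ler_nat ltnW// ltn_expl.
  by rewrite ler_eXn2l ?ltr1n// leq_addr.
move: (H1 i) (H2 i) => /andP[? ?] /andP[? ?] ?.
by rewrite ler_norml; apply/andP; split; lra.
Qed.

End dyadic.

Lemma cvge0_small (R : realType) (u : nat -> \bar R) (e : R) :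
  u n @[n --> \oo] --> 0 -> (0 < e)%R -> exists k, u k <= e%:E.
Proof.
move=> cv e0; apply: contrapT => H.
have : e%:E <= 0; last by rewrite leNgt lte_fin e0.
rewrite -(cvg_lim _ cv)//; apply: lime_ge; first by apply/cvg_ex; eexists; exact: cv.
by apply: nearW => n; rewrite leNgt; apply/negP => /ltW un; apply: H; exists n.
Qed.

Section density.
Context d (T : measurableType d) (R : realType).
Variables (mu : {measure set T -> \bar R}) (N : seq bool -> set T).
Hypotheses (mN : forall s, measurable (N s))
  (NU : forall s, N s = N (false :: s) `|` N (true :: s))
  (Ndisj : forall s, N (false :: s) `&` N (true :: s) = set0)
  (Nfin : mu (N [::]) < +oo).

Definition node_union k (U : set T) :=
  forall s, size s = k -> N s `<=` U \/ N s `<=` ~` U.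

(** Approximability in measure by finite unions of nodes. The sets with this
    property form a sigma-algebra, which gives a density theorem for the tree
    from additivity and continuity of the measure. *)
Definition node_approx (B : set T) := forall eps : R, (0 < eps)%R ->
  exists k U, [/\ measurable U, node_union k U &
    mu (N [::] `&` (B `\` U `|` U `\` B)) <= eps%:E].

Lemma node_unionS k U : node_union k U -> node_union k.+1 U.
Proof.
move=> H [//|b s] /= [sk]; have sub : N (b :: s) `<=` N s.
  by rewrite [X in _ `<=` X]NU; case: b; [exact: subsetUr|exact: subsetUl].
by case: (H _ sk) => h; [left|right]; exact: subset_trans h.
Qed.

Lemma node_union_le j k U : (j <= k)%N -> node_union j U -> node_union k U.
Proof.
move=> /subnK <-; elim: (k - j)%N => // m IH H; rewrite addSn.
exact/node_unionS/IH.
Qed.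

Lemma node_unionU k U V : node_union k U -> node_union k V ->
  node_union k (U `|` V).
Proof.
move=> HU HV s sk; case: (HU s sk) => h; first by left; exact: subset_trans h (@subsetUl _ _ _).
case: (HV s sk) => h'; first by left; exact: subset_trans h' (@subsetUr _ _ _).
by right; rewrite setCU subsetI.
Qed.

Let mDelta B U : measurable B -> measurable U ->
  measurable (N [::] `&` (B `\` U `|` U `\` B)).
Proof.
by move=> mB mU; apply: measurableI => //; apply: measurableU; exact: measurableD.
Qed.

Lemma node_approxU A B : measurable A -> measurable B ->
  node_approx A -> node_approx B -> node_approx (A `|` B).
Proof.
move=> mA mB HA HB e e0; have e20 : (0 < e / 2)%R by rewrite divr_gt0.
have [k [U [mU kU HU]]] := HA _ e20; have [j [V [mV jV HV]]] := HB _ e20.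
exists (maxn k j), (U `|` V); split; first exact: measurableU.
  apply: node_unionU.
    exact: node_union_le (leq_maxl _ _) kU.
  exact: node_union_le (leq_maxr _ _) jV.
rewrite (splitr e) EFinD; apply: le_trans (leeD HU HV).
apply: le_trans (measureU2 _ _ _); [|exact: mDelta|exact: mDelta].
apply: le_measure; rewrite ?inE.
- by apply: mDelta; exact: measurableU.
- by apply: measurableU; exact: mDelta.
move=> x [Nx] [[[Ax|Bx] /not_orP[nU nV]]|[[Ux|Vx] /not_orP[nA nB]]].
- by left; split => //; left.
- by right; split => //; left.
- by left; split => //; right.
- by right; split => //; right.
Qed.

Lemma node_approx_sigma_algebra :
  sigma_algebra setT [set B | measurable B /\ node_approx B].
Proof.
split.
- split => // e e0; exists 0%N, set0; split => //; first by move=> s _; right; rewrite setC0.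
  by rewrite setDv setU0 setI0 measure0 lee_fin ltW.
- move=> A [mA HA]; split; first exact: measurableD.
  move=> e e0; have [k [U [mU kU HU]]] := HA e e0.
  exists k, (~` U); split.
  + exact: measurableC.
  + by move=> s /kU [h|h]; [right; rewrite setCK|left].
  + rewrite (_ : _ `|` _ = A `\` U `|` U `\` A)// setTD; apply/seteqP; split => x /=.
      by move=> [[nA]|[nU]] /contrapT ?; [right|left].
    by move=> [[? ?]|[? ?]]; [right|left]; split => // /(_ _).
- move=> A HA; have mA k : measurable (A k) by case: (HA k).
  split; first exact: bigcupT_measurable.
  pose B k := \bigcup_(i < k) A i.
  have mB k : measurable (B k) by apply: bigcup_measurable => i _.
  have HB k : node_approx (B k).
    elim: k => [|k IH].
      rewrite /B bigcup_mkord big_ord0 => e e0; exists 0%N, set0; split => //.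
        by move=> s _; right; rewrite setC0.
      by rewrite setDv setU0 setI0 measure0 lee_fin ltW.
    rewrite /B bigcup_mkord big_ord_recr/= -bigcup_mkord.
    by apply: node_approxU => //; [exact: mB|case: (HA k)].
  have BA : \bigcup_k A k = \bigcup_k B k.
    apply/seteqP; split => x [k _ Hx]; first by exists k.+1 => //; exists k => //=.
    by case: Hx => i _ Hx; exists i.
  move=> e e0; have e20 : (0 < e / 2)%R by rewrite divr_gt0.
  have [k Hk] : exists k, mu (N [::] `&` (\bigcup_k A k `\` B k)) <= (e / 2)%:E.
    have := @nonincreasing_cvg_mu _ _ _ mu (fun k => N [::] `&` (\bigcup_k A k `\` B k)).
    have -> : \bigcap_k (N [::] `&` (\bigcup_k A k `\` B k)) = set0.
      rewrite -subset0 => x H; have [_ [Ax _]] := H 0%N I.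
      by move: Ax; rewrite BA => -[k _ Bx]; have [_ [_]] := H k I; apply.
    rewrite measure0 => cv.
    have {}cv : (mu \o (fun k => N [::] `&` (\bigcup_k A k `\` B k))) x @[x --> \oo] --> 0.
      apply: cv => //.
      + by apply: le_lt_trans Nfin; apply: le_measure; rewrite ?inE//; apply: measurableI => //; apply: measurableD => //; exact: bigcupT_measurable.
      + by move=> k; apply: measurableI => //; apply: measurableD => //; exact: bigcupT_measurable.
      + apply/nonincreasing_seqP => k; apply/subsetPset => x [Nx [Ax nB]]; split => //; split => //.
        by apply: contra_not nB => -[i /= ik Ai]; exists i => //=; rewrite (ltn_trans ik).
    exact: cvge0_small cv e20.
  have [j [U [mU jU HU]]] := HB k _ e20.
  exists j, U; split => //; rewrite (splitr e) EFinD.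
  apply: le_trans (leeD Hk HU).
  have m1 : measurable (\bigcup_k A k) by exact: bigcupT_measurable.
  have m2 : measurable (N [::] `&` (\bigcup_k A k `\` B k)).
    by apply: measurableI => //; exact: measurableD.
  apply: le_trans (measureU2 _ m2 (mDelta (mB k) mU)).
  apply: le_measure; rewrite ?inE; [exact: mDelta|by apply: measurableU => //; exact: mDelta|].
  move=> x [Nx] [[Ax nU]|[Ux nA]].
    have [Bx|nB] := pselect (B k x); first by right; split => //; left.
    by left.
  right; split => //; right; split => //; apply: contra_not nA.
  by move=> [i _ Ai]; exists i.
Qed.

(** If every node were filled to at most three quarters, the same would hold
    for a finite union of nodes that approximates [G] up to an eighth of its
    measure. *)
Lemma node_approx_dense G : measurable G -> G `<=` N [::] -> 0 < mu G ->
  node_approx G -> exists s, (3 / 4)%:E * mu (N s) <= mu (G `&` N s).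
Proof.
move=> mG GN G0 HG; apply: contrapT => H.
have {}H s : mu (G `&` N s) <= (3 / 4)%:E * mu (N s).
  rewrite leNgt; apply/negP => Hs; apply: H; exists s; exact: ltW.
have Gfin : mu G \is a fin_num.
  rewrite ge0_fin_numE//; apply: le_lt_trans Nfin.
  by apply: le_measure; rewrite ?inE.
have g0 : (0 < fine (mu G))%R by rewrite fine_gt0// G0/= ltey_eq Gfin.
have e0 : (0 < fine (mu G) / 8)%R by rewrite divr_gt0.
have [k [U [mU kU HU]]] := HG _ e0.
have HGU j : forall s, (size s + j)%N = k ->
    mu (G `&` U `&` N s) <= (3 / 4)%:E * mu (U `&` N s).
  elim: j => [|j IH] s sk.
    rewrite addn0 in sk; have [NsU|NsU] := kU s sk.
      by rewrite -setIA (setIidr NsU).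
    have U0 : U `&` N s = set0 by rewrite -subset0 => x [Ux /NsU].
    by rewrite -setIA U0 setI0 measure0 mule0.
  rewrite NU !setIUr !measureU//; last 6 first.
  - exact: measurableI.
  - exact: measurableI.
  - by rewrite -subset0 -(Ndisj s) => x [[_ ?] [_ ?]].
  - by apply: measurableI => //; exact: measurableI.
  - by apply: measurableI => //; exact: measurableI.
  - by rewrite -subset0 -(Ndisj s) => x [[_ ?] [_ ?]].
  rewrite ge0_muleDr//; apply: leeD; apply: IH.
    by rewrite /= addSn -addnS.
  by rewrite /= addSn -addnS.
have {}HGU := HGU k [::] erefl.
have fin A : measurable A -> A `<=` N [::] -> mu A = (fine (mu A))%:E.
  move=> mA AN; rewrite fineK// ge0_fin_numE//; apply: le_lt_trans Nfin.
  by apply: le_measure; rewrite ?inE.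
have mD := mDelta mG mU.
have mGU : measurable (G `&` U) by exact: measurableI.
have mUN : measurable (U `&` N [::]) by exact: measurableI.
have eD := fin _ mD (@subIsetl _ _ _).
have eU := fin _ mUN (@subIsetr _ _ _).
have eGU := fin _ mGU (subset_trans (@subIsetl _ _ _) GN).
have GUN : G `&` U `&` N [::] = G `&` U by apply/setIidl => x [/GN].
rewrite GUN eGU eU -EFinM lee_fin in HGU.
rewrite eD lee_fin in HU.
have : mu G <= mu (G `&` U) + mu (N [::] `&` (G `\` U `|` U `\` G)).
  apply: le_trans (measureU2 _ mGU mD); apply: le_measure; rewrite ?inE//.
    exact: measurableU.
  move=> x Gx; have [Ux|nU] := pselect (U x); first by left.
  by right; split; [exact: GN|left].
rewrite eGU eD -(fineK Gfin) -EFinD lee_fin => H1.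
have : mu (U `&` N [::]) <= mu (G `&` U) + mu (N [::] `&` (G `\` U `|` U `\` G)).
  apply: le_trans (measureU2 _ mGU mD); apply: le_measure; rewrite ?inE//.
    exact: measurableU.
  move=> x [Ux Nx]; have [Gx|nG] := pselect (G x); first by left.
  by right; split => //; right.
rewrite eGU eU eD -EFinD lee_fin => H2.
move: g0 HGU HU H1 H2; move: (fine (mu (N [::] `&` _))) (fine (mu (G `&` U)))
  (fine (mu (U `&` _))) (fine (mu G)) => r1 r2 r3 r4.
by lra.
Qed.

End density.

Section density_Rn.
Context {R : realType} (n : nat).
Local Notation RT := (measurableTypeR R).
Local Notation mu := (@lebesgue_n R n).
Variable N : seq bool -> set (Rn R n).
Hypotheses (mN : forall s, measurable (N s))
  (NU : forall s, N s = N (false :: s) `|` N (true :: s))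
  (Ndisj : forall s, N (false :: s) `&` N (true :: s) = set0)
  (Nfin : mu (N [::]) < +oo).
Hypothesis N_small : forall eps : R, (0 < eps)%R -> exists d, forall s, size s = d ->
  forall x y, N s x -> N s y -> forall i, (`|tnth x i - tnth y i| <= eps)%R.

Lemma node_cover k : N [::] `<=` \bigcup_(s in [set s | size s = k]) N s.
Proof.
elim: k => [|k IH] x Nx; first by exists [::].
have [s /= sk] := IH x Nx; rewrite NU => -[H|H]; eexists; try exact: H; by rewrite /= sk.
Qed.

Lemma node_disj s s' x : size s = size s' -> N s x -> N s' x -> s = s'.
Proof.
have sub b t : N (b :: t) `<=` N t.
  by rewrite [X in _ `<=` X]NU; case: b; [exact: subsetUr|exact: subsetUl].
elim: s s' => [|b s IH] [|b' s']//= [ss'] H1 H2.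
have e : s = s' by apply: IH => //; [exact: sub H1|exact: sub H2].
rewrite -e in H2 *; congr cons.
by case: b b' H1 H2 => -[]// H1 H2; have : set0 x by rewrite -(Ndisj s).
Qed.

(** The nodes of small diameter inside the half-space miss it only in a thin
    slab. *)
Lemma node_approx_ray (i : 'I_n) (t : R) :
  node_approx mu N [set x | (t < tnth x i)%R].
Proof.
pose H := [set x : Rn R n | (t < tnth x i)%R].
have mH : measurable H.
  have := @measurable_coord R n i (`]t, +oo[%classic : set RT) (measurable_itv _).
  by congr measurable; apply/seteqP; split => x /=; rewrite in_itv/= andbT.
pose U k := \bigcup_(s in [set s | size s = k /\ N s `<=` H]) N s.
have mU k : measurable (U k).
  have -> : U k = \bigcup_(s : seq bool) (if `[< size s = k /\ N s `<=` H >] then N s else set0).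
    apply/seteqP; split => x [s /= Hs Ns]; first by exists s => //; case: asboolP.
    by move: Ns; case: asboolP => // Hs' Ns; exists s.
  apply: countable_bigcupT_measurable => // s.
  by case: ifP.
have kU k : node_union N k (U k).
  move=> s sk; have [sH|sH] := pselect (N s `<=` H).
    by left=> x Nx; exists s.
  right=> x Nx [s' [s'k s'H] N's].
  by apply: sH; rewrite (@node_disj s s' x) ?sk.
pose slab m := N [::] `&` [set x : Rn R n | (t < tnth x i <= t + m.+1%:R^-1)%R].
have mslab m : measurable (slab m).
  apply: measurableI => //.
  have := @measurable_coord R n i (`]t, (t + m.+1%:R^-1)%R]%classic : set RT) (measurable_itv _).
  by congr measurable; apply/seteqP; split => x /=; rewrite in_itv.
move=> e e0.
have [m Hm] : exists m, mu (slab m) <= e%:E.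
  have := @nonincreasing_cvg_mu _ _ _ mu slab.
  have -> : \bigcap_k slab k = set0.
    rewrite -subset0 => x Hx; have [_ /= /andP[tx _]] := Hx 0%N I.
    have xt0 : (0 < tnth x i - t)%R by rewrite subr_gt0.
    pose m := Num.truncn (tnth x i - t)^-1%R.
    have [_ /= /andP[_ ]] := Hx m I.
    rewrite -lerBlDl leNgt => /negP; apply.
    by rewrite invf_plt ?posrE// truncnS_gt.
  rewrite measure0 => cv.
  have {}cv : (mu \o slab) x @[x --> \oo] --> 0.
    apply: cv => //.
    + by apply: le_lt_trans Nfin; apply: le_measure; rewrite ?inE//; exact: subIsetl.
    + apply/nonincreasing_seqP => k; apply/subsetPset => x [Nx /= /andP[tx xt]]; split => //=.
      rewrite tx/= (le_trans xt)// lerD2l lef_pV2 ?posrE ?ltr0n// ler_nat.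
      by rewrite ltnW.
  exact: cvge0_small cv e0.
have m10 : (0 < m.+1%:R^-1 :> R)%R by rewrite invr_gt0 ltr0n.
have [k Hk] := N_small m10.
exists k, (U k); split => //; apply: le_trans Hm.
apply: le_measure; rewrite ?inE//.
  by apply: measurableI => //; apply: measurableU; exact: measurableD.
move=> x [Nx] [[Hx nU]|[[s [sk sH] Nsx] nH]]; last by case: nH; exact: sH.
split => //=; rewrite Hx/= leNgt; apply/negP => xt; apply: nU.
have [s /= sk Nsx] := node_cover k Nx.
exists s => //; split => // y Nsy; rewrite /H/=.
have := Hk s sk x y Nsx Nsy i; rewrite ler_norml => /andP[_].
by rewrite lerBlDr => /(lt_le_trans xt); rewrite addrC ltrD2l.
Qed.

(** Half-spaces generate the Borel sets. *)
Lemma node_approx_borel (B : set (n.-tuple RT)) : measurable B ->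
  node_approx mu N B.
Proof.
move=> mB; have sa := node_approx_sigma_algebra mN NU Nfin.
suff /(_ _ mB) [] : (measurable : set (set (n.-tuple RT))) `<=`
  [set B : set (Rn R n) | measurable B /\ node_approx mu N B] by [].
apply: smallest_sub => //.
have coord (i : 'I_n) : (measurable : set (set RT)) `<=`
    [set A | measurable [set x : Rn R n | A (tnth x i)] /\
             node_approx mu N [set x : Rn R n | A (tnth x i)]].
  move=> A mA; split; first exact: measurable_coord.
  have {}mA : <<s RGenOInfty.G (R:=R) >> A.
    by have := mA; rewrite RGenOInfty.measurableE.
  suff : <<s RGenOInfty.G (R:=R) >> `<=` [set A |
     [set B : set (Rn R n) | measurable B /\ node_approx mu N B] [set x : Rn R n | A (tnth x i)]].
    by move=> /(_ _ mA) [].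
  have [s0 sC sU] := sa.
  apply: smallest_sub.
    split.
    - exact: s0.
    - by move=> A0 /sC; congr (_ _); rewrite !setTD.
    - move=> F /sU; congr (_ _); apply/seteqP; split => x /= [k _ H]; by exists k.
  move=> _ [t ->]; split.
    have := @measurable_coord R n i (`]t, +oo[%classic : set RT) (measurable_itv _).
    by [].
  have := @node_approx_ray i t; congr node_approx; apply/seteqP; split => x /=; rewrite in_itv/= andbT//.
apply: (big_ind (fun S => S `<=` _)) => //.
- by move=> S S' H1 H2; rewrite subUset.
- by move=> i _ _ [A mA <-]; rewrite setTI; exact: (coord i).
Qed.

(** A Lebesgue measurable set is contained in a Borel set of almost the same
    measure, to which [node_approx_borel] applies. *)
Lemma node_dense (G : set (Rn R n)) : measurable G -> G `<=` N [::] ->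
  0 < mu G -> exists s, (3 / 4)%:E * mu (N s) <= mu (G `&` N s).
Proof.
move=> mG GN G0; apply: (node_approx_dense mN NU Ndisj Nfin mG GN G0).
move=> e e0; have e20 : (0 < e / 2)%R by rewrite divr_gt0.
have Gfin : mu G \is a fin_num.
  rewrite ge0_fin_numE//; apply: le_lt_trans Nfin.
  by apply: le_measure; rewrite ?inE.
have [B [mB GB HB]] : exists B : set (n.-tuple RT), [/\ measurable B, G `<=` B &
    mu B <= mu G + (e / 2)%:E].
  have [_ [F [mF GF] <-] HF] := @lb_ereal_inf_adherent _ _ _ e20 Gfin.
  exists (\bigcup_k F k); split => //; first exact: bigcupT_measurable.
  have mUF : measurable (\bigcup_k F k) by exact: bigcupT_measurable.
  rewrite /lebesgue_n/completed_measure_extension measurable_mu_extE//.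
  apply: (le_trans _ (ltW HF)).
  exact: measure_sigma_subadditive.
have [k [U [mU kU HU]]] := node_approx_borel mB e20.
exists k, U; split => //; rewrite (splitr e) EFinD.
have mB' := measurable_borel mB.
have mBG : measurable ((B : set (Rn R n)) `\` G) by exact: measurableD.
have HBG : mu ((B : set (Rn R n)) `\` G) <= (e / 2)%:E.
  rewrite measureD//; last first.
    by apply: le_lt_trans HB _; rewrite -(fineK Gfin) -EFinD ltry.
  by rewrite setIidr// leeBlDr// addeC.
apply: le_trans (leeD HBG HU).
have mD (A : set (Rn R n)) : measurable A -> measurable (N [::] `&` (A `\` U `|` U `\` A)).
  by move=> mA; apply: measurableI => //; apply: measurableU; exact: measurableD.
apply: le_trans (measureU2 _ mBG (mD _ mB')).
apply: le_measure; rewrite ?inE; [exact: mD|by apply: measurableU => //; exact: mD|].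
move=> x [Nx] [[Gx nU]|[Ux nG]].
  by right; split => //; left; split => //; exact: GB.
have [Bx|nB] := pselect (B x); first by left.
by right; split => //; right.
Qed.

End density_Rn.

(** * Self-improvement of the dual condition *)

(** Where [y <= a] the left side is at most [1/v]. Where [y > a], powers of [v]
    are converted into powers of the weight [u^(1/(1 - y))] through
    [c v^-(1 - a) <= u]; the inequality between [q] and [del] says that the
    power of [v] that remains has the right sign. *)
Lemma exponent_gain (R : realType) (v u c a y q del P : R) :
  (0 < v <= 1 -> 0 <= a -> 0 <= y -> 0 < P -> P^-1 <= 1 - y -> 0 < c <= 1 ->
  c * v `^ (- (1 - a)) <= u -> 1 <= q -> q * y < 1 -> q * a <= 1 -> 0 < del ->
  q * (1 - y) <= (1 + del) * (1 - q * y) ->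
  (v `^ (- (1 - q * a))) `^ (1 - q * y)^-1 <= v^-1 +
    (c^-1 `^ P) `^ (1 + del) * (v `^ del * (u `^ (1 - y)^-1) `^ (1 + del)))%R.
Proof.
move=> /andP[v0 v1] a0 y0 P0 yP /andP[c0 c1] cu q1 qy1 qa1 d0 H.
have iP0 : (0 < P^-1)%R by rewrite invr_gt0.
have y10 : (0 < 1 - y)%R by exact: lt_le_trans yP.
have qy0 : (0 < 1 - q * y)%R by rewrite subr_gt0.
have vle (s t : R) : (t <= s -> v `^ s <= v `^ t)%R.
  move=> ts; rewrite /powR gt_eqF// ler_expR; apply: ler_wnM2r => //.
  exact: ln_le0.
have [ya|ay] := leP y a.
  apply: (@le_trans _ _ (v^-1)%R); last first.
    by rewrite lerDl !mulr_ge0 ?powR_ge0.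
  rewrite -powRrM -[leRHS]powR_inv1 ?(ltW v0)//; apply: vle.
  rewrite mulNr lerN2 ler_pdivrMr// mul1r lerD2l lerN2.
  by rewrite ler_pM2l// (lt_le_trans ltr01).
apply: (@le_trans _ _ (v `^ (del + (- (1 - a) / (1 - y)) * (1 + del)))%R).
  rewrite -powRrM; apply: vle.
  rewrite -subr_ge0.
  have -> : (- (1 - q * a) / (1 - q * y) - (del + - (1 - a) / (1 - y) * (1 + del)) =
    (y - a) * (((1 + del) * (1 - q * y) - q * (1 - y)) / ((1 - y) * (1 - q * y))))%R.
    by field; rewrite !gt_eqF.
  apply: mulr_ge0; first by rewrite subr_ge0 ltW.
  by rewrite divr_ge0 ?mulr_ge0 ?(ltW y10) ?(ltW qy0)// subr_ge0.
rewrite gt0_powRD//.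
have step : (v `^ (- (1 - a) / (1 - y)) <= c^-1 `^ P * u `^ (1 - y)^-1)%R.
  apply: (@le_trans _ _ ((c^-1 * u) `^ (1 - y)^-1)%R).
    rewrite powRrM; apply: ge0_ler_powR; rewrite ?invr_ge0 ?(ltW y10)//.
    - by rewrite nnegrE powR_ge0.
    - rewrite nnegrE mulr_ge0 ?invr_ge0 ?(ltW c0)// (le_trans _ cu)//.
      by rewrite mulr_ge0 ?powR_ge0// ltW.
    - by rewrite ler_pdivlMl.
  have u0 : (0 <= u)%R.
    by rewrite (le_trans _ cu)// mulr_ge0 ?powR_ge0// ltW.
  rewrite powRM ?invr_ge0 ?(ltW c0)// ler_wpM2r ?powR_ge0//.
  apply: ler_powR; first by rewrite invf_ge1.
  by rewrite -[leRHS]invrK lef_pV2 ?posrE.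
apply: (@le_trans _ _ (v `^ del * (c^-1 `^ P * u `^ (1 - y)^-1) `^ (1 + del))%R).
  rewrite ler_pM2l ?powR_gt0// powRrM; apply: ge0_ler_powR; rewrite ?nnegrE ?powR_ge0//.
  - by rewrite addr_ge0// ltW.
  - by rewrite mulr_ge0 ?powR_ge0.
rewrite powRM ?powR_ge0// mulrCA lerDr.
by rewrite invr_ge0 ltW.
Qed.

Section doubling.
Context d (T : measurableType d) (R : realType).
Variable mu : {measure set T -> \bar R}.

Lemma le_integral_rpow (A B : set T) (z : T -> R) (s t : R) :
  measurable A -> measurable B -> A `<=` B -> measurable_fun setT z ->
  (forall x, 0 <= z x)%R -> (0 <= s)%R -> (s <= t)%R ->
  \int[mu]_(x in A) rpow s (z x) <= \int[mu]_(x in B) rpow t (z x).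
Proof.
move=> mA mB AB mz z0 s0 st.
have m u (C : set T) : (0 <= u)%R -> measurable_fun C (fun x => rpow u (z x)).
  by move=> u0; apply: measurable_funTS; exact: measurable_rpowc.
have t0 : (0 <= t)%R by exact: le_trans st.
apply: (@le_trans _ _ (\int[mu]_(x in A) rpow t (z x))).
  apply: ge0_le_integral; [exact: mA| |exact: m|exact: m|].
    by move=> x _; exact: rpow_ge0.
  by move=> x _; exact: le_rpow.
apply: ge0_subset_integral; [exact: mA|exact: mB|exact: m| |exact: AB].
by move=> x _; exact: rpow_ge0.
Qed.

(** Jensen's inequality with the roles of [y] and [1 - y] exchanged, applied to
    [u] times the indicator of [E]: its mean over [D] is at least [u/2], so the
    constant [u] is recovered from it up to a bounded factor. When [u] is below
    the threshold of Jensen's inequality, the weight lies between two constants. *)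
Lemma dual_doubling_step (D E : set T) (v P c' a u : R) (y : T -> R) :
  measurable D -> mu D = v%:E -> (0 < v <= 1)%R ->
  measurable_fun setT y -> (forall x, 0 <= y x)%R -> (0 < P)%R ->
  (forall x, P^-1 <= 1 - y x)%R -> (0 < c' <= 1)%R -> (0 <= a <= 1)%R ->
  \int[mu]_(x in D) rpow (c' * v `^ (- a)) (y x) <= 1 ->
  \int[mu]_(x in D) rpow (c' * v `^ (- (1 - a))) (1 - y x) <= 1 ->
  (1 <= u)%R -> \int[mu]_(x in D) rpow u (1 - y x) <= 1 ->
  measurable E -> E `<=` D -> mu D <= 2%:E * mu E ->
  \int[mu]_(x in D) rpow u (1 - y x) <=
    (2 * (4 / c' ^+ 2) `^ P)%:E * \int[mu]_(x in E) rpow u (1 - y x).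
Proof.
move=> mD muD v01 my z0 P0 yP c'01 /andP[a0 a1'] + + u1 + mE Es mEs.
have [c'0 c'1] : (0 < c' /\ c' <= 1)%R by case/andP: c'01.
have [v0 v1] : (0 < v /\ v <= 1)%R by case/andP: v01.
have k1 : (1 <= 4 / c' ^+ 2)%R.
  rewrite ler_pdivlMr ?exprn_gt0// mul1r (@le_trans _ _ 1%R)// ?ler1n//.
  by rewrite exprn_ile1// ltW.
have kP1 : (1 <= (4 / c' ^+ 2) `^ P)%R.
  by rewrite -[leLHS](powRr0 (4 / c' ^+ 2)); apply: ler_powR => //; exact: ltW.
have y10 x : (0 <= 1 - y x)%R by rewrite (le_trans _ (yP x))// invr_ge0 ltW.
have y11 x : (1 - y x <= 1)%R by rewrite gerBl.
have a1 : (0 <= 1 - a)%R by rewrite subr_ge0.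
have u0 : (0 <= u)%R by rewrite (le_trans _ u1).
have my' : measurable_fun setT (fun x => 1 - y x)%R by exact: measurable_funB.
have mw A : measurable_fun A (fun x => rpow u (1 - y x)).
  by apply: measurable_funTS; exact: measurable_rpowc.
have w0 x : 0 <= rpow u (1 - y x) by exact: rpow_ge0.
have [e mEfin] : exists e : R, mu E = e%:E.
  exists (fine (mu E)); rewrite fineK// ge0_fin_numE//; apply: (@le_lt_trans _ _ (mu D)).
    by apply: le_measure; rewrite ?inE.
  by rewrite muD ltry.
have ve : (v <= 2 * e)%R by move: mEs; rewrite muD mEfin -EFinM lee_fin.
have [ubig|usmall] := leP (4 / c')%R u.
  have [f fdef] : exists f : T -> R, f = (fun x => u * \1_E x)%R.
    by exists (fun x => u * \1_E x)%R.
  have mf : measurable_fun setT f.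
    by rewrite fdef; apply: measurable_funM => //; exact: measurable_indic.
  have f0 x : (0 <= f x)%R by rewrite fdef mulr_ge0// indicE.
  have [F FE] : exists F : R, (F = u * e / v)%R by exists (u * e / v)%R.
  have uF : (u / 2 <= F)%R.
    rewrite FE -mulrA ler_wpM2l// ler_pdivlMr// mulrC.
    by rewrite ler_pdivrMr// mulrC.
  have F0 : (0 <= F)%R by rewrite (le_trans _ uF)// divr_ge0.
  have cc0 : (0 <= c' * (c' / 2 * F))%R.
    apply: mulr_ge0; first exact: ltW.
    by apply: mulr_ge0 => //; rewrite divr_ge0// ltW.
  have FC : (2 / c' <= F)%R.
    apply: le_trans uF; rewrite ler_pdivlMr// (le_trans _ ubig)//.
    by rewrite mulrAC -natrM.
  have uFk : (u <= 4 / c' ^+ 2 * (c' * (c' / 2 * F)))%R.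
    have -> : (4 / c' ^+ 2 * (c' * (c' / 2 * F)) = 2 * F)%R.
      by field; rewrite gt_eqF.
    by lra.
  have y11' x : (1 * (1 - y x) <= 1)%R by rewrite mul1r.
  have a1m : (1 * (1 - a) <= 1)%R by rewrite mul1r gerBl.
  have e1 (t : R) : (1 - (1 - t) = t)%R by ring.
  have WE0 : 0 <= \int[mu]_(x in E) rpow u (1 - y x) by exact: integral_ge0.
  have HF : \int[mu]_(x in D) (f x)%:E = (F * v)%:E.
    rewrite fdef; under eq_integral do rewrite EFinM.
    rewrite ge0_integralZl//; last first.
      by apply: measurable_funTS; apply/measurable_EFinP; exact: measurable_indic.
    by rewrite integral_indic// setIidl// mEfin -EFinM FE divfK// gt_eqF.
  pose k := ((4 / c' ^+ 2) `^ P)%R.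
  have k2 : (k <= 2 * k)%R by rewrite ler_peMl ?powR_ge0// ler1n.
  have absorb : \int[mu]_(x in D) rpow u (1 - y x) <=
      k%:E * \int[mu]_(x in D) rpow (c' * (c' / 2 * F)) (1 - y x).
    rewrite -ge0_integralZl; last 4 first.
    - exact: mD.
    - by apply: measurable_funTS; exact: measurable_rpowc.
    - by move=> x _; exact: rpow_ge0.
    - by rewrite lee_fin powR_ge0.
    apply: ge0_le_integral; [exact: mD|by []|exact: mw| |].
    - apply: measurable_funTS; apply: measurable_funeM; exact: measurable_rpowc.
    move=> x _; apply: (@le_trans _ _ (rpow (4 / c' ^+ 2 * (c' * (c' / 2 * F))) (1 - y x))).
      exact: le_rpow.
    exact: rpow_scale_up.
  have vG (I : \bar R) : 0 <= I -> I <= 1 -> exists G : R, [/\ (0 <= G)%R, I = (G * v)%:E &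
      (v * G `^ 1)%:E = I].
    move=> I0 I1; have Ifin : I = (fine I)%:E.
      by rewrite fineK// ge0_fin_numE// (le_lt_trans I1)// ltry.
    have G0 : (0 <= fine I / v)%R by rewrite divr_ge0 ?fine_ge0// ltW.
    have E1 : (fine I / v * v = fine I)%R by rewrite divfK// gt_eqF.
    by exists (fine I / v)%R; rewrite powRr1// [(v * _)%R]mulrC E1 -Ifin.
  have fE x : rpow (f x) (1 - y x) = (fun x => rpow u (1 - y x)) \_ E x.
    rewrite fdef /patch indicE; case: ifP => _; first by rewrite mulr1.
    by rewrite mulr0 rpow0l.
  have intf : \int[mu]_(x in D) rpow (f x) (1 - y x) = \int[mu]_(x in E) rpow u (1 - y x).
    rewrite -[in RHS](setIidr Es) integral_mkcondr.
    by apply: eq_integral => x _; exact: fE.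
  move=> HaD HdD Hu.
  have WE : \int[mu]_(x in E) rpow u (1 - y x) <= 1.
    by apply: le_trans Hu; apply: ge0_subset_integral.
  have [G [G0 WG vGE]] := vG _ WE0 WE.
  have HG : \int[mu]_(x in D) rpow (f x) (1 * (1 - y x)) = (G * v)%:E.
    by under eq_integral do rewrite mul1r; rewrite intf.
  have HpD : \int[mu]_(x in D) rpow (c' * v `^ (- (1 - (1 - a)))) (1 - (1 - y x)) <= 1.
    rewrite (e1 a); under eq_integral do rewrite (e1 (y _)); exact: HaD.
  have HqD : \int[mu]_(x in D)
      rpow (c' * v `^ (- (1 - 1 * (1 - a)))) (1 - 1 * (1 - y x)) <= 1.
    rewrite (mul1r (1 - a)%R) (e1 a).
    under eq_integral do rewrite (mul1r (1 - y _)%R) (e1 (y _)); exact: HaD.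
  have Hf : \int[mu]_(x in D) rpow (f x) (1 - y x) <= 1 by rewrite intf.
  have := jensen_gain mD muD v01 my' y10 (lexx _) y11' mf f0 a1 a1m c'01
    HdD HpD HqD Hf HF FC HG.
  rewrite vGE => Hj; apply: le_trans absorb _.
  clear Hf HqD HpD HdD HaD Hu.
  apply: (@le_trans _ _ (k%:E * \int[mu]_(x in E) rpow u (1 - y x))).
    by apply: lee_wpmul2l => //; rewrite lee_fin powR_ge0.
  by apply: lee_wpmul2r => //; rewrite lee_fin.
move=> _ _ _.
have c'4 : (u `^ P <= (4 / c' ^+ 2) `^ P)%R.
  have uk : (u <= 4 / c' ^+ 2)%R.
    apply: le_trans (ltW usmall) _.
    rewrite ler_pM2l// lef_pV2 ?posrE ?exprn_gt0//.
    by rewrite expr2 ler_piMr// ltW.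
  apply: ge0_ler_powR; [exact: ltW|by rewrite nnegrE|by rewrite nnegrE (le_trans _ k1)|exact: uk].
have wle x : rpow u (1 - y x) <= ((4 / c' ^+ 2) `^ P)%:E.
  apply: (@le_trans _ _ (u `^ P)%:E); last by rewrite lee_fin.
  have := @rpow_scale_up R u 1 (1 - y x) P u1 ler01 P0 (yP x).
  rewrite mulr1 => /le_trans; apply.
  rewrite -[leRHS]mule1; apply: lee_wpmul2l; first by rewrite lee_fin powR_ge0.
  by apply: rpow_le1; rewrite ?ler01 ?lexx// y10 y11.
have wge x : 1 <= rpow u (1 - y x).
  have [->|un1] := eqVneq u 1%R.
    by rewrite rpowE ?(lt_le_trans _ (yP x)) ?invr_gt0// powR1.
  have u1' : (1 < u)%R by rewrite lt_neqAle eq_sym un1.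
  apply: le_trans (rpow_ge1 u1' _); first by rewrite lee_fin.
  by rewrite y10 y11.
apply: (@le_trans _ _ ((4 / c' ^+ 2) `^ P * v)%:E).
  rewrite EFinM -muD -integral_cst//.
  by apply: ge0_le_integral.
apply: (@le_trans _ _ ((2 * (4 / c' ^+ 2) `^ P)%:E * e%:E)).
  rewrite -EFinM lee_fin mulrAC [leRHS]mulrC ler_wpM2l ?powR_ge0//.
rewrite lee_wpmul2l ?lee_fin ?mulr_ge0 ?powR_ge0//.
rewrite -mEfin -[leLHS]mul1e -integral_cst//.
by apply: ge0_le_integral.
Qed.

(** Integration of [exponent_gain], the power [1 + 1/m] of the weight being
    controlled by the reverse Hoelder inequality. *)
Lemma dual_gain_step (N : seq bool -> set T) (v u c a q P C : R) (y : T -> R) (m : nat) :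
  (forall s, measurable (N s)) ->
  (forall s, N s = N (false :: s) `|` N (true :: s)) ->
  (forall s, N (false :: s) `&` N (true :: s) = set0) ->
  (forall s, mu (N s) = (v / 2 ^+ size s)%:E) ->
  (forall G, measurable G -> G `<=` N [::] -> 0 < mu G ->
    exists s, (3 / 4)%:E * mu (N s) <= mu (G `&` N s)) ->
  (0 < v <= 1)%R -> (0 < c <= 1)%R -> (0 <= a)%R -> (1 <= u)%R -> (1 <= q)%R ->
  (0 < P)%R -> (1 <= C)%R -> (0 < m)%N -> (6 * C <= m%:R)%R ->
  measurable_fun setT y -> (forall x, 0 <= y x)%R ->
  (forall x, P^-1 <= 1 - y x)%R -> (forall x, q * y x < 1)%R -> (q * a <= 1)%R ->
  (forall x, q * (1 - y x) <= (1 + m%:R^-1) * (1 - q * y x))%R ->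
  (c * v `^ (- (1 - a)) <= u)%R ->
  \int[mu]_(x in N [::]) rpow u (1 - y x) <= 1 ->
  (forall s E, measurable E -> E `<=` N s -> mu (N s) <= 2%:E * mu E ->
    \int[mu]_(x in N s) rpow u (1 - y x) <= C%:E * \int[mu]_(x in E) rpow u (1 - y x)) ->
  \int[mu]_(x in N [::]) rpow (c / (1 + (c^-1 `^ P) `^ (1 + m%:R^-1) * (2 + 16 * C)) *
     v `^ (- (1 - q * a))) (1 - q * y x) <= 1.
Proof.
move=> mN NU Ndisj Nmu Ndense v01 c01 a0 u1 q1 P0 C1 m0 mC my z0 yP qy1 qa1 qcond cu Hu HC.
have [v0 v1] : (0 < v /\ v <= 1)%R by case/andP: v01.
have [c0 c1] : (0 < c /\ c <= 1)%R by case/andP: c01.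
set del := (m%:R^-1)%R in qcond *.
have d0 : (0 < del)%R by rewrite invr_gt0 ltr0n.
set A := (1 + _)%R.
have A1 : (1 <= A)%R.
  rewrite lerDl mulr_ge0 ?powR_ge0// addr_ge0// mulr_ge0// ltW//.
  exact: lt_le_trans C1.
have A0 : (0 < A)%R by exact: lt_le_trans A1.
have u0 : (0 < u)%R by exact: lt_le_trans u1.
have y10 x : (0 < 1 - y x)%R by rewrite (lt_le_trans _ (yP x))// invr_gt0.
have my' : measurable_fun setT (fun x => 1 - y x)%R by exact: measurable_funB.
have N0mu : mu (N [::]) = v%:E by rewrite Nmu divr1.
pose w x := (u `^ (1 - y x)^-1)%R.
have wE x : rpow u (1 - y x) = (w x)%:E by rewrite rpowE.
have mw : measurable_fun setT w.
  apply/measurable_EFinP; rewrite (_ : EFin \o w = fun x => rpow u (1 - y x)); last first.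
    by apply/funext => x; rewrite /= -wE.
  by apply: measurable_rpowc => //; [move=> x; exact: ltW|exact: ltW].
have w0 x : (0 <= w x)%R by exact: powR_ge0.
have wB x : (w x <= u `^ P)%R.
  apply: ler_powR => //.
  by rewrite -[leRHS]invrK lef_pV2 ?posrE ?invr_gt0.
have doub s E : measurable E -> E `<=` N s -> mu (N s) <= 2%:E * mu E ->
    \int[mu]_(x in N s) (w x)%:E <= C%:E * \int[mu]_(x in E) (w x)%:E.
  move=> mE EN mEN; have := HC s E mE EN mEN.
  by under eq_integral do rewrite wE; under [in leRHS]eq_integral do rewrite wE.
have Hw : \int[mu]_(x in N [::]) (w x)%:E <= 1.
  by under eq_integral do rewrite -wE.
have w1 x : (1 <= w x)%R.
  by rewrite -[leLHS](powRr0 u); apply: ler_powR => //; rewrite invr_ge0 ltW.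
set W := fine (\int[mu]_(x in N [::]) (w x)%:E).
have WE : \int[mu]_(x in N [::]) (w x)%:E = W%:E.
  rewrite fineK//; rewrite ge0_fin_numE; first exact: le_lt_trans Hw (ltry _).
  by apply: integral_ge0 => x _; rewrite lee_fin.
have W1 : (W <= 1)%R by rewrite -lee_fin -WE.
have W0 : (0 < W)%R.
  apply: (lt_le_trans v0); rewrite -lee_fin -WE -N0mu -[leLHS]mul1e -integral_cst; last exact: mN.
  apply: ge0_le_integral; [exact: mN|by []|exact: measurable_cst| |].
    by apply: measurable_funTS; apply/measurable_EFinP.
  by move=> x _; rewrite lee_fin.
have RH : \int[mu]_(x in N [::]) (w x `^ (1 + del))%:E <= ((2 + 16 * C) * v `^ (- del))%:E.
  have := @reverse_holder _ _ R mu N v w (u `^ P)%R C mN NU Ndisj Nmu v0 mw w0 wB C1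
    doub Ndense m m0 mC W0.
  move=> /le_trans; apply; rewrite -/W -/del lee_fin.
  have C20 : (0 <= 2 + 16 * C)%R by rewrite addr_ge0// mulr_ge0// (le_trans _ C1).
  rewrite -mulrA ler_wpM2l// -[leRHS]mulr1 ler_pM ?powR_ge0 ?(ltW W0)//.
  have -> : (v `^ (- del) = v^-1 `^ del)%R by rewrite -(powR_inv1 (ltW v0)) -powRrM mulN1r.
  apply: ge0_ler_powR; [exact: ltW| | |].
  - by rewrite nnegrE divr_ge0 ?(ltW W0) ?(ltW v0).
  - by rewrite nnegrE invr_ge0 ltW.
  by rewrite -[leRHS]mul1r ler_wpM2r// invr_ge0 ltW.
pose K := ((c^-1 `^ P) `^ (1 + del))%R.
have K0 : (0 <= K)%R by exact: powR_ge0.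
have ptw x : rpow (c / A * v `^ (- (1 - q * a))) (1 - q * y x) <=
    (A^-1 * v^-1)%:E + (A^-1 * (K * v `^ del))%:E * (w x `^ (1 + del))%:E.
  have qy0 : (0 < 1 - q * y x)%R by rewrite subr_gt0.
  have qyle : (1 - q * y x <= 1)%R.
    by rewrite gerBl mulr_ge0// (le_trans ler01)// ltW.
  have cA : (0 <= c / A * v `^ (- (1 - q * a)))%R by rewrite mulr_ge0 ?powR_ge0// divr_ge0// ltW.
  apply: (@le_trans _ _ (rpow (A^-1 * v `^ (- (1 - q * a))) (1 - q * y x))).
    apply: le_rpow => //; first exact: ltW.
    by rewrite ler_wpM2r ?powR_ge0// ler_piMl// invr_ge0 ltW.
  apply: (@le_trans _ _ (A^-1%:E * rpow (v `^ (- (1 - q * a))) (1 - q * y x))).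
    apply: rpow_scale.
    - by rewrite invr_gt0 A0/= invf_le1.
    - exact: powR_ge0.
    - by rewrite (ltW qy0).
  rewrite rpowE// -!EFinM -EFinD lee_fin -mulrA -mulrDr ler_pM2l ?invr_gt0//.
  by rewrite -mulrA; exact: exponent_gain.
apply: (@le_trans _ _ (\int[mu]_(x in N [::])
    ((A^-1 * v^-1)%:E + (A^-1 * (K * v `^ del))%:E * (w x `^ (1 + del))%:E))).
  apply: ge0_le_integral; [exact: mN|by move=> x _; exact: rpow_ge0| | |by move=> x _; exact: ptw].
  - apply: measurable_funTS; apply: measurable_rpowc.
    + by apply: measurable_funB => //; exact: measurable_funM.
    + by move=> x; rewrite subr_ge0 ltW.
    + by rewrite mulr_ge0 ?powR_ge0// divr_ge0// ltW.
  - apply: measurable_funTS; apply: emeasurable_funD => //.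
    apply: measurable_funeM; apply/measurable_EFinP.
    exact: measurableT_comp (measurable_powR _) mw.
have mwd : measurable_fun (N [::]) (fun x => (w x `^ (1 + del))%:E).
  apply: measurable_funTS; apply/measurable_EFinP.
  exact: measurableT_comp (measurable_powR _) mw.
have AK : (0 <= A^-1 * (K * v `^ del))%R by rewrite !mulr_ge0 ?powR_ge0// invr_ge0 ltW.
rewrite ge0_integralD; last 5 first.
- exact: mN.
- by move=> x _; rewrite lee_fin mulr_ge0 ?invr_ge0// ltW.
- exact: measurable_cst.
- by move=> x _; rewrite -EFinM lee_fin mulr_ge0 ?powR_ge0.
- exact: measurable_funeM.
rewrite ge0_integralZl; last 4 first.
- exact: mN.
- exact: mwd.
- by move=> x _; rewrite lee_fin powR_ge0.
- by rewrite lee_fin.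
rewrite integral_cst; last exact: mN.
rewrite N0mu -EFinM divfK ?gt_eqF//.
apply: (@le_trans _ _ (A^-1%:E + (A^-1 * (K * v `^ del))%:E * ((2 + 16 * C) * v `^ (- del))%:E)).
  by rewrite leeD2l// lee_wpmul2l.
rewrite -EFinM -EFinD lee_fin.
have -> : (A^-1 + A^-1 * (K * v `^ del) * ((2 + 16 * C) * v `^ (- del)) = A^-1 * A)%R.
  transitivity (A^-1 * (1 + K * (2 + 16 * C)))%R; last by [].
  by rewrite powRN; field; rewrite !gt_eqF ?powR_gt0.
by rewrite mulVf// gt_eqF.
Qed.

End doubling.

Section local_theory.
Context {R : realType} (n : nat).
Hypothesis n_gt0 : (0 < n)%N.
Local Notation mu := (@lebesgue_n R n).
Implicit Types (y : Rn R n -> R) (b : n.-tuple R).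

(** For the cubes of measure at most 1, the indicator has [p]-norm at most
    [|Q|^a / c] and [p']-norm at most [|Q|^(1-a) / c]; the number [a] stands for
    the mean of [y]. *)
Definition local_muckenhoupt (c r : R) y := forall b L,
  (0 < L)%R -> (L ^+ n <= 1)%R -> exists a : R, [/\ (0 <= a <= r^-1)%R,
    \int[mu]_(x in cube b L) rpow (c * (L ^+ n) `^ (- a)) (y x) <= 1 &
    \int[mu]_(x in cube b L) rpow (c * (L ^+ n) `^ (- (1 - a))) (1 - y x) <= 1].

Lemma dual_doubling (r c : R) : (1 < r)%R -> (0 < c <= 1)%R ->
  exists2 C : R, (1 <= C)%R & forall y, measurable_fun setT y ->
  (forall x, 0 <= y x <= r^-1)%R -> local_muckenhoupt c r y ->
  forall b (L u : R), (0 < L)%R -> (L ^+ n <= 1)%R -> (1 <= u)%R ->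
  \int[mu]_(x in dyad (tnth b) L [::]) rpow u (1 - y x) <= 1 ->
  forall s E, measurable E -> E `<=` dyad (tnth b) L s ->
  mu (dyad (tnth b) L s) <= 2%:E * mu E ->
  \int[mu]_(x in dyad (tnth b) L s) rpow u (1 - y x) <=
    C%:E * \int[mu]_(x in E) rpow u (1 - y x).
Proof.
move=> r1 /andP[c0 c1].
pose P := ((1 - r^-1)^-1)%R.
have r0 : (0 < r)%R by exact: lt_trans r1.
have iP0 : (0 < 1 - r^-1)%R by rewrite subr_gt0 invf_lt1.
have P0 : (0 < P)%R by rewrite invr_gt0.
pose c' := (c / 2 ^+ n)%R.
have c'0 : (0 < c')%R by rewrite divr_gt0// exprn_gt0.
have c'1 : (c' <= 1)%R.
  by rewrite ler_pdivrMr ?exprn_gt0// mul1r (le_trans c1)// exprn_ege1// ler1n.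
have k1 : (1 <= 4 / c' ^+ 2)%R.
  rewrite ler_pdivlMr ?exprn_gt0// mul1r (@le_trans _ _ 1%R)// ?ler1n//.
  by rewrite exprn_ile1// ltW.
have kP1 : (1 <= (4 / c' ^+ 2) `^ P)%R.
  by rewrite -[leLHS](powRr0 (4 / c' ^+ 2)); apply: ler_powR => //; exact: ltW.
exists (2 * (4 / c' ^+ 2) `^ P)%R; first by lra.
move=> y my yr HA b L u L0 L1 u1 Hu s E mE Es mEs.
have z0 x : (0 <= y x)%R by case/andP: (yr x).
have z1 x : (y x <= r^-1)%R by case/andP: (yr x).
have yP x : (P^-1 <= 1 - y x)%R by rewrite /P invrK; have := z1 x; lra.
have y10 x : (0 <= 1 - y x)%R by rewrite (le_trans _ (yP x))// invr_ge0 ltW.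
have y11 x : (1 - y x <= 1)%R by rewrite gerBl.
have u0 : (0 <= u)%R by rewrite (le_trans _ u1).
have my' : measurable_fun setT (fun x => 1 - y x)%R by exact: measurable_funB.
set D := dyad (tnth b) L s in Es mEs *.
have mD : measurable D by exact: measurable_dyad.
have muD : mu D = (L ^+ n / 2 ^+ size s)%:E by exact: dyad_measure.
set v := (L ^+ n / 2 ^+ size s)%R in muD.
have v0 : (0 < v)%R by rewrite divr_gt0 ?exprn_gt0.
have v1 : (v <= 1)%R.
  by rewrite ler_pdivrMr ?exprn_gt0// mul1r (le_trans L1)// exprn_ege1// ler1n.
have v01 : (0 < v <= 1)%R by rewrite v0.
have [b' [L' [L'0 L'L DQ L'v]]] := dyad_sub_cube n_gt0 (tnth b) L0 s.
have L'1 : (L' ^+ n <= 1)%R.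
  by apply: le_trans L1; rewrite lerXn2r ?nnegrE ?(ltW L0) ?(ltW L'0).
have [a [/andP[a0 ar] Ha Hd]] := HA b' L' L'0 L'1.
have a1 : (0 <= 1 - a)%R by rewrite subr_ge0 (le_trans ar)// invf_le1// ltW.
have [mQ muQ] := lebesgue_cube b' (ltW L'0).
have scale (e : R) : (0 <= e <= 1)%R ->
    (c' * v `^ (- e) <= c * (L' ^+ n) `^ (- e))%R.
  move=> /andP[e0 e1]; rewrite /c' -mulrA ler_pM2l// ler_pdivrMl ?exprn_gt0//.
  rewrite !powRN -[leRHS]invrK lef_pV2 ?posrE ?powR_gt0 ?invr_gt0 ?mulr_gt0 ?invr_gt0 ?powR_gt0 ?exprn_gt0//.
  rewrite invfM invrK ler_pdivrMl ?exprn_gt0//.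
  apply: (@le_trans _ _ ((2 ^+ n * v) `^ e)%R).
    have p1 : (L' ^+ n)%R \is Num.nneg by rewrite nnegrE exprn_ge0// ltW.
    have p2 : (2 ^+ n * v)%R \is Num.nneg by rewrite nnegrE mulr_ge0 ?exprn_ge0// ltW.
    exact: (ge0_ler_powR e0 p1 p2 L'v).
  rewrite powRM ?exprn_ge0 ?(ltW v0)// ler_wpM2r ?powR_ge0//.
  rewrite -[leRHS]powRr1 ?exprn_ge0//; apply: ler_powR => //.
  by rewrite exprn_ege1// ler1n.
have onD (e : R) (z : Rn R n -> R) : (0 <= e <= 1)%R -> measurable_fun setT z ->
    (forall x, 0 <= z x)%R ->
    \int[mu]_(x in cube b' L') rpow (c * (L' ^+ n) `^ (- e)) (z x) <= 1 ->
    \int[mu]_(x in D) rpow (c' * v `^ (- e)) (z x) <= 1.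
  move=> e01 mz zz H; apply: le_trans H.
  have := @le_integral_rpow _ _ R mu D (cube b' L') z _ _ mD mQ DQ mz zz _ (scale e e01); apply.
  by rewrite mulr_ge0 ?powR_ge0// ltW.
have a01 : (0 <= a <= 1)%R by rewrite a0 -subr_ge0.
have a01' : (0 <= 1 - a <= 1)%R by rewrite a1 gerBl.
have HaD := onD a y a01 my z0 Ha.
have HdD := onD (1 - a)%R (fun x => 1 - y x)%R a01' my' y10 Hd.
apply: (@dual_doubling_step _ _ R mu D E v P c' a u y mD muD v01 my z0 P0 yP
  _ a01 HaD HdD u1 _ mE Es mEs).
  by rewrite c'0.
apply: le_trans Hu.
have DN : D `<=` dyad (tnth b) L [::] by apply: node_sub => s'; exact: dyadU.
have := @le_integral_rpow _ _ R mu D (dyad (tnth b) L [::]) (fun x => 1 - y x)%R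
  u u mD (measurable_dyad (tnth b) L0 [::]) DN my' y10 u0 (lexx u).
by apply.
Qed.

(** The constants depend on [y] only through [r] and [c]: the exponent [q] comes
    from the doubling constant via the reverse Hoelder inequality. *)
Lemma dual_gain (r c : R) : (1 < r)%R -> (0 < c <= 1)%R ->
  exists q c1 : R, [/\ (1 < q)%R, (q < r)%R, (0 < c1 <= c)%R &
  forall y, measurable_fun setT y ->
  (forall x, 0 <= y x <= r^-1)%R -> local_muckenhoupt c r y ->
  forall b (L a : R), (0 < L)%R -> (L ^+ n <= 1)%R -> (0 <= a <= r^-1)%R ->
  \int[mu]_(x in cube b L) rpow (c * (L ^+ n) `^ (- (1 - a))) (1 - y x) <= 1 ->
  \int[mu]_(x in dyad (tnth b) L [::])
     rpow (c1 * (L ^+ n) `^ (- (1 - q * a))) (1 - q * y x) <= 1].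
Proof.
move=> r1 c01; have [C C1 HC] := dual_doubling r1 c01.
have [c0 c1] : (0 < c /\ c <= 1)%R by case/andP: c01.
pose P := ((1 - r^-1)^-1)%R.
have r0 : (0 < r)%R by exact: lt_trans r1.
have iP0 : (0 < 1 - r^-1)%R by rewrite subr_gt0 invf_lt1.
have P0 : (0 < P)%R by rewrite invr_gt0.
pose m := (Num.truncn (6 * C)%R).+1.
have mC : (6 * C <= m%:R)%R by rewrite ltW// truncnS_gt.
pose del := (m%:R^-1 : R)%R.
have d0 : (0 < del)%R by rewrite invr_gt0 ltr0n.
pose q := ((1 + del) / (1 + del / r))%R.
have dr0 : (0 < 1 + del / r)%R by rewrite addr_gt0// divr_gt0.
have q1 : (1 < q)%R.
  by rewrite ltr_pdivlMr// mul1r ltrD2l ltr_pdivrMr// -[ltLHS]mulr1 ltr_pM2l.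
have qr : (q < r)%R.
  rewrite ltr_pdivrMr// mulrDr mulr1 mulrCA divff ?gt_eqF// mulr1.
  by rewrite ltrD2r.
pose A := (1 + (c^-1 `^ P) `^ (1 + del) * (2 + 16 * C))%R.
have A1 : (1 <= A)%R.
  rewrite lerDl mulr_ge0 ?powR_ge0// addr_ge0// mulr_ge0// ltW//.
  exact: lt_le_trans C1.
have A0 : (0 < A)%R by exact: lt_le_trans A1.
exists q, (c / A)%R; split; [exact: q1|exact: qr| |].
  by rewrite divr_gt0//= ler_pdivrMr// ler_peMr// ltW.
move=> y my yr.
have z0 x : (0 <= y x)%R by case/andP: (yr x).
have z1 x : (y x <= r^-1)%R by case/andP: (yr x).
have qE : (q * (1 + del / r) = 1 + del)%R by rewrite /q divfK// gt_eqF.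
have qcond x : (q * (1 - y x) <= (1 + del) * (1 - q * y x))%R.
  have -> : ((1 + del) * (1 - q * y x) = q * (1 + del / r - (1 + del) * y x))%R.
    by rewrite -qE; ring.
  rewrite ler_pM2l; last exact: lt_trans q1.
  have : (del * y x <= del / r)%R by rewrite ler_pM2l.
  by rewrite mulrDl mul1r; lra.
move=> HA b L a L0 L1 /andP[a0 ar] Hd.
have yP x : (P^-1 <= 1 - y x)%R by rewrite /P invrK lerD2l lerN2.
have y10 x : (0 < 1 - y x)%R by rewrite (lt_le_trans _ (yP x))// invr_gt0.
have my' : measurable_fun setT (fun x => 1 - y x)%R by exact: measurable_funB.
set N := dyad (tnth b) L.
have mN s : measurable (N s) by exact: measurable_dyad.
have NU s : N s = N (false :: s) `|` N (true :: s) by exact: dyadU.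
have Ndisj s : N (false :: s) `&` N (true :: s) = set0 by exact: dyad_disj.
have Nmu s : mu (N s) = (L ^+ n / 2 ^+ size s)%:E by exact: dyad_measure.
set v := (L ^+ n)%R in Nmu L1 Hd *.
have v0 : (0 < v)%R by rewrite exprn_gt0.
have N0mu : mu (N [::]) = v%:E by rewrite Nmu divr1.
have Nsmall eps : (0 < eps)%R -> exists d, forall s, size s = d ->
    forall x x', N s x -> N s x' -> forall i, (`|tnth x i - tnth x' i| <= eps)%R.
  by move=> e0; exact: dyad_small.
have Nfin : mu (N [::]) < +oo by rewrite N0mu ltry.
have Ndense := node_dense mN NU Ndisj Nfin Nsmall.
have NQ : N [::] `<=` cube b L by move=> x H i; have /andP[-> /ltW] := H i.
have [mQ muQ] := lebesgue_cube b (ltW L0).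
(* the maximum with 1 makes the weight at least 1 everywhere *)
pose u := Num.max 1%R (c * v `^ (- (1 - a)))%R.
have u1 : (1 <= u)%R by rewrite le_max lexx.
have cu : (c * v `^ (- (1 - a)) <= u)%R by rewrite le_max lexx orbT.
have u0 : (0 < u)%R by exact: lt_le_trans u1.
have Hu : \int[mu]_(x in N [::]) rpow u (1 - y x) <= 1.
  rewrite /u; case: (leP 1%R _) => h.
    apply: le_trans Hd.
    have h0 : (0 <= c * v `^ (- (1 - a)))%R by rewrite mulr_ge0 ?powR_ge0// ltW.
    have := @le_integral_rpow _ _ R mu (N [::]) (cube b L) (fun x => 1 - y x)%R
      _ _ (mN [::]) mQ NQ my' (fun x => ltW (y10 x)) h0 (lexx _).
    by apply.
  apply: (@le_trans _ _ (\int[mu]_(x in N [::]) 1)).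
    apply: ge0_le_integral; [exact: mN|by move=> x _; exact: rpow_ge0| |exact: measurable_cst|].
      by apply: measurable_funTS; apply: measurable_rpowc => // x; exact: ltW.
    move=> x _; apply: rpow_le1; first by rewrite ler01 lexx.
    by rewrite (ltW (y10 x)) gerBl z0.
  rewrite integral_cst; last exact: mN.
  rewrite mul1e; apply: (@le_trans _ _ v%:E); last by rewrite lee_fin.
  by rewrite le_eqVlt; apply/orP; left; apply/eqP; exact: N0mu.
have qy1 x : (q * y x < 1)%R.
  apply: (@le_lt_trans _ _ (q * r^-1)%R).
    by rewrite ler_wpM2l// (le_trans ler01)// ltW.
  by rewrite ltr_pdivrMr// mul1r.
have qa1 : (q * a <= 1)%R.
  apply: (@le_trans _ _ (q * r^-1)%R).
    by rewrite ler_wpM2l// (le_trans ler01)// ltW.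
  by rewrite ler_pdivrMr// mul1r ltW.
have v01 : (0 < v <= 1)%R by rewrite v0.
have := @dual_gain_step _ _ R mu N v u c a q P C y m mN NU Ndisj Nmu Ndense v01 c01
  a0 u1 (ltW q1) P0 C1 isT mC my z0 yP qy1 qa1 qcond cu Hu
  (HC y my yr HA b L u L0 L1 u1 Hu).
by apply.
Qed.

End local_theory.

(** * Maximal functions of countable families of sets *)

Section maximal_layers.
Context d (T : measurableType d) (R : realType).
Variable mu : {measure set T -> \bar R}.

(** The integral of a nonnegative function is a supremum over the simple
    functions below it. *)
Lemma le_integral_ge0 (f g : T -> \bar R) : (forall x, 0 <= f x) ->
  (forall x, f x <= g x) -> \int[mu]_x f x <= \int[mu]_x g x.
Proof.
move=> f0 fg; have g0 x : 0 <= g x by exact: le_trans (fg x).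
rewrite !ge0_integralTE//; apply: ge_ereal_sup => _ [h /= hf <-].
by apply: ereal_sup_ubound; exists h => //= x; exact: le_trans (fg x).
Qed.

(** Hoelder's inequality with respect to the weight [f], in additive form. The
    negative power of [f] on the right is what makes the sum over the levels
    converge. *)
Lemma mean_power_truncation (D : set T) (v q S A tau : R) (f h : T -> R) :
  measurable D -> mu D = v%:E -> (0 < v)%R -> (1 < q)%R -> (0 < S)%R ->
  (0 < tau)%R -> measurable_fun setT f -> measurable_fun setT h ->
  (forall x, 0 <= f x)%R -> (forall x, 0 <= h x)%R -> (0 <= A)%R ->
  \int[mu]_(x in D) (f x)%:E <= (S * v)%:E ->
  \int[mu]_(x in D) (if tau < f x then h x else 0)%R%:E = (A * v)%:E ->
  (v * A `^ q)%:E <= (S `^ (q - 1))%:E *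
    \int[mu]_(x in D) (if tau < f x then h x `^ q * f x `^ (1 - q) else 0)%R%:E.
Proof.
move=> mD muD v0 q1 S0 t0 mf mh f0 h0 A0 HS HA.
have q0 : (0 < q)%R by exact: lt_trans q1.
have q10 : (0 < q - 1)%R by rewrite subr_gt0.
(* the ratio of the two means is the optimal parameter in Young's inequality *)
pose s := (A / S)%R.
have s0 : (0 <= s)%R by rewrite divr_ge0// ltW.
pose g x := (if tau < f x then h x `^ q * f x `^ (1 - q) else 0)%R.
pose hh x := (if tau < f x then h x else 0)%R.
have g0 x : (0 <= g x)%R by rewrite /g; case: ifP => _ //; rewrite mulr_ge0 ?powR_ge0.
have hh0 x : (0 <= hh x)%R by rewrite /hh; case: ifP.
have mt : measurable_fun setT (fun x => tau < f x)%R.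
  by apply: measurable_fun_ltr => //; exact: measurable_cst.
have mfq : measurable_fun setT (fun x => f x `^ (1 - q))%R.
  exact: measurableT_comp (measurable_powR _) mf.
have mhq : measurable_fun setT (fun x => h x `^ q)%R.
  exact: measurableT_comp (measurable_powR _) mh.
have mg : measurable_fun setT g.
  apply: measurable_fun_ifT => //; exact: measurable_funM.
have mhh : measurable_fun setT hh by apply: measurable_fun_ifT.
have young x : (q * s `^ (q - 1) * hh x <= g x + (q - 1) * s `^ q * f x)%R.
  rewrite /hh /g; case: ifPn => tf; last first.
    by rewrite mulr0 add0r !mulr_ge0 ?powR_ge0// ltW.
  have fx0 : (0 < f x)%R by exact: lt_trans tf.
  have qi : (0 <= q^-1 <= 1)%R by rewrite invr_ge0 (ltW q0) invf_le1// ltW.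
  have := powR_young qi (mulr_ge0 (powR_ge0 (h x) q) (powR_ge0 (f x) (1 - q)))
    (mulr_ge0 (powR_ge0 s q) (f0 x)).
  have -> : ((h x `^ q * f x `^ (1 - q)) `^ q^-1 = h x * f x `^ (- (1 - q^-1)))%R.
    rewrite powRM ?powR_ge0// -!powRrM divff ?gt_eqF// powRr1//.
    by congr (_ * _ `^ _)%R; field; rewrite gt_eqF.
  have -> : ((s `^ q * f x) `^ (1 - q^-1) = s `^ (q - 1) * f x `^ (1 - q^-1))%R.
    rewrite powRM ?powR_ge0// -powRrM.
    by congr (_ `^ _ * _)%R; field; rewrite gt_eqF.
  rewrite (powRN (f x)).
  have fp : (f x `^ (1 - q^-1) != 0)%R by rewrite gt_eqF ?powR_gt0.
  have -> : (h x / f x `^ (1 - q^-1) * (s `^ (q - 1) * f x `^ (1 - q^-1)) =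
    s `^ (q - 1) * h x)%R by field.
  rewrite -(ler_pM2l q0) => H; rewrite -mulrA (le_trans H)// le_eqVlt.
  by apply/orP; left; apply/eqP; field; rewrite gt_eqF.
have : \int[mu]_(x in D) ((q * s `^ (q - 1))%:E * (hh x)%:E) <=
    \int[mu]_(x in D) ((g x)%:E + ((q - 1) * s `^ q)%:E * (f x)%:E).
  apply: ge0_le_integral => //.
  - by move=> x _; rewrite -EFinM lee_fin !mulr_ge0 ?powR_ge0// ltW.
  - apply: measurable_funTS; apply: measurable_funeM; exact/measurable_EFinP.
  - apply: measurable_funTS; apply: emeasurable_funD; first exact/measurable_EFinP.
    by apply: measurable_funeM; exact/measurable_EFinP.
  - by move=> x _; rewrite -!EFinM -EFinD lee_fin.
rewrite ge0_integralZl//; last 3 first.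
- by apply: measurable_funTS; exact/measurable_EFinP.
- by move=> x _; rewrite lee_fin.
- by rewrite lee_fin mulr_ge0 ?powR_ge0// ltW.
rewrite ge0_integralD//; last 4 first.
- by move=> x _; rewrite lee_fin.
- by apply: measurable_funTS; exact/measurable_EFinP.
- by move=> x _; rewrite -EFinM lee_fin !mulr_ge0 ?powR_ge0// ltW.
- by apply: measurable_funTS; apply: measurable_funeM; exact/measurable_EFinP.
rewrite ge0_integralZl//; last 3 first.
- by apply: measurable_funTS; exact/measurable_EFinP.
- by move=> x _; rewrite lee_fin.
- by rewrite lee_fin mulr_ge0 ?powR_ge0// ltW.
rewrite HA -EFinM.
set I := \int[mu]_(x in D) (g x)%:E.
have I0 : 0 <= I by apply: integral_ge0 => x _; rewrite lee_fin.
move=> H.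
have {}H : (q * s `^ (q - 1) * (A * v))%:E <= I + ((q - 1) * s `^ q * (S * v))%:E.
  apply: le_trans H _; rewrite leeD2l// [leRHS]EFinM lee_wpmul2l// lee_fin.
  by rewrite mulr_ge0 ?powR_ge0// ltW.
have key : (A * s `^ (q - 1) = s `^ q * S)%R.
  have [A00|An0] := eqVneq A 0%R.
    have s00 : s = 0%R by rewrite /s A00 mul0r.
    by rewrite A00 mul0r s00 powR0 ?mul0r// gt_eqF.
  have sp : (0 < s)%R by rewrite divr_gt0// lt_def An0.
  have -> : (s `^ q = s `^ (q - 1) * s)%R.
    by rewrite -[X in (_ * X)%R](powRr1 s0) -gt0_powRD// subrK.
  by rewrite -mulrA /s divfK ?gt_eqF// mulrC.
have vA : (v * A `^ q = S `^ (q - 1) * (s `^ q * S * v))%R.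
  rewrite /s powRM ?invr_ge0 ?(ltW S0)//.
  have -> : (S^-1 `^ q = (S `^ (q - 1))^-1 * S^-1)%R.
    rewrite -{1}(powR_inv1 (ltW S0)) -powRrM mulN1r.
    have {1}-> : q = (q - 1 + 1)%R by rewrite subrK.
    by rewrite powRN gt0_powRD// powRr1 ?(ltW S0)// invfM.
  by field; rewrite !gt_eqF ?powR_gt0.
rewrite vA EFinM lee_wpmul2l ?lee_fin ?powR_ge0//.
have [If|If] := eqVneq I +oo; first by rewrite -/g -/I If leey.
have IE : I = (fine I)%:E by rewrite fineK// ge0_fin_numE// ltey.
rewrite -/I IE lee_fin; rewrite IE -EFinD lee_fin in H.
have e1 : (q * s `^ (q - 1) * (A * v) = q * (s `^ q * S * v))%R.
  by rewrite -key; ring.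
by rewrite e1 in H; lra.
Qed.

(** The levels grow geometrically and the power [q - 1] is positive, so the sum
    is comparable to its last term. *)
Lemma geometric_levels (q al t : R) (K : nat) : (1 < q)%R -> (0 < al)%R -> (0 <= t)%R ->
  (\sum_(k < K) (if al * 2 ^+ k / 2 < t then (al * 2 ^+ k.+1) `^ (q - 1) else 0) <=
   (2 `^ (q - 1)) ^+ 3 / (2 `^ (q - 1) - 1) * t `^ (q - 1))%R.
Proof.
move=> q1 al0 t0; have q10 : (0 < q - 1)%R by rewrite subr_gt0.
set b := (2 `^ (q - 1))%R.
have b1 : (1 < b)%R.
  have := @gt0_ltr_powR R _ q10 1%R 2%R; rewrite powR1; apply; rewrite ?nnegrE//.
  by rewrite ltr1n.
have b10 : (0 < b - 1)%R by rewrite subr_gt0.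
have b0 : (0 < b)%R by exact: lt_trans b1.
set A := (al `^ (q - 1))%R; have A0 : (0 <= A)%R by exact: powR_ge0.
have TE k : ((al * 2 ^+ k) `^ (q - 1) = A * b ^+ k)%R.
  by rewrite powRM ?exprn_ge0 ?(ltW al0)// -powR_mulrn// powRAC powR_mulrn ?powR_ge0.
have all (J : nat) : (\sum_(k < J) (al * 2 ^+ k.+1) `^ (q - 1) <= A * (b ^+ J.+1 / (b - 1)))%R.
  elim: J => [|J IH].
    by rewrite big_ord0 mulr_ge0// divr_ge0 ?exprn_ge0// ltW.
  rewrite big_ord_recr/= TE (le_trans (lerD IH (lexx _)))// -mulrDr ler_wpM2l//.
  rewrite le_eqVlt; apply/orP; left; apply/eqP; rewrite [in RHS]exprS.
  by field; rewrite gt_eqF.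
elim: K => [|K IH].
  by rewrite big_ord0 mulr_ge0 ?powR_ge0// divr_ge0 ?exprn_ge0// ltW.
rewrite big_ord_recr/=; case: ifPn => h; last by rewrite addr0.
apply: (@le_trans _ _ (\sum_(k < K.+1) (al * 2 ^+ k.+1) `^ (q - 1))%R).
  rewrite big_ord_recr/= lerD2r; apply: ler_sum => k _.
  by case: ifP => // _; exact: powR_ge0.
apply: le_trans (all K.+1) _.
have : (A * b ^+ K <= b * t `^ (q - 1))%R.
  rewrite -TE /b -powRM//; apply: ge0_ler_powR; rewrite ?nnegrE ?(ltW q10)//.
  - by rewrite mulr_ge0 ?exprn_ge0// ltW.
  - by rewrite mulr_ge0.
  - by move: h; rewrite ltr_pdivrMr// (mulrC t) => /ltW.
move=> H; have := ler_wpM2l (_ : 0 <= b ^+ 2 / (b - 1))%R H.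
rewrite divr_ge0 ?exprn_ge0 ?(ltW b10) ?(ltW b0)// => /(_ isT) {}H.
have e1 : (A * (b ^+ K.+2 / (b - 1)) = b ^+ 2 / (b - 1) * (A * b ^+ K))%R.
  by rewrite !exprS; field; rewrite gt_eqF.
rewrite e1 (le_trans H)// le_eqVlt; apply/orP; left; apply/eqP.
by field; rewrite gt_eqF.
Qed.

Variables (Q Q' : nat -> set T) (v A : nat -> R).
Hypotheses (mQ : forall i, measurable (Q i)) (mQ' : forall i, measurable (Q' i)).
Hypothesis vitali : forall I : seq nat, exists J : seq nat,
  [/\ {subset J <= I},
      forall i, i \in I -> exists2 j, j \in J & Q i `<=` Q' j &
      forall phi : T -> \bar R, measurable_fun setT phi -> (forall x, 0 <= phi x) ->
        \sum_(j <- J) \int[mu]_(x in Q j) phi x <= \int[mu]_x phi x].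

(** The means are prescribed numbers, so that the function is simple and real
    valued; the relation with integrals is a separate hypothesis. *)
Fixpoint max_mean (n : nat) (x : T) : R :=
  if n is m.+1 then Num.max (max_mean m x) (A m * \1_(Q m) x)%R else 0%R.

Lemma max_mean_ge0 n x : (0 <= max_mean n x)%R.
Proof. by elim: n => //= n IH; rewrite le_max IH. Qed.

Lemma max_mean_attained n x : (0 < max_mean n x)%R ->
  exists i, [/\ (i < n)%N, Q i x & max_mean n x = A i].
Proof.
elim: n => [|n IH]/=; first by rewrite ltxx.
case: (leP (max_mean n x) _) => h; last first.
  by move=> /IH[i [ii Qi E]]; exists i; split => //; exact: ltnW.
rewrite indicE; have [Qx|Qx] := boolP (x \in Q n); last by rewrite mulr0 ltxx.
by rewrite mulr1 => _; exists n; split => //; move: Qx; rewrite inE.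
Qed.

Lemma measurable_max_mean n : measurable_fun setT (max_mean n).
Proof.
elim: n => [|n IH]; first exact: measurable_cst.
by apply: measurable_maxr => //; apply: measurable_funM => //.
Qed.

(** A point where the maximum has size [al 2^k] lies in some set with a mean of
    this size, hence in an enlarged set of the Vitali subfamily of that level. *)
Lemma max_mean_layers (n : nat) (al : R) (Psi : R -> T -> \bar R) (phi : nat -> T -> \bar R) :
  (0 < al)%R -> (forall t x, 0 <= Psi t x) ->
  (forall t, (0 <= t)%R -> measurable_fun setT (Psi t)) ->
  (forall s t x, (0 <= s)%R -> (s <= t)%R -> Psi s x <= Psi t x) ->
  (forall k, measurable_fun setT (phi k)) -> (forall k x, 0 <= phi k x) ->
  (forall i k, (i < n)%N -> (al * 2 ^+ k < A i <= al * 2 ^+ k.+1)%R ->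
    \int[mu]_(x in Q' i) Psi (al * 2 ^+ k.+1)%R x <= \int[mu]_(x in Q i) phi k x) ->
  exists K : nat,
  \int[mu]_x (if (al < max_mean n x)%R then Psi (max_mean n x) x else 0) <=
  \sum_(k < K) \int[mu]_x phi k x.
Proof.
move=> al0 P0 mP homP mphi phi0 H.
have [K HK] : exists K : nat, forall i, (i < n)%N -> (A i <= al * 2 ^+ K)%R.
  elim: (n) => [|m [K IH]]; first by exists 0%N.
  pose K' := (Num.truncn `|A m / al|%R).+1.
  have HK' : (A m <= al * 2 ^+ K')%R.
    rewrite mulrC -ler_pdivrMr// (le_trans (ler_norm _))//.
    rewrite (le_trans (ltW (truncnS_gt _)))// -/K' -natrX ler_nat ltnW// ltn_expl//.
  exists (maxn K K') => i; rewrite ltnS leq_eqVlt => /predU1P[->|im].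
    by rewrite (le_trans HK')// ler_pM2l// ler_eXn2l ?ltr1n// leq_maxr.
  by rewrite (le_trans (IH _ im))// ler_pM2l// ler_eXn2l ?ltr1n// leq_maxl.
pose I k := [seq i <- iota 0 n | (al * 2 ^+ k < A i <= al * 2 ^+ k.+1)%R].
have /choice[J HJ] := fun k => vitali (I k).
exists K.
apply: (@le_trans _ _ (\int[mu]_x (\sum_(k < K) \sum_(j <- J k)
   ((Psi (al * 2 ^+ k.+1)%R) \_ (Q' j)) x))).
  apply: le_integral_ge0; first by move=> x; case: ifP.
  have term0 k j x : 0 <= ((Psi (al * 2 ^+ k.+1)%R) \_ (Q' j)) x.
    by rewrite /patch; case: ifP.
  have sum0 k x : 0 <= \sum_(j <- J k) ((Psi (al * 2 ^+ k.+1)%R) \_ (Q' j)) x.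
    by apply: sume_ge0 => j _.
  move=> x; case: ifPn => [Mx|_]; last by apply: sume_ge0 => k _.
  have M0 : (0 < max_mean n x)%R by exact: lt_trans Mx.
  have [i [ii Qx ME]] := max_mean_attained M0.
  have [k kK Hk] : exists2 k, (k < K)%N & (al * 2 ^+ k < A i <= al * 2 ^+ k.+1)%R.
    have := HK i ii; rewrite ME in Mx; elim: (K) => [|K' IH] HK'.
      by move: (lt_le_trans Mx HK'); rewrite expr0 mulr1 ltxx.
    have [/IH[k kK Hk]|h] := leP (A i) (al * 2 ^+ K')%R.
      by exists k => //; exact: ltnW.
    by exists K' => //; rewrite h.
  have [_ /(_ i) cov _] := HJ k.
  have iI : i \in I k by rewrite mem_filter Hk mem_iota.
  have [j jJ QQ'] := cov iI.
  rewrite (bigD1 (Ordinal kK))//=; apply: (@le_trans _ _ (\sum_(j <- J k) ((Psi (al * 2 ^+ k.+1)%R) \_ (Q' j)) x)); last first.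
    by rewrite leeDl// sume_ge0.
  rewrite (perm_big _ (perm_to_rem jJ)) big_cons.
  apply: (@le_trans _ _ (((Psi (al * 2 ^+ k.+1)%R) \_ (Q' j)) x)); last first.
    by rewrite leeDl// sume_ge0.
  rewrite /patch mem_set; last exact: QQ'.
  by apply: homP; [exact: ltW|rewrite ME; case/andP: Hk].
have p0 k : (0 <= al * 2 ^+ k)%R by rewrite mulr_ge0 ?exprn_ge0// ltW.
have mterm (k : nat) j : measurable_fun setT ((Psi (al * 2 ^+ k.+1)%R) \_ (Q' j)).
  by apply/(measurable_restrictT _ (mQ' j)); apply: measurable_funTS; exact: mP.
rewrite ge0_integral_sum//; last 2 first.
- by move=> k; exact: emeasurable_sum.
- by move=> k x _; apply: sume_ge0 => j _; rewrite /patch; case: ifP.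
apply: lee_sum => k _; rewrite ge0_integral_sum//; last first.
  by move=> j x _; rewrite /patch; case: ifP.
have [sub _ disj] := HJ k.
apply: le_trans (disj (phi k) (mphi k) (phi0 k)).
rewrite big_seq [leRHS]big_seq; apply: lee_sum => j /sub.
rewrite mem_filter mem_iota add0n /= => /andP[jk jn].
by rewrite -integral_mkcond; exact: H.
Qed.

(** The bound for a single set carries the power [q > 1] of a mean. By
    [mean_power_truncation] this costs only [h^q f^(1-q)] over the part of the
    set where [f] exceeds half the level, and these integrals can be summed
    first over disjoint sets and then over the levels. With [h = f] this is
    Marcinkiewicz's interpolation argument. *)
Lemma max_mean_bound (n : nat) (al q B : R) (f h : T -> R) (Psi : R -> T -> \bar R) :
  (0 < al)%R -> (1 < q)%R -> (0 <= B)%R ->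
  (forall i, 0 < v i)%R -> (forall i, mu (Q i) = (v i)%:E) ->
  measurable_fun setT f -> measurable_fun setT h ->
  (forall x, 0 <= f x)%R -> (forall x, 0 <= h x)%R ->
  (forall i, \int[mu]_(x in Q i) (f x)%:E = (A i * v i)%:E) ->
  (forall i, \int[mu]_(x in Q i) (h x)%:E < +oo) ->
  (forall t x, 0 <= Psi t x) ->
  (forall t, (0 <= t)%R -> measurable_fun setT (Psi t)) ->
  (forall s t x, (0 <= s)%R -> (s <= t)%R -> Psi s x <= Psi t x) ->
  (forall i k H, (i < n)%N -> (al * 2 ^+ k < A i <= al * 2 ^+ k.+1)%R -> (0 <= H)%R ->
    \int[mu]_(x in Q i) (if al * 2 ^+ k / 2 < f x then h x else 0)%R%:E = (H * v i)%:E ->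
    \int[mu]_(x in Q' i) Psi (al * 2 ^+ k.+1)%R x <= (B * (v i * H `^ q))%:E) ->
  \int[mu]_x (if (al < max_mean n x)%R then Psi (max_mean n x) x else 0) <=
  (B * ((2 `^ (q - 1)) ^+ 3 / (2 `^ (q - 1) - 1)))%:E * \int[mu]_x (h x `^ q)%:E.
Proof.
move=> al0 q1 B0 v0 muQ mf mh f0 h0 HA Hh P0 mP homP H.
pose g k x := (if al * 2 ^+ k / 2 < f x then h x `^ q * f x `^ (1 - q) else 0)%R.
have a0 k : (0 < al * 2 ^+ k)%R by rewrite mulr_gt0// exprn_gt0.
have mt k : measurable_fun setT (fun x => al * 2 ^+ k / 2 < f x)%R.
  by apply: measurable_fun_ltr => //; exact: measurable_cst.
have mfq : measurable_fun setT (fun x => f x `^ (1 - q))%R.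
  exact: measurableT_comp (measurable_powR _) mf.
have mhq : measurable_fun setT (fun x => h x `^ q)%R.
  exact: measurableT_comp (measurable_powR _) mh.
have mg k : measurable_fun setT (g k).
  by apply: measurable_fun_ifT => //; exact: measurable_funM.
have g0 k x : (0 <= g k x)%R by rewrite /g; case: ifP => _ //; rewrite mulr_ge0 ?powR_ge0.
pose phi k x := (B * (al * 2 ^+ k.+1) `^ (q - 1))%:E * (g k x)%:E.
have Bk k : (0 <= B * (al * 2 ^+ k.+1) `^ (q - 1))%R by rewrite mulr_ge0 ?powR_ge0.
have mphi k : measurable_fun setT (phi k).
  by apply: measurable_funeM; exact/measurable_EFinP.
have phi0 k x : 0 <= phi k x by rewrite /phi -EFinM lee_fin mulr_ge0.
have [i k ii Hk|K HK] := max_mean_layers (n := n) al0 P0 mP homP mphi phi0.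
  have mhk : measurable_fun setT (fun x => if al * 2 ^+ k / 2 < f x then h x else 0)%R.
    exact: measurable_fun_ifT.
  have hk0 x : (0 <= if al * 2 ^+ k / 2 < f x then h x else 0)%R by case: ifP.
  have fin : \int[mu]_(x in Q i) (if al * 2 ^+ k / 2 < f x then h x else 0)%R%:E < +oo.
    apply: le_lt_trans (Hh i); apply: ge0_le_integral => //.
    - by move=> x _; rewrite lee_fin.
    - by apply: measurable_funTS; exact/measurable_EFinP.
    - by apply: measurable_funTS; exact/measurable_EFinP.
    - by move=> x _; rewrite lee_fin; case: ifP.
  have int0 : 0 <= \int[mu]_(x in Q i) (if al * 2 ^+ k / 2 < f x then h x else 0)%R%:E.
    by apply: integral_ge0 => x _; rewrite lee_fin.
  pose HH := (fine (\int[mu]_(x in Q i) (if al * 2 ^+ k / 2 < f x then h x else 0)%R%:E) / v i)%R.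
  have HH0 : (0 <= HH)%R by rewrite divr_ge0 ?fine_ge0// ltW.
  have HE : \int[mu]_(x in Q i) (if al * 2 ^+ k / 2 < f x then h x else 0)%R%:E = (HH * v i)%:E.
    by rewrite /HH divfK ?gt_eqF// fineK// ge0_fin_numE.
  apply: (le_trans (H i k HH ii Hk HH0 HE)).
  have tau0 : (0 < al * 2 ^+ k / 2)%R by rewrite divr_gt0.
  have HS : \int[mu]_(x in Q i) (f x)%:E <= (al * 2 ^+ k.+1 * v i)%:E.
    by rewrite HA lee_fin ler_pM2r//; case/andP: Hk.
  have := mean_power_truncation (mQ i) (muQ i) (v0 i) q1 (a0 k.+1) tau0 mf mh f0 h0 HH0 HS HE.
  rewrite /phi ge0_integralZl//; last 3 first.
  - by apply: measurable_funTS; exact/measurable_EFinP.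
  - by move=> x _; rewrite lee_fin.
  - by rewrite lee_fin.
  move=> Hm; rewrite EFinM [X in _ <= X * _]EFinM -muleA; apply: lee_wpmul2l; first by rewrite lee_fin.
  exact: Hm.
apply: (le_trans HK).
rewrite -ge0_integral_sum//.
rewrite -ge0_integralZl//; last 3 first.
- exact/measurable_EFinP.
- by move=> x _; rewrite lee_fin powR_ge0.
- rewrite lee_fin mulr_ge0// divr_ge0 ?exprn_ge0 ?powR_ge0// subr_ge0.
  rewrite -[leLHS](powRr0 2); apply: ler_powR; first by rewrite ler1n.
  by rewrite subr_ge0 ltW.
apply: le_integral_ge0; first by move=> x; exact: sume_ge0.
move=> x; rewrite /phi.
under eq_bigr do rewrite -EFinM.
rewrite sumEFin -EFinM lee_fin.
have [f00|fn0] := eqVneq (f x) 0%R.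
  rewrite big1.
    rewrite mulr_ge0 ?powR_ge0// mulr_ge0// divr_ge0 ?exprn_ge0 ?powR_ge0// subr_ge0.
    rewrite -[leLHS](powRr0 2); apply: ler_powR; first by rewrite ler1n.
    by rewrite subr_ge0 ltW.
  by move=> k _; rewrite /g f00 ltNge divr_ge0 ?(ltW (a0 k))//= mulr0.
have fx0 : (0 < f x)%R by rewrite lt_def fn0 f0.
have := geometric_levels K q1 al0 (f0 x).
move=> /(ler_wpM2l (_ : 0 <= B * (h x `^ q * f x `^ (1 - q)))%R).
rewrite !mulr_ge0 ?powR_ge0// => /(_ isT) Hg.
have -> : (B * ((2 `^ (q - 1)) ^+ 3 / (2 `^ (q - 1) - 1)) * h x `^ q =
  B * (h x `^ q * f x `^ (1 - q)) *
  ((2 `^ (q - 1)) ^+ 3 / (2 `^ (q - 1) - 1) * f x `^ (q - 1)))%R.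
  have e1 : (f x `^ (1 - q) * f x `^ (q - 1) = 1)%R.
    rewrite -gt0_powRD// (_ : 1 - q + (q - 1) = 0)%R ?powRr0//; ring.
  set D := ((2 `^ (q - 1)) ^+ 3 / _)%R.
  transitivity (B * D * h x `^ q * (f x `^ (1 - q) * f x `^ (q - 1)))%R; last by ring.
  by rewrite e1 mulr1.
apply: le_trans Hg; rewrite mulr_sumr; apply: ler_sum => k _.
rewrite /g; case: ifP => _; last by rewrite !mulr0.
by rewrite le_eqVlt; apply/orP; left; apply/eqP; ring.
Qed.

End maximal_layers.

(** * Cubes and their triples *)

(** Values below [tau] contribute at most [tau] to a mean. *)
Lemma mean_truncation d (T : measurableType d) (R : realType)
    (mu : {measure set T -> \bar R}) (D : set T) (v A H tau : R) (f : T -> R) :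
  measurable D -> mu D = v%:E -> (0 < v)%R -> (0 <= tau)%R ->
  measurable_fun setT f -> (forall x, 0 <= f x)%R ->
  \int[mu]_(x in D) (f x)%:E = (A * v)%:E ->
  \int[mu]_(x in D) (if tau < f x then f x else 0)%R%:E = (H * v)%:E ->
  (A - tau <= H)%R.
Proof.
move=> mD muD v0 tau0 mf f0 HA HH.
have mg : measurable_fun setT (fun x => if tau < f x then f x else 0)%R.
  apply: measurable_fun_ifT => //.
  by apply: measurable_fun_ltr => //; exact: measurable_cst.
have g0 x : (0 <= if tau < f x then f x else 0)%R by case: ifP.
have : \int[mu]_(x in D) (f x)%:E <=
    \int[mu]_(x in D) ((if tau < f x then f x else 0)%R%:E + tau%:E).
  apply: ge0_le_integral => //.
  - by move=> x _; rewrite lee_fin.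
  - by apply: measurable_funTS; exact/measurable_EFinP.
  - by apply: measurable_funTS; apply: emeasurable_funD => //; exact/measurable_EFinP.
  - by move=> x _; rewrite -EFinD lee_fin; case: ltP; rewrite ?add0r// lerDl.
rewrite ge0_integralD//; last 2 first.
- by move=> x _; rewrite lee_fin.
- by apply: measurable_funTS; exact/measurable_EFinP.
rewrite HA HH integral_cst// muD -EFinM -EFinD lee_fin -mulrDl ler_pM2r// => h.
by rewrite lerBlDr.
Qed.

Lemma integral_same_measure d (T : measurableType d) (R : realType)
    (mu : {measure set T -> \bar R}) (D Q : set T) (v : R) (f : T -> \bar R) :
  measurable D -> measurable Q -> D `<=` Q -> mu D = v%:E -> mu Q = v%:E ->
  measurable_fun setT f -> (forall x, 0 <= f x) ->
  \int[mu]_(x in Q) f x = \int[mu]_(x in D) f x.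
Proof.
move=> mD mQ DQ muD muQ mf f0.
have mQD : measurable (Q `\` D) by exact: measurableD.
have N : mu (Q `\` D) = 0.
  have Qoo : mu Q < +oo by rewrite muQ ltry.
  have -> : mu (Q `\` D) = mu Q - mu (Q `&` D) by exact: measureD.
  by rewrite setIidr// muQ muD -EFinB subrr.
rewrite -[X in \int[mu]_(x in X) _](setDUK DQ) ge0_integral_setU//.
- rewrite [X in _ + X](_ : _ = 0) ?adde0//.
  by apply: null_set_integral => //; exact: measurable_funTS.
- exact: measurable_funTS.
- by rewrite disj_set2E setDIK.
Qed.

Section cubes.
Context {R : realType} (n : nat).
Local Notation mu := (@lebesgue_n R n).
Implicit Types (b : n.-tuple R) (L : R).

Lemma cube_center b L : (0 < L)%R -> cube b L b.
Proof. by move=> L0 i; rewrite lexx lerDl ltW. Qed.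

Definition triple_corner b L : n.-tuple R := [tuple (tnth b i - L)%R | i < n].
Definition triple b L : set (Rn R n) := cube (triple_corner b L) (3 * L).

Lemma measurable_cube b L : (0 < L)%R -> measurable (cube b L : set (Rn R n)).
Proof. by move=> /ltW /(lebesgue_cube b) []. Qed.

Lemma measurable_triple b L : (0 < L)%R -> measurable (triple b L).
Proof. by move=> L0; apply: measurable_cube; rewrite mulr_gt0. Qed.

Lemma lebesgue_triple b L : (0 < L)%R -> mu (triple b L) = (3 ^+ n * L ^+ n)%:E.
Proof.
move=> L0; have L30 : (0 <= 3 * L)%R by rewrite mulr_ge0 ?ltW.
by have [_ ->] := lebesgue_cube (triple_corner b L) L30; rewrite exprMn.
Qed.

Lemma cube_triple b L : (0 < L)%R -> cube b L `<=` triple b L.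
Proof.
move=> L0 x H i; rewrite tnth_mktuple; have := H i => /andP[h1 h2].
by apply/andP; split; lra.
Qed.

Lemma meet_sub_triple b L b' L' : (L' <= L)%R ->
  cube b L `&` cube b' L' !=set0 -> cube b' L' `<=` triple b L.
Proof.
move=> LL [z [H1 H2]] x H i; rewrite tnth_mktuple.
have := H i; have := H1 i; have := H2 i => /andP[? ?] /andP[? ?] /andP[? ?].
by apply/andP; split; lra.
Qed.

(** A cube of maximal side is selected, the cubes that meet it are contained in
    its triple, and the others are treated recursively. *)
Lemma vitali_cubes (b : nat -> n.-tuple R) (l : nat -> R) :
  (forall i, 0 < l i)%R -> forall I : seq nat, exists J : seq nat,
  [/\ {subset J <= I},
      forall i, i \in I -> exists2 j, j \in J & cube (b i) (l i) `<=` triple (b j) (l j) &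
      forall phi : Rn R n -> \bar R, measurable_fun setT phi -> (forall x, 0 <= phi x) ->
        \sum_(j <- J) \int[mu]_(x in cube (b j) (l j)) phi x <= \int[mu]_x phi x].
Proof.
move=> l0 I.
pose U (J : seq nat) := \bigcup_(j in [set` J]) (cube (b j) (l j) : set (Rn R n)).
have mQ j : measurable (cube (b j) (l j) : set (Rn R n)) by exact: measurable_cube.
have mU J : measurable (U J) by apply: bigcup_measurable => k _.
suff [J [JI cov H]] : exists J : seq nat,
  [/\ {subset J <= I},
      forall i, i \in I -> exists2 j, j \in J & cube (b i) (l i) `<=` triple (b j) (l j) &
      forall phi : Rn R n -> \bar R, measurable_fun setT phi -> (forall x, 0 <= phi x) ->
        \sum_(j <- J) \int[mu]_(x in cube (b j) (l j)) phi x <= \int[mu]_(x in U J) phi x].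
  exists J; split => // phi mphi phi0; apply: le_trans (H _ mphi phi0) _.
  apply: ge0_subset_integral => //.
elim: (size I) {-2}I (leqnn (size I)) => [|m IH] {}I.
  rewrite leqn0 => /nilP ->; exists [::]; split => // phi mphi phi0.
  by rewrite big_nil integral_ge0.
move=> Im; have [->|In0] := eqVneq I [::].
  by exists [::]; split => // phi mphi phi0; rewrite big_nil integral_ge0.
have [i0 i0I i0max] : exists2 i0, i0 \in I & forall i, i \in I -> (l i <= l i0)%R.
  elim: I In0 {Im} => // i I' IH' _.
  have [->|/IH'[j jI jmax]] := eqVneq I' [::].
    by exists i; rewrite ?inE// => k; rewrite inE => /eqP ->.
  have [lij|lij] := leP (l i) (l j).
    exists j; first by rewrite inE jI orbT.
    by move=> k; rewrite inE => /predU1P[->//|/jmax].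
  exists i; first by rewrite inE eqxx.
  move=> k; rewrite inE => /predU1P[->//|/jmax h].
  exact: le_trans h (ltW lij).
pose P i := `[< cube (b i0) (l i0) `&` cube (b i) (l i) = set0 >].
have i0P : ~~ P i0.
  apply/asboolP => /seteqP[/(_ (b i0)) + _]; apply.
  by split; exact: cube_center.
have [J [JI cov H]] : exists J : seq nat,
  [/\ {subset J <= [seq i <- I | P i]},
      forall i, i \in [seq i <- I | P i] -> exists2 j, j \in J & cube (b i) (l i) `<=` triple (b j) (l j) &
      forall phi : Rn R n -> \bar R, measurable_fun setT phi -> (forall x, 0 <= phi x) ->
        \sum_(j <- J) \int[mu]_(x in cube (b j) (l j)) phi x <= \int[mu]_(x in U J) phi x].
  apply: IH; rewrite -ltnS (leq_trans _ Im)// size_filter -(count_predC P I).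
  by rewrite -[ltnLHS]addn0 ltn_add2l -has_count; apply/hasP; exists i0.
exists (i0 :: J); split.
- by move=> j; rewrite inE => /predU1P[->//|/JI]; rewrite mem_filter => /andP[].
- move=> i iI; have [Pi|/asboolPn nPi] := boolP (P i).
    have [|j jJ Hj] := cov i; first by rewrite mem_filter Pi.
    by exists j => //; rewrite inE jJ orbT.
  exists i0; first by rewrite inE eqxx.
  apply: meet_sub_triple; first exact: i0max.
  exact/set0P/eqP.
- move=> phi mphi phi0; rewrite big_cons.
  have -> : U (i0 :: J) = cube (b i0) (l i0) `|` U J.
    rewrite /U; apply/seteqP; split => x.
      move=> [j /=]; rewrite inE => /predU1P[->|jJ] Hj; first by left.
      by right; exists j.
    move=> [Hx|[j jJ Hj]]; first by exists i0 => //=; rewrite inE eqxx.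
    by exists j => //=; rewrite inE jJ orbT.
  rewrite ge0_integral_setU//=.
  + by rewrite leeD2l// H.
  + exact: measurable_funTS.
  + rewrite disj_set2E; apply/eqP; rewrite -subset0 => x [H1 [j /= jJ H2]].
    have := JI _ jJ; rewrite mem_filter => /andP[/asboolP + _].
    by move=> /seteqP[/(_ x) + _]; apply.
Qed.

(** Half-open and closed cubes have the same measure. *)
Lemma integral_cube_dyad b L (f : Rn R n -> \bar R) : (0 < n)%N -> (0 < L)%R ->
  measurable_fun setT f -> (forall x, 0 <= f x) ->
  \int[mu]_(x in cube b L) f x = \int[mu]_(x in dyad (tnth b) L [::]) f x.
Proof.
move=> n0 L0 mf f0; set Q := cube b L; set D := dyad (tnth b) L [::].
have mQ : measurable (Q : set (Rn R n)) by exact: measurable_cube.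
have mD : measurable D by exact: measurable_dyad.
have DQ : D `<=` Q by move=> x H i; have /andP[-> /ltW] := H i.
have muQ : mu Q = (L ^+ n)%:E by have [] := lebesgue_cube b (ltW L0).
have muD : mu D = (L ^+ n)%:E by rewrite (dyad_measure n0)// expr0 divr1.
exact: integral_same_measure mD mQ DQ muD muQ mf f0.
Qed.

End cubes.

Lemma integral_add1 d (T : measurableType d) (R : realType)
    (mu : {measure set T -> \bar R}) (D : set T) (v : R) (g : T -> \bar R) :
  measurable D -> mu D = v%:E -> measurable_fun setT g -> (forall x, 0 <= g x) ->
  \int[mu]_x g x <= 1 -> \int[mu]_(x in D) (1 + g x) <= (v + 1)%:E.
Proof.
move=> mD muD mg g0 Hg; rewrite ge0_integralD//; last exact: measurable_funTS.
rewrite integral_cst// mul1e muD EFinD leeD2l//.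
by apply: le_trans Hg; exact: ge0_subset_integral.
Qed.

(** * Large values of the maximal function *)

(** The constant of the geometric sum over the levels in [max_mean_bound]. *)
Definition gain_const (R : realType) (q : R) : R :=
  ((2 `^ (q - 1)) ^+ 3 / (2 `^ (q - 1) - 1))%R.

Lemma gain_const_ge0 (R : realType) (q : R) : (1 < q)%R -> (0 <= gain_const q)%R.
Proof.
move=> q1; rewrite divr_ge0 ?exprn_ge0 ?powR_ge0// subr_ge0.
rewrite -[leLHS](powRr0 2); apply: ler_powR; first by rewrite ler1n.
by rewrite subr_ge0 ltW.
Qed.

Section cube_families.
Context {R : realType} (n : nat).
Hypothesis n_gt0 : (0 < n)%N.
Local Notation mu := (@lebesgue_n R n).
Implicit Types (y f : Rn R n -> R).

(** Jensen's inequality with a gain on the cubes of measure at most 1; for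
    [q = 1] it would be too weak to be summed over levels. *)
Definition mean_gain (q k : R) y := forall b (L : R) f (F G : R),
  (0 < L)%R -> (L ^+ n <= 1)%R ->
  measurable_fun setT f -> (forall x, 0 <= f x)%R ->
  \int[mu]_(x in cube b L) rpow (f x) (y x) <= 1 ->
  \int[mu]_(x in cube b L) (f x)%:E = (F * L ^+ n)%:E -> (k^-1 <= F)%R ->
  \int[mu]_(x in cube b L) rpow (f x) (q * y x) = (G * L ^+ n)%:E ->
  \int[mu]_(x in cube b L) rpow (k * F) (y x) <= (L ^+ n * G `^ q)%:E.

Lemma local_jensen (r c : R) : (1 < r)%R -> (0 < c <= 1)%R ->
  exists q k : R, [/\ (1 < q)%R, (0 < k <= 1)%R &
  forall y, measurable_fun setT y -> (forall x, 0 <= y x <= r^-1)%R ->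
  local_muckenhoupt c r y -> mean_gain q k y].
Proof.
move=> r1 c01; have [c0 c1] : (0 < c /\ c <= 1)%R by case/andP: c01.
have [q [k [q1 qr k0c HH]]] := dual_gain n_gt0 r1 c01.
have [k0 kc] : (0 < k /\ k <= c)%R by case/andP: k0c.
have k1 : (k <= 1)%R by exact: le_trans c1.
have k01 : (0 < k <= 1)%R by rewrite k0 k1.
have r0 : (0 < r)%R by exact: lt_trans r1.
have q0 : (0 < q)%R by exact: lt_trans q1.
exists q, (k * (k / 2))%R; split; first exact: q1.
  rewrite !mulr_gt0//=; nra.
move=> y my yr.
have mqy : measurable_fun setT (fun x => q * y x)%R by exact: measurable_funM.
have my2 : measurable_fun setT (fun x => 1 - q * y x)%R by exact: measurable_funB.
move=> HA b L f F G L0 L1 mf f0 Hf HF FC HG.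
have [a [ar Ha Hd]] := HA b L L0 L1.
have Hq := HH y my yr HA b L a L0 L1 ar Hd.
have [a0 ar'] : (0 <= a /\ a <= r^-1)%R by case/andP: ar.
set v := (L ^+ n)%R in HF HG Ha Hd Hq *.
have v0 : (0 < v)%R by rewrite exprn_gt0.
have v01 : (0 < v <= 1)%R by rewrite v0.
have mQ : measurable (cube b L : set (Rn R n)) by exact: measurable_cube.
have muQ : mu (cube b L) = v%:E by have [] := lebesgue_cube b (ltW L0).
have z0 x : (0 <= y x)%R by case/andP: (yr x).
have z1 x : (y x <= r^-1)%R by case/andP: (yr x).
have ri1 : (r^-1 <= 1)%R by rewrite invf_le1// ltW.
have y10 x : (0 <= 1 - y x)%R by rewrite subr_ge0 (le_trans (z1 x)).
have qr1 (s : R) : (s <= r^-1)%R -> (q * s <= 1)%R.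
  move=> sr; apply: (@le_trans _ _ (q * r^-1)%R); first by rewrite ler_pM2l.
  by rewrite ler_pdivrMr// mul1r ltW.
have qy1 x : (q * y x <= 1)%R by exact: qr1.
have qy10 x : (0 <= 1 - q * y x)%R by rewrite subr_ge0.
have qa1 : (q * a <= 1)%R by exact: qr1.
have my1 : measurable_fun setT (fun x => 1 - y x)%R by exact: measurable_funB.
have le_kc (e : R) : (0 <= k * v `^ e)%R /\ (k * v `^ e <= c * v `^ e)%R.
  by split; [rewrite mulr_ge0 ?powR_ge0// ltW|rewrite ler_wpM2r ?powR_ge0].
have Ha' : \int[mu]_(x in cube b L) rpow (k * v `^ (- a)) (y x) <= 1.
  apply: le_trans Ha; have [e1 e2] := le_kc (- a)%R.
  exact: (@le_integral_rpow _ _ R mu (cube b L) (cube b L) y _ _ mQ mQ (@subset_refl _ _) my z0 e1 e2).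
have Hd' : \int[mu]_(x in cube b L) rpow (k * v `^ (- (1 - a))) (1 - y x) <= 1.
  apply: le_trans Hd; have [e1 e2] := le_kc (- (1 - a))%R.
  exact: (@le_integral_rpow _ _ R mu (cube b L) (cube b L) (fun x => 1 - y x)%R _ _ mQ mQ (@subset_refl _ _) my1 y10 e1 e2).
have Hq' : \int[mu]_(x in cube b L) rpow (k * v `^ (- (1 - q * a))) (1 - q * y x) <= 1.
  rewrite integral_cube_dyad; [exact: Hq|exact: n_gt0|exact: L0| |].
    by apply: measurable_rpowc; [exact: my2|exact: qy10|case: (le_kc (- (1 - q * a))%R)].
  by move=> x; exact: rpow_ge0.
have FC' : (2 / k <= F)%R.
  apply: le_trans FC; rewrite (_ : (k * (k / 2))^-1 = 2 / k * k^-1)%R; last first.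
    by field; exact: lt0r_neq0.
  by rewrite ler_peMr ?divr_ge0 ?(ltW k0)// invf_ge1.
have := jensen_gain mQ muQ v01 my z0 (ltW q1) qy1 mf f0 a0 qa1 k01 Ha' Hd' Hq' Hf HF FC' HG.
by rewrite (_ : k * (k / 2) * F = k * (k / 2 * F))%R; last exact/esym/mulrA.
Qed.

Variables (b : nat -> n.-tuple R) (l : nat -> R).
Hypothesis l0 : forall i, (0 < l i)%R.
Local Notation Q := (fun i => cube (b i) (l i) : set (Rn R n)).
Local Notation v := (fun i => (l i ^+ n)%R).

Let mQ i : measurable (Q i). Proof. exact: measurable_cube. Qed.
Let mQ' i : measurable (triple (b i) (l i)). Proof. exact: measurable_triple. Qed.
Let v0 i : (0 < v i)%R. Proof. exact: exprn_gt0. Qed.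
Let muQ i : mu (Q i) = (v i)%:E.
Proof. by have [] := lebesgue_cube (b i) (ltW (l0 i)). Qed.

(** The maximal inequality for a constant exponent. The family is finite, so the
    lowest level can be chosen below all nonzero means. *)
Lemma max_mean_strong (r : R) (A : nat -> R) f N : (1 < r)%R ->
  measurable_fun setT f -> (forall x, 0 <= f x)%R ->
  (forall i, \int[mu]_(x in Q i) (f x)%:E = (A i * v i)%:E) ->
  \int[mu]_x (max_mean Q A N x `^ r)%:E <=
  (3 ^+ n * 4 `^ r * gain_const r)%:E *
    \int[mu]_x (f x `^ r)%:E.
Proof.
move=> r1 mf f0 HA; have r0 : (0 < r)%R by exact: lt_trans r1.
have [al al0 Hal] : exists2 al : R, (0 < al)%R &
    forall i, (i < N)%N -> (0 < A i -> al < A i)%R.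
  elim: N => [|N [al al0 IH]]; first by exists 1%R.
  have [A0|A0] := ltP 0%R (A N).
    exists (Num.min al (A N / 2))%R; first by rewrite lt_min al0 divr_gt0.
    move=> i; rewrite ltnS leq_eqVlt => /predU1P[->|iN] Ai0; rewrite gt_min.
      by rewrite [X in _ || X](_ : _ = true) ?orbT//; apply/idP; rewrite ltr_pdivrMr// ltr_pMr// ltr1n.
    by rewrite IH.
  exists al => // i; rewrite ltnS leq_eqVlt => /predU1P[->|iN]; last exact: IH.
  by rewrite ltNge A0.
have B0 : (0 <= 3 ^+ n * 4 `^ r :> R)%R by rewrite mulr_ge0 ?powR_ge0 ?exprn_ge0.
have Afin i : \int[mu]_(x in Q i) (f x)%:E < +oo by rewrite HA ltry.
have ME : \int[mu]_x (max_mean Q A N x `^ r)%:E =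
    \int[mu]_x (if (al < max_mean Q A N x)%R then (max_mean Q A N x `^ r)%:E else 0).
  apply: eq_integral => x _; case: ltP => // h.
  have [M0|M0] := ltP 0%R (max_mean Q A N x).
    have [i [iN _ E]] := max_mean_attained M0.
    by move: h; rewrite E leNgt Hal// -E.
  by rewrite (_ : max_mean Q A N x = 0%R) ?powR0 ?gt_eqF//; apply/eqP; rewrite eq_le M0 max_mean_ge0.
rewrite ME.
have := @max_mean_bound _ _ R mu Q (fun i => triple (b i) (l i)) v A mQ mQ'
  (vitali_cubes b l0) N al r _ f f (fun t x => (t `^ r)%:E) al0 r1 B0 v0 muQ mf mf f0 f0 HA Afin.
apply.
- by move=> t x; rewrite lee_fin powR_ge0.
- by move=> t t0; exact: measurable_cst.
- move=> s t x s0 st; rewrite lee_fin; apply: ge0_ler_powR; rewrite ?nnegrE ?(ltW r0)//.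
  exact: le_trans s0 st.
move=> i k H iN /andP[Ak _] H0 HH.
have tau0 : (0 <= al * 2 ^+ k / 2)%R by rewrite divr_ge0// mulr_ge0 ?exprn_ge0// ltW.
have := mean_truncation (mQ i) (muQ i) (v0 i) tau0 mf f0 (HA i) HH => hA.
rewrite integral_cst; last exact: mQ'.
rewrite [X in _ * X](_ : _ = (3 ^+ n * v i)%:E); last exact: lebesgue_triple.
rewrite -EFinM lee_fin.
apply: (@le_trans _ _ ((4 * H) `^ r * (3 ^+ n * v i))%R).
  apply: ler_wpM2r; first by rewrite mulr_ge0 ?exprn_ge0// ltW.
  apply: ge0_ler_powR; rewrite ?nnegrE ?(ltW r0) ?mulr_ge0 ?exprn_ge0 ?(ltW al0)//.
  rewrite exprS; lra.
rewrite powRM// le_eqVlt; apply/orP; left; apply/eqP; ring.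
Qed.

(** A mean above [1 + 3^n] forces the triple of the cube to have measure at most
    1, because the integral of [f] over a cube is at most [|Q| + 1]. The
    inequality [mean_gain] is therefore available on the triple; it is applied
    to [f] restricted to the cube and to the values above half the level, which
    keep at least half of the mean. *)
Lemma local_maximal_bound (q k : R) y f (A : nat -> R) (al : R) N :
  (1 < q)%R -> (0 < k <= 1)%R ->
  mean_gain q k y ->
  measurable_fun setT y -> (forall x, 0 <= y x <= 1)%R ->
  measurable_fun setT f -> (forall x, 0 <= f x)%R ->
  (forall x, rpow (f x) (y x) < +oo) ->
  \int[mu]_x rpow (f x) (y x) <= 1 ->
  (forall i, \int[mu]_(x in Q i) (f x)%:E = (A i * v i)%:E) ->
  (1 + 3 ^+ n <= al)%R -> (2 * 3 ^+ n / k <= al)%R ->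
  \int[mu]_x (if (al < max_mean Q A N x)%R then
     rpow (k / (4 * 3 ^+ n) * max_mean Q A N x) (y x) else 0) <=
  (3 ^+ n * gain_const q)%:E.
Proof.
move=> q1 /andP[k0 k1] Hj my y01 mf f0 foo Hf HA al1 al2.
have y0 x : (0 <= y x)%R by case/andP: (y01 x).
have q0 : (0 < q)%R by exact: lt_trans q1.
have t0 : (0 < 3 ^+ n :> R)%R by rewrite exprn_gt0.
have al0 : (0 < al)%R by rewrite (lt_le_trans _ al1)// addr_gt0.
have qy0 x : (0 <= q * y x)%R by rewrite mulr_ge0// ltW.
have mqy : measurable_fun setT (fun x => q * y x)%R by exact: measurable_funM.
pose h x := fine (rpow (f x) (q * y x)).
have hE x : rpow (f x) (q * y x) = (h x)%:E by have [] := rpowM_exp (y0 x) q0 (foo x).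
have h0 x : (0 <= h x)%R by rewrite fine_ge0 ?rpow_ge0.
have mh : measurable_fun setT h.
  apply/measurable_EFinP; rewrite (_ : EFin \o h = (fun x => rpow (f x) (q * y x))).
    exact: measurable_rpow.
  by apply/funext => x /=; rewrite hE.
have hq x : (h x `^ q)%:E = rpow (f x) (y x).
  have [_ ->] := rpowM_exp (y0 x) q0 (foo x).
  by rewrite fineK// ge0_fin_numE ?rpow_ge0.
have Hhq : \int[mu]_x (h x `^ q)%:E <= 1.
  by apply: le_trans Hf; rewrite le_eqVlt; apply/orP; left; apply/eqP; apply: eq_integral => x _.
have mfq : measurable_fun setT (fun x => rpow (f x) (y x)) by exact: measurable_rpow.
have intQ (i : nat) : \int[mu]_(x in Q i) (1 + rpow (f x) (y x)) <= (v i + 1)%:E.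
  exact: (integral_add1 (mQ i) (muQ i) mfq (fun x => rpow_ge0 _ _) Hf).
have m1 i : measurable_fun (Q i) (fun x => 1 + rpow (f x) (y x)).
  by apply: measurable_funTS; exact: emeasurable_funD.
have hfin (i : nat) : \int[mu]_(x in Q i) (h x)%:E < +oo.
  apply: (@le_lt_trans _ _ (v i + 1)%:E); last exact: ltry.
  apply: le_trans (intQ i); apply: ge0_le_integral.
  - exact: mQ.
  - by move=> x _; rewrite lee_fin.
  - by apply: measurable_funTS; exact/measurable_EFinP.
  - exact: m1.
  - move=> x _; rewrite -hq -EFinD lee_fin.
    have [h1|h1] := leP (h x) 1%R; first by rewrite (le_trans h1)// lerDl powR_ge0.
    rewrite -[leLHS]add0r lerD// -[leLHS]powRr1//; apply: ler_powR; exact: ltW.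
have v3 (i : nat) : (al < A i)%R -> (3 ^+ n * v i <= 1)%R.
  move=> Ai; have : (A i * v i <= v i + 1)%R.
    rewrite -lee_fin -HA; apply: le_trans (intQ i); apply: ge0_le_integral.
    - exact: mQ.
    - by move=> x _; rewrite lee_fin.
    - by apply: measurable_funTS; exact/measurable_EFinP.
    - exact: m1.
    - move=> x _; have [h1|h1] := leP (f x) 1%R.
        by apply: (@le_trans _ _ 1); rewrite ?lee_fin// leeDl// rpow_ge0.
      apply: (@le_trans _ _ (rpow (f x) (y x))); last by rewrite leeDr.
      exact: rpow_ge1.
  have := v0 i => vi0; have : ((1 + 3 ^+ n) * v i <= A i * v i)%R.
    by rewrite ler_pM2r// (le_trans al1)// ltW.
  by rewrite mulrDl mul1r => e1 e2; have := le_trans e1 e2; rewrite lerD2l.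
have C0 := gain_const_ge0 q1.
set C := gain_const q in C0 *.
apply: (@le_trans _ _ ((3 ^+ n * C)%:E * \int[mu]_x (h x `^ q)%:E)); last first.
  rewrite -[leRHS]mule1; apply: lee_wpmul2l; last exact: Hhq.
  by rewrite lee_fin mulr_ge0// ltW.
have kap0 : (0 <= k / (4 * 3 ^+ n))%R by rewrite divr_ge0 ?mulr_ge0 ?(ltW k0) ?(ltW t0).
have := @max_mean_bound _ _ R mu Q (fun i => triple (b i) (l i)) v A mQ mQ'
  (vitali_cubes b l0) N al q _ f h (fun t x => rpow (k / (4 * 3 ^+ n) * t)%R (y x)) al0 q1 (ltW t0) v0 muQ mf mh f0 h0 HA hfin.
apply.
- by move=> t x; exact: rpow_ge0.
- move=> t t00; apply: measurable_rpowc => //; exact: mulr_ge0.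
- by move=> s t x s0 st; apply: le_rpow => //; [exact: mulr_ge0|exact: ler_wpM2l].
move=> i j H iN /andP[Aj _] H0 HH.
set tau := (al * 2 ^+ j / 2)%R in HH *.
have tau0 : (0 <= tau)%R by rewrite divr_ge0// mulr_ge0 ?exprn_ge0// ltW.
have ajal : (al <= al * 2 ^+ j)%R by rewrite ler_peMr ?(ltW al0)// exprn_ege1// ler1n.
have v31 : (3 ^+ n * v i <= 1)%R by apply: v3; exact: le_lt_trans Aj.
pose D := triple (b i) (l i).
have QD : Q i `<=` D by exact: cube_triple.
have mtau : measurable_fun setT (fun x => tau < f x)%R.
  by apply: measurable_fun_ltr => //; exact: measurable_cst.
pose ft x := (if tau < f x then f x else 0)%R.
have mft : measurable_fun setT ft by exact: measurable_fun_ifT.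
have ft0 x : (0 <= ft x)%R by rewrite /ft; case: ifP.
pose f1 := (ft \_ (Q i))%R.
have mf1 : measurable_fun setT f1.
  by apply/(measurable_restrictT _ (mQ i)); exact: measurable_funTS.
have f10 x : (0 <= f1 x)%R by rewrite /f1 /patch; case: ifP.
have f1f x : (f1 x <= f x)%R.
  by rewrite /f1 /ft /patch; case: ifP => // _; case: ifP.
have onQ (g : Rn R n -> \bar R) : (forall x, 0 <= g x) -> measurable_fun setT g ->
    \int[mu]_(x in D) (g \_ (Q i)) x = \int[mu]_(x in Q i) g x.
  move=> g0 mg; rewrite -integral_mkcondr; congr (\int[mu]_(x in _) _).
  exact: setIidr.
have ftfin : \int[mu]_(x in Q i) (ft x)%:E < +oo.
  apply: (@le_lt_trans _ _ (\int[mu]_(x in Q i) (f x)%:E)); last by rewrite HA ltry.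
  apply: ge0_le_integral; first exact: mQ.
  - by move=> x _; rewrite lee_fin.
  - by apply: measurable_funTS; exact/measurable_EFinP.
  - by apply: measurable_funTS; exact/measurable_EFinP.
  - by move=> x _; rewrite lee_fin /ft; case: ifP.
have ftint0 : 0 <= \int[mu]_(x in Q i) (ft x)%:E.
  by apply: integral_ge0 => x _; rewrite lee_fin.
have vi0 := v0 i.
pose H' := (fine (\int[mu]_(x in Q i) (ft x)%:E) / v i)%R.
have H'E : \int[mu]_(x in Q i) (ft x)%:E = (H' * v i)%:E.
  by rewrite /H' divfK ?gt_eqF// fineK// ge0_fin_numE.
have H'A : (tau <= H')%R.
  have := mean_truncation (mQ i) (muQ i) (v0 i) tau0 mf f0 (HA i) H'E.
  by move: Aj; rewrite /tau; clear; move=> *; lra.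
have L30 : (0 < 3 * l i)%R by rewrite mulr_gt0.
have L31 : ((3 * l i) ^+ n <= 1)%R by rewrite exprMn.
have fy1 : \int[mu]_(x in D) rpow (f1 x) (y x) <= 1.
  apply: (@le_trans _ _ (\int[mu]_(x in D) rpow (f x) (y x))).
    apply: ge0_le_integral.
    - exact: mQ'.
    - by move=> x _; exact: rpow_ge0.
    - by apply: measurable_funTS; exact: measurable_rpow.
    - exact: measurable_funTS.
    - by move=> x _; apply: le_rpow.
  apply: le_trans Hf; apply: ge0_subset_integral; [exact: mQ'|exact: measurableT|exact: mfq| |exact: subsetT].
  by move=> x _; exact: rpow_ge0.
have F1 : \int[mu]_(x in D) (f1 x)%:E = (H' / 3 ^+ n * (3 * l i) ^+ n)%:E.
  transitivity (\int[mu]_(x in D) ((EFin \o ft) \_ (Q i)) x).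
    by apply: eq_integral => x _; rewrite /f1 /patch; case: ifP.
  rewrite onQ.
  - rewrite H'E exprMn; congr EFin; field; exact: lt0r_neq0.
  - by move=> x; rewrite lee_fin.
  - exact/measurable_EFinP.
have FC : (k^-1 <= H' / 3 ^+ n)%R.
  rewrite ler_pdivlMr//; apply: le_trans H'A; rewrite /tau ler_pdivlMr//.
  apply: le_trans ajal; apply: le_trans al2.
  by rewrite le_eqVlt; apply/orP; left; apply/eqP; ring.
have G1 : \int[mu]_(x in D) rpow (f1 x) (q * y x) = (H / 3 ^+ n * (3 * l i) ^+ n)%:E.
  transitivity (\int[mu]_(x in D) ((fun x => (if tau < f x then h x else 0)%R%:E) \_ (Q i)) x).
    apply: eq_integral => x _; rewrite /f1 /ft /patch; case: ifP => // _; last exact: rpow0l.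
    case: ifP => _; first exact: hE.
    exact: rpow0l.
  rewrite onQ.
  - rewrite HH exprMn; congr EFin; field; exact: lt0r_neq0.
  - by move=> x; rewrite lee_fin; case: ifP.
  - by apply/measurable_EFinP; exact: measurable_fun_ifT.
have := Hj (triple_corner (b i) (l i)) (3 * l i)%R f1 (H' / 3 ^+ n)%R (H / 3 ^+ n)%R
   L30 L31 mf1 f10 fy1 F1 FC G1.
rewrite -/(triple (b i) (l i)) -/D => HJ.
apply: (@le_trans _ _ (\int[mu]_(x in D) rpow (k * (H' / 3 ^+ n)) (y x))).
  have e0 : (0 <= k / (4 * 3 ^+ n) * (al * 2 ^+ j.+1))%R.
    by rewrite mulr_ge0// mulr_ge0 ?exprn_ge0// ltW.
  have e1 : (k / (4 * 3 ^+ n) * (al * 2 ^+ j.+1) <= k * (H' / 3 ^+ n))%R.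
    have -> : (k / (4 * 3 ^+ n) * (al * 2 ^+ j.+1) = k * (tau / 3 ^+ n))%R.
      by rewrite /tau exprS; field; exact: lt0r_neq0.
    by rewrite ler_pM2l// ler_pM2r// invr_gt0.
  exact: (@le_integral_rpow _ _ R mu D D y _ _ (mQ' i) (mQ' i) (@subset_refl _ _) my y0 e0 e1).
apply: (le_trans HJ); rewrite lee_fin exprMn mulrA.
apply: ler_wpM2l; first by rewrite mulr_ge0 ?ltW.
apply: ge0_ler_powR; rewrite ?nnegrE ?(ltW q0) ?divr_ge0 ?(ltW t0)//.
by rewrite ler_pdivrMr// ler_peMr// exprn_ege1// ler1n.
Qed.

End cube_families.

(** * Bounded values of the maximal function *)

Section means.
Context d (T : measurableType d) (R : realType).
Variable mu : {measure set T -> \bar R}.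

(** Convexity: integrate the tangent inequality at [S]. *)
Lemma mean_powR (D : set T) (v S be : R) (f : T -> R) :
  measurable D -> mu D = v%:E -> (0 < v)%R -> (1 <= be)%R ->
  measurable_fun setT f -> (forall x, 0 <= f x)%R -> (0 <= S)%R ->
  \int[mu]_(x in D) (f x)%:E = (S * v)%:E ->
  (S `^ be * v)%:E <= \int[mu]_(x in D) (f x `^ be)%:E.
Proof.
move=> mD muD v0 be1 mf f0 S0 HS.
have be0 : (0 < be)%R by exact: lt_le_trans be1.
have mfb : measurable_fun setT (fun x => f x `^ be)%R.
  exact: measurableT_comp (measurable_powR _) mf.
have [Soo|Sfin] := eqVneq (\int[mu]_(x in D) (f x `^ be)%:E) +oo.
  by rewrite Soo leey.
have I0 : 0 <= \int[mu]_(x in D) (f x `^ be)%:E.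
  by apply: integral_ge0 => x _; rewrite lee_fin powR_ge0.
set I := \int[mu]_(x in D) (f x `^ be)%:E in I0 Sfin *.
have IE : I = (fine I)%:E by rewrite fineK// ge0_fin_numE// lt_neqAle Sfin leey.
have ib0 : (0 <= be^-1)%R by rewrite invr_ge0 ltW.
have ib1 : (be^-1 <= 1)%R by rewrite invf_le1.
have : \int[mu]_(x in D) ((S `^ (be - 1))%:E * (f x)%:E) <=
    \int[mu]_(x in D) ((be^-1)%:E * (f x `^ be)%:E + ((1 - be^-1) * S `^ be)%:E).
  apply: ge0_le_integral => //.
  - by move=> x _; rewrite -EFinM lee_fin mulr_ge0 ?powR_ge0.
  - by apply: measurable_funTS; apply: measurable_funeM; exact/measurable_EFinP.
  - apply: measurable_funTS; apply: emeasurable_funD => //.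
    by apply: measurable_funeM; exact/measurable_EFinP.
  - move=> x _; rewrite -!EFinM -EFinD lee_fin.
    have th01 : (0 <= be^-1 <= 1)%R by rewrite ib0.
    have := powR_young th01 (powR_ge0 (f x) be) (powR_ge0 S be).
    rewrite -!powRrM divff ?gt_eqF// powRr1// (_ : be * (1 - be^-1) = be - 1)%R.
      by rewrite mulrC.
    by field; rewrite gt_eqF.
rewrite ge0_integralZl//; last 3 first.
- by apply: measurable_funTS; exact/measurable_EFinP.
- by move=> x _; rewrite lee_fin.
- by rewrite lee_fin powR_ge0.
rewrite HS ge0_integralD//; last 3 first.
- by move=> x _; rewrite -EFinM lee_fin mulr_ge0 ?powR_ge0.
- by apply: measurable_funTS; apply: measurable_funeM; exact/measurable_EFinP.
- by move=> x _; rewrite lee_fin mulr_ge0 ?powR_ge0// subr_ge0.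
rewrite ge0_integralZl//; last 2 first.
- by apply: measurable_funTS; exact/measurable_EFinP.
- by move=> x _; rewrite lee_fin powR_ge0.
rewrite -/I IE integral_cst// muD -!EFinM -EFinD !lee_fin mulrA.
have -> : (S `^ (be - 1) * S = S `^ be)%R.
  have [->|Sn0] := eqVneq S 0%R; first by rewrite mulr0 powR0// gt_eqF.
  have Sp : (0 < S)%R by rewrite lt_def Sn0.
  by rewrite -{2}(powRr1 S0) -gt0_powRD// subrK.
move=> h; rewrite -(@ler_pM2l _ be^-1) ?invr_gt0//; move: h.
by lra.
Qed.

Lemma le_integral_EFin (D : set T) (f g : T -> R) : measurable D ->
  measurable_fun setT f -> measurable_fun setT g ->
  (forall x, 0 <= f x)%R -> (forall x, f x <= g x)%R ->
  \int[mu]_(x in D) (f x)%:E <= \int[mu]_(x in D) (g x)%:E.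
Proof.
move=> mD mf mg f0 fg; apply: ge0_le_integral => //.
- by move=> x _; rewrite lee_fin.
- by apply: measurable_funTS; exact/measurable_EFinP.
- by apply: measurable_funTS; exact/measurable_EFinP.
- by move=> x _; rewrite lee_fin.
Qed.

Lemma integral_sum_EFin (D : set T) (f g h : T -> R) : measurable D ->
  measurable_fun setT f -> measurable_fun setT g ->
  (forall x, 0 <= f x)%R -> (forall x, 0 <= g x)%R -> (forall x, h x = f x + g x)%R ->
  \int[mu]_(x in D) (h x)%:E =
  \int[mu]_(x in D) (f x)%:E + \int[mu]_(x in D) (g x)%:E.
Proof.
move=> mD mf mg f0 g0 hE; rewrite -ge0_integralD//.
- by apply: eq_integral => x _; rewrite hE EFinD.
- by move=> x _; rewrite lee_fin.
- by apply: measurable_funTS; exact/measurable_EFinP.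
- by move=> x _; rewrite lee_fin.
- by apply: measurable_funTS; exact/measurable_EFinP.
Qed.

Lemma integral_le1_fin (D : set T) (v : R) (f : T -> R) : measurable D ->
  mu D = v%:E -> measurable_fun setT f -> (forall x, 0 <= f x)%R ->
  (forall x, f x <= 1)%R -> \int[mu]_(x in D) (f x)%:E < +oo.
Proof.
move=> mD muD mf f0 f1.
apply: (@le_lt_trans _ _ (\int[mu]_(x in D) ((fun=> 1%R : R) x)%:E)).
  by apply: le_integral_EFin => //; exact: measurable_cst.
by rewrite integral_cst// muD mul1e ltry.
Qed.

Lemma integralZ_EFin (D : set T) (c S : R) (f : T -> R) : measurable D ->
  measurable_fun setT f -> (forall x, 0 <= f x)%R -> (0 <= c)%R ->
  \int[mu]_(x in D) (f x)%:E = S%:E ->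
  \int[mu]_(x in D) (c * f x)%R%:E = (c * S)%:E.
Proof.
move=> mD mf f0 c0 HS; under eq_integral do rewrite EFinM.
rewrite ge0_integralZl//; first by rewrite HS EFinM.
- by apply: measurable_funTS; exact/measurable_EFinP.
- by move=> x _; rewrite lee_fin.
Qed.

Lemma integralDT (f g : T -> \bar R) :
  measurable_fun setT f -> measurable_fun setT g ->
  (forall x, 0 <= f x) -> (forall x, 0 <= g x) ->
  \int[mu]_x (f x + g x) = \int[mu]_x f x + \int[mu]_x g x.
Proof. by move=> mf mg f0 g0; rewrite ge0_integralD. Qed.

Lemma integral_cst_le (D : set T) (f : T -> \bar R) (v c B : R) :
  measurable D -> mu D = v%:E -> (0 <= c)%R ->
  measurable_fun setT f -> (forall x, 0 <= f x) -> (forall x, c%:E <= f x) ->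
  \int[mu]_x f x <= B%:E -> (c * v <= B)%R.
Proof.
move=> mD muD c0 mf f0 cf H; rewrite -lee_fin; apply: le_trans H.
rewrite EFinM -muD -integral_cst//; apply: (@le_trans _ _ (\int[mu]_(x in D) f x)).
  by apply: ge0_le_integral => //; exact: measurable_funTS.
exact: ge0_subset_integral.
Qed.

Lemma measurable_rpow_dist (y : T -> R) (yi ga : R) : measurable_fun setT y ->
  (0 <= ga)%R -> measurable_fun setT (fun x => rpow ga `|y x - yi|%R).
Proof.
move=> my ga0; apply: measurable_rpowc => //.
by apply: measurableT_comp => //; exact: measurable_funB.
Qed.

Lemma exists_means (Q : nat -> set T) (v : nat -> R) (f : T -> R) :
  (forall i, 0 < v i)%R -> (forall x, 0 <= f x)%R ->
  (forall i, \int[mu]_(x in Q i) (f x)%:E < +oo) ->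
  exists A : nat -> R, (forall i, 0 <= A i)%R /\
    forall i, \int[mu]_(x in Q i) (f x)%:E = (A i * v i)%:E.
Proof.
move=> v0 f0 foo; exists (fun i => fine (\int[mu]_(x in Q i) (f x)%:E) / v i)%R.
have I0 i : 0 <= \int[mu]_(x in Q i) (f x)%:E.
  by apply: integral_ge0 => x _; rewrite lee_fin.
split=> i; first by rewrite divr_ge0 ?fine_ge0// ltW.
by rewrite divfK ?gt_eqF// fineK// ge0_fin_numE.
Qed.

Lemma le_max_mean (Q : nat -> set T) (A : nat -> R) N i x : (i < N)%N -> Q i x ->
  (A i <= max_mean Q A N x)%R.
Proof.
elim: N => // N IH; rewrite ltnS leq_eqVlt => /predU1P[->|iN] Qx /=.
  by rewrite le_max indicE mem_set// mulr1 lexx orbT.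
by rewrite le_max IH.
Qed.

Lemma max_mean_le (Q : nat -> set T) (A : nat -> R) N x t : (0 <= t)%R ->
  (forall i, (i < N)%N -> Q i x -> (A i <= t)%R) -> (max_mean Q A N x <= t)%R.
Proof.
move=> t0 H; have [M0|M0] := ltP 0%R (max_mean Q A N x); last exact: le_trans t0.
by have [i [iN Qx ->]] := max_mean_attained M0; exact: H.
Qed.

End means.

Lemma split_level (R : realType) (ga al M M1 M2 : R) :
  (0 < ga)%R -> (1 <= al)%R -> (0 <= M1)%R -> (0 <= M2)%R -> (M <= al)%R ->
  (M <= M1 + M2)%R ->
  (ga ^+ 2 / (2 * al) * M <= Num.max (ga * (ga * Num.min 1 (M1 / al)))
    (ga * (ga * Num.min 1 (M2 / al))))%R.
Proof.
move=> ga0 al1 M10 M20 Mal M12; have al0 : (0 < al)%R by exact: lt_le_trans al1.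
have -> : (ga ^+ 2 / (2 * al) * M = ga * (ga * (M / al / 2)))%R.
  by field; rewrite gt_eqF.
have u1 : (M / al / 2 <= 1)%R by rewrite ler_pdivrMr// mul1r ler_pdivrMr//; lra.
have u2 : (M / al / 2 <= Num.max (M1 / al) (M2 / al))%R.
  rewrite ler_pdivrMr//; apply: (@le_trans _ _ ((M1 + M2) / al)%R).
    by rewrite ler_pM2r ?invr_gt0.
  rewrite mulrDl; set a := (M1 / al)%R; set b := (M2 / al)%R.
  by case: (leP a b) => ?; lra.
have u : (M / al / 2 <= Num.max (Num.min 1 (M1 / al)) (Num.min 1 (M2 / al)))%R.
  by rewrite -min_maxr le_min u1.
rewrite le_max; move: u; rewrite le_max => /orP[] u; apply/orP; [left|right];
  by rewrite !ler_pM2l.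
Qed.

Section far.
Context {R : realType} (n : nat).
Hypothesis n_gt0 : (0 < n)%N.
Local Notation mu := (@lebesgue_n R n).
Variables (b : nat -> n.-tuple R) (l : nat -> R).
Hypothesis l0 : forall i, (0 < l i)%R.
Local Notation Q := (fun i => cube (b i) (l i) : set (Rn R n)).
Local Notation v := (fun i => (l i ^+ n)%R).
Implicit Types (y f : Rn R n -> R).
Variable r : R.
Hypothesis r1 : (1 < r)%R.
Local Notation K := (3 ^+ n * 4 `^ r * gain_const r)%R.

Let mQ i : measurable (Q i). Proof. exact: measurable_cube. Qed.
Let v0 i : (0 < v i)%R. Proof. exact: exprn_gt0. Qed.
Let muQ i : mu (Q i) = (v i)%:E.
Proof. by have [] := lebesgue_cube (b i) (ltW (l0 i)). Qed.
Let r0 : (0 < r)%R. Proof. exact: lt_trans r1. Qed.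

Lemma strong_const_ge0 : (0 <= K)%R.
Proof.
by rewrite mulr_ge0 ?gain_const_ge0// mulr_ge0 ?powR_ge0// exprn_ge0.
Qed.

(** Otherwise [|y - yi|] is bounded from below, the integrand is bounded from
    below by a positive constant, and cubes have arbitrarily large measure. *)
Lemma nekvinda_limit_le y (yi ga : R) : measurable_fun setT y ->
  (forall x, 0 <= y x <= r^-1)%R -> (0 < ga <= 1)%R -> (0 <= yi)%R ->
  \int[mu]_x rpow ga `|y x - yi|%R <= 1 -> (yi <= r^-1)%R.
Proof.
move=> my yr /andP[ga0 ga1] yi0 H; rewrite leNgt; apply/negP => ryi.
pose e := (yi - r^-1)%R; have e0 : (0 < e)%R by rewrite subr_gt0.
pose ep := (ga `^ e^-1)%R; have ep0 : (0 < ep)%R by rewrite powR_gt0.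
pose L := (1 + 2 / ep)%R.
have L1 : (1 <= L)%R by rewrite lerDl divr_ge0// ltW.
have L0 : (0 < L)%R by exact: lt_le_trans L1.
pose b0 : n.-tuple R := [tuple 0%R | i < n].
have [mC muC] := lebesgue_cube b0 (ltW L0).
have md := @measurable_rpow_dist _ _ R y yi ga my (ltW ga0).
have epP x : ep%:E <= rpow ga `|y x - yi|%R.
  rewrite /ep -rpowE//; apply: le_rpow_exp_le1; [by rewrite ltW|exact: ltW|].
  rewrite distrC; apply: le_trans (ler_norm _); rewrite /e lerD2l lerN2.
  by case/andP: (yr x).
have := integral_cst_le mC muC (ltW ep0) md (fun x => rpow_ge0 _ _) epP H.
apply/negP; rewrite -ltNge.
apply: (@lt_le_trans _ _ (ep * L)%R).
  rewrite /L mulrDr mulr1 mulrCA divff ?gt_eqF//; lra.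
rewrite ler_pM2l// -[leLHS]expr1; exact: ler_weXn2l.
Qed.

(** For values at most 1 the variable exponent is exchanged with the constant
    [1/yi], which is at least [r]: Jensen's inequality for the power [1/(yi r)]
    reduces the maximal inequality for [1/yi] to the one for [r]. This keeps the
    constant independent of [yi]. *)
Lemma far_small_values y f (A : nat -> R) (yi ga : R) N :
  measurable_fun setT y -> (forall x, 0 <= y x)%R -> (0 <= yi <= r^-1)%R ->
  (0 < ga <= 1)%R -> \int[mu]_x rpow ga `|y x - yi|%R <= 1 ->
  measurable_fun setT f -> (forall x, 0 <= f x <= 1)%R ->
  \int[mu]_x rpow (f x) (y x) <= 1 ->
  (forall i, \int[mu]_(x in Q i) (f x)%:E = (A i * v i)%:E) ->
  (forall i, 0 <= A i)%R ->
  exists M : Rn R n -> R, [/\ measurable_fun setT M, (forall x, 0 <= M x)%R,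
    \int[mu]_x (M x `^ r)%:E <= (K * 2)%:E &
    forall x (t : R), (0 <= t <= 1)%R -> (t <= max_mean Q A N x)%R ->
      rpow (ga * t) yi <= (M x `^ r)%:E].
Proof.
move=> my y0 /andP[yi0 yir] /andP[ga0 ga1] Hga mf f01 Hf HA A0.
have K0 := strong_const_ge0.
have f0 x : (0 <= f x)%R by case/andP: (f01 x).
have f1 x : (f x <= 1)%R by case/andP: (f01 x).
have [yi00|yin0] := eqVneq yi 0%R.
  exists (fun=> 0%R); split => //.
  - rewrite powR0 ?gt_eqF// integral0 lee_fin mulr_ge0//.
  - move=> x t /andP[t0 t1] _; rewrite yi00 /rpow eqxx (_ : ga * t <= 1)%R.
      by rewrite lee_fin powR_ge0.
    by rewrite mulr_ile1// ltW.
have {yin0}yip : (0 < yi)%R by rewrite lt_def yin0.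
(* the power that turns the exponent [r] into [1/yi] *)
pose be := (yi * r)^-1%R.
have be1 : (1 <= be)%R.
  rewrite invf_ge1 ?mulr_gt0//; apply: le_trans (ler_wpM2r (ltW r0) yir) _.
  by rewrite mulVf// gt_eqF.
have be0 : (0 < be)%R by exact: lt_le_trans be1.
have berE : (be * r = yi^-1)%R by rewrite /be invfM divfK// gt_eqF.
pose g x := (ga * f x)%R.
have g0 x : (0 <= g x)%R by rewrite mulr_ge0// ltW.
have g1 x : (g x <= 1)%R by rewrite mulr_ile1// ltW.
have mg : measurable_fun setT g by exact: measurable_funM.
pose h x := (g x `^ be)%R.
have h0 x : (0 <= h x)%R by exact: powR_ge0.
have h1 x : (h x <= 1)%R.
  rewrite (_ : 1%R = (1 `^ be)%R); last by rewrite powR1.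
  by apply: ge0_ler_powR; rewrite ?nnegrE ?(ltW be0).
have mh : measurable_fun setT h by exact: measurableT_comp (measurable_powR _) mg.
have hoo i : \int[mu]_(x in Q i) (h x)%:E < +oo.
  exact: (integral_le1_fin (mQ i) (muQ i) mh h0 h1).
have [B [B0 HB]] := exists_means v0 h0 hoo.
have hrE x : (h x `^ r)%:E = rpow (ga * f x) yi.
  by rewrite rpowE// /h -powRrM berE.
have md := @measurable_rpow_dist _ _ R y yi ga my (ltW ga0).
have Hh : \int[mu]_x (h x `^ r)%:E <= 2%:E.
  apply: (@le_trans _ _ (\int[mu]_x (rpow (f x) (y x) + rpow ga `|y x - yi|%R))).
    apply: le_integral_ge0 => x; first by rewrite lee_fin powR_ge0.
    rewrite hrE distrC; apply: rpow_perturb => //; first by rewrite ltW.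
  have mfy : measurable_fun setT (fun x => rpow (f x) (y x)) by exact: measurable_rpow.
  rewrite (@integralDT _ _ R mu _ _ mfy md (fun x => rpow_ge0 _ _) (fun x => rpow_ge0 _ _)).
  by apply: (le_trans (leeD Hf Hga)); rewrite -EFinD.
exists (max_mean Q B N); split.
- exact: measurable_max_mean.
- by move=> x; exact: max_mean_ge0.
- have HS := max_mean_strong l0 N r1 mh h0 HB.
  apply: le_trans HS _.
  rewrite [X in _ <= X](EFinM K 2%R); apply: lee_wpmul2l; last exact: Hh.
  by rewrite lee_fin.
move=> x t /andP[t0 t1] tM; rewrite rpowE// -berE powRrM lee_fin.
apply: ge0_ler_powR; rewrite ?nnegrE ?(ltW r0) ?powR_ge0 ?max_mean_ge0//.
have [M0|M0] := ltP 0%R (max_mean Q A N x); last first.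
  have -> : t = 0%R by apply/eqP; rewrite eq_le t0 (le_trans tM).
  by rewrite mulr0 powR0 ?gt_eqF// max_mean_ge0.
have [i [iN Qx ME]] := max_mean_attained M0.
apply: (@le_trans _ _ (B i)); last exact: (@le_max_mean _ _ R Q B N i).
rewrite ME in tM.
apply: (@le_trans _ _ ((ga * A i) `^ be)%R).
  apply: ge0_ler_powR; rewrite ?nnegrE ?(ltW be0) ?mulr_ge0 ?(ltW ga0)//.
  by rewrite ler_pM2l.
rewrite -(@ler_pM2r _ (v i))// -lee_fin -HB.
apply: (mean_powR (mQ i) (muQ i)) => //; first by rewrite mulr_ge0// ltW.
by rewrite -mulrA; exact: (@integralZ_EFin _ _ R mu (Q i) ga (A i * v i) f (mQ i) mf f0 (ltW ga0) (HA i)).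
Qed.

(** The function is split at height 1. The large values satisfy
    [f^r <= f^p] and are covered by the maximal inequality for [r]; the small
    values are covered by [far_small_values]. *)
Lemma far_maximal_bound y f (A : nat -> R) (yi ga al : R) N :
  measurable_fun setT y -> (forall x, 0 <= y x <= r^-1)%R -> (0 <= yi <= r^-1)%R ->
  (0 < ga <= 1)%R -> \int[mu]_x rpow ga `|y x - yi|%R <= 1 -> (1 <= al)%R ->
  measurable_fun setT f -> (forall x, 0 <= f x)%R ->
  \int[mu]_x rpow (f x) (y x) <= 1 ->
  (forall i, \int[mu]_(x in Q i) (f x)%:E = (A i * v i)%:E) ->
  \int[mu]_x (if (max_mean Q A N x <= al)%R then
     rpow (ga ^+ 2 / (2 * al) * max_mean Q A N x) (y x) else 0) <=
  (3 * K + 2)%:E.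
Proof.
move=> my yr yir ga01 Hga al1 mf f0 Hf HA.
have [ga0 ga1] : (0 < ga /\ ga <= 1)%R by case/andP: ga01.
have [yi0 yi1] : (0 <= yi /\ yi <= r^-1)%R by case/andP: yir.
have al0 : (0 < al)%R by exact: lt_le_trans al1.
have K0 := strong_const_ge0.
have y0 x : (0 <= y x)%R by case/andP: (yr x).
have y1 x : (y x <= r^-1)%R by case/andP: (yr x).
have m1f : measurable_fun setT (fun x => 1 < f x)%R.
  by apply: measurable_fun_ltr => //; exact: measurable_cst.
pose f1 x := (if 1 < f x then f x else 0)%R.
pose f2 x := (if 1 < f x then 0 else f x)%R.
have mf1 : measurable_fun setT f1 by exact: measurable_fun_ifT.
have mf2 : measurable_fun setT f2 by exact: measurable_fun_ifT.
have f10 x : (0 <= f1 x)%R by rewrite /f1; case: ifP.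
have f20 x : (0 <= f2 x <= 1)%R by rewrite /f2; case: ltP => // h; rewrite ?lexx ?ler01// f0.
have f200 x : (0 <= f2 x)%R by case/andP: (f20 x).
have f2f x : (f2 x <= f x)%R by rewrite /f2; case: ifP.
have f1f x : (f1 x <= f x)%R by rewrite /f1; case: ifP.
have f12 x : f x = (f1 x + f2 x)%R.
  by rewrite /f1 /f2; case: ifP; rewrite ?addr0 ?add0r.
have leoo (g : Rn R n -> R) : measurable_fun setT g -> (forall x, 0 <= g x)%R ->
    (forall x, g x <= f x)%R -> forall i, \int[mu]_(x in Q i) (g x)%:E < +oo.
  move=> mg g0 gf i; apply: (@le_lt_trans _ _ (\int[mu]_(x in Q i) (f x)%:E)); last first.
    by rewrite HA ltry.
  exact: le_integral_EFin.
have [A1 [A10 HA1]] := exists_means v0 f10 (leoo f1 mf1 f10 f1f).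
have [A2 [A20 HA2]] := exists_means v0 f200 (leoo f2 mf2 f200 f2f).
have A12 i : A i = (A1 i + A2 i)%R.
  apply: (@mulIf _ (v i)); first by rewrite gt_eqF.
  apply: EFin_inj; rewrite mulrDl EFinD -HA -HA1 -HA2.
  exact: (@integral_sum_EFin _ _ R mu (Q i) f1 f2 f (mQ i) mf1 mf2 f10 f200 f12).
have Hf2 : \int[mu]_x rpow (f2 x) (y x) <= 1.
  apply: le_trans Hf; apply: le_integral_ge0 => x; first exact: rpow_ge0.
  by apply: le_rpow.
have [M [mM M0 HM MP]] := far_small_values N my y0 yir ga01 Hga mf2 f20 Hf2 HA2 A20.
pose M1 := max_mean Q A1 N.
have mM1 : measurable_fun setT M1 by exact: measurable_max_mean.
have M10 x : (0 <= M1 x)%R by exact: max_mean_ge0.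
have HM1 : \int[mu]_x (M1 x `^ r)%:E <= K%:E.
  have HS := max_mean_strong l0 N r1 mf1 f10 HA1.
  apply: le_trans HS _.
  rewrite -[leRHS]mule1; apply: lee_wpmul2l; first by rewrite lee_fin.
  apply: le_trans Hf; apply: le_integral_ge0 => x; first by rewrite lee_fin powR_ge0.
  rewrite /f1; case: ltP => h; last by rewrite powR0 ?gt_eqF// rpow_ge0.
  have [->|yn0] := eqVneq (y x) 0%R; first by rewrite /rpow eqxx ifN ?leey// -ltNge.
  have yp : (0 < y x)%R by rewrite lt_def yn0 y0.
  rewrite rpowE// lee_fin; apply: ler_powR; first exact: ltW.
  by rewrite -[leLHS]invrK lef_pV2 ?posrE ?invr_gt0.
have md := @measurable_rpow_dist _ _ R y yi ga my (ltW ga0).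
have mMr : measurable_fun setT (fun x => (M x `^ r)%:E).
  by apply/measurable_EFinP; exact: measurableT_comp (measurable_powR _) mM.
have mM1r : measurable_fun setT (fun x => (M1 x `^ r)%:E).
  by apply/measurable_EFinP; exact: measurableT_comp (measurable_powR _) mM1.
pose W x := rpow ga `|y x - yi|%R.
have W0 x : 0 <= W x by exact: rpow_ge0.
apply: (@le_trans _ _ (\int[mu]_x (((M1 x `^ r)%:E + W x) + ((M x `^ r)%:E + W x)))).
  apply: le_integral_ge0 => x; first by case: ifP => // _; exact: rpow_ge0.
  case: (leP (max_mean Q A N x) al) => [Mal|_]; last by rewrite !adde_ge0// lee_fin powR_ge0.
  set MM := max_mean Q A N x in Mal *.
  have MM0 : (0 <= MM)%R by exact: max_mean_ge0.
  pose M2 := max_mean Q A2 N.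
  have M20 : (0 <= M2 x)%R by exact: max_mean_ge0.
  have MM12 : (MM <= M1 x + M2 x)%R.
    apply: max_mean_le; first exact: addr_ge0.
    by move=> i iN Qx; rewrite A12; apply: lerD;
      [exact: (@le_max_mean _ _ R Q A1 N i)|exact: (@le_max_mean _ _ R Q A2 N i)].
  pose s := (Num.min 1 (M1 x / al))%R; pose t := (Num.min 1 (M2 x / al))%R.
  have divle (z : R) : (0 <= z)%R -> (z / al <= z)%R.
    by move=> z0; rewrite ler_pdivrMr// ler_peMr.
  have s0 : (0 <= s)%R by rewrite le_min ler01 divr_ge0// ltW.
  have t0 : (0 <= t)%R by rewrite le_min ler01 divr_ge0// ltW.
  have s1 : (s <= 1)%R by rewrite ge_min lexx.
  have t1 : (t <= 1)%R by rewrite ge_min lexx.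
  have sM : (s <= M1 x)%R by rewrite ge_min (divle _ (M10 x)) orbT.
  have tM : (t <= M2 x)%R by rewrite ge_min (divle _ M20) orbT.
  have key := split_level ga0 al1 (M10 x) M20 Mal MM12.
  rewrite -/s -/t in key.
  have gat (z : R) : (0 <= z)%R -> (z <= 1)%R -> (0 <= ga * z <= 1)%R.
    by move=> z0 z1; rewrite mulr_ge0 ?(ltW ga0)//= mulr_ile1// ltW.
  have ga01' : (0 <= ga <= 1)%R by rewrite ltW.
  apply: (le_trans (le_rpow_max _ (y0 x) key)).
    by rewrite mulr_ge0// divr_ge0 ?exprn_ge0 ?mulr_ge0 ?(ltW al0) ?(ltW ga0).
  apply: leeD.
    apply: (le_trans (rpow_perturb ga01' (gat _ s0 s1) (y0 x) yi0)).
    rewrite leeD2r//; apply: (@le_trans _ _ (rpow s r^-1)).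
      apply: (@le_trans _ _ (rpow s yi)).
        apply: le_rpow => //; first by rewrite mulr_ge0// ltW.
        by rewrite ler_piMl.
      by apply: le_rpow_exp_le1 => //; rewrite s0.
    rewrite rpowE ?invr_gt0// invrK lee_fin.
    by apply: ge0_ler_powR; rewrite ?nnegrE ?(ltW r0).
  apply: (le_trans (rpow_perturb ga01' (gat _ t0 t1) (y0 x) yi0)).
  rewrite leeD2r//; apply: MP => //; by rewrite t0.
have mW : measurable_fun setT W by [].
have p1 x : 0 <= (M1 x `^ r)%:E by rewrite lee_fin powR_ge0.
have p2 x : 0 <= (M x `^ r)%:E by rewrite lee_fin powR_ge0.
rewrite (@integralDT _ _ R mu (fun x => (M1 x `^ r)%:E + W x) (fun x => (M x `^ r)%:E + W x)).
- rewrite (@integralDT _ _ R mu _ _ mM1r mW p1 W0) (@integralDT _ _ R mu _ _ mMr mW p2 W0).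
  apply: (le_trans (leeD (leeD HM1 Hga) (leeD HM Hga))).
  rewrite -!EFinD lee_fin le_eqVlt; apply/orP; left; apply/eqP; ring.
- exact: emeasurable_funD.
- exact: emeasurable_funD.
- by move=> x; rewrite adde_ge0.
- by move=> x; rewrite adde_ge0.
Qed.

End far.

(** * Finite families of cubes *)

Section modular_bound.
Context {R : realType} (n : nat).
Hypothesis n_gt0 : (0 < n)%N.
Local Notation mu := (@lebesgue_n R n).
Implicit Types (y f : Rn R n -> R).

(** The modular inequality for finite maxima of means over cubes. *)
Definition means_bounded (C : R) y := forall f : Rn R n -> R,
  measurable_fun setT f -> (forall x, 0 <= f x)%R ->
  (forall x, rpow (f x) (y x) < +oo) -> \int[mu]_x rpow (f x) (y x) <= 1 ->
  forall (b : nat -> n.-tuple R) (l A : nat -> R), (forall i, 0 < l i)%R ->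
  (forall i, \int[mu]_(x in cube (b i) (l i)) (f x)%:E = (A i * l i ^+ n)%:E) ->
  forall N, \int[mu]_x rpow (max_mean (fun i => cube (b i) (l i)) A N x / C) (y x) <= 1.

(** Above the level [al] the bound is [local_maximal_bound] and below it
    [far_maximal_bound]; a last rescaling turns the sum of the two constants
    into 1. *)
Lemma max_mean_modular (r c ga : R) : (1 < r)%R -> (0 < c <= 1)%R -> (0 < ga <= 1)%R ->
  exists C : R, (0 < C)%R /\
  forall y (yi : R), measurable_fun setT y -> (forall x, 0 <= y x <= r^-1)%R ->
  local_muckenhoupt c r y -> (0 <= yi)%R ->
  \int[mu]_x rpow ga `|y x - yi|%R <= 1 ->
  means_bounded C y.
Proof.
move=> r1 c01 ga01; have [q [k [q1 k01 HJ]]] := local_jensen n_gt0 r1 c01.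
have [k0 k1] : (0 < k /\ k <= 1)%R by case/andP: k01.
have [ga0 ga1] : (0 < ga /\ ga <= 1)%R by case/andP: ga01.
have t0 : (0 < 3 ^+ n :> R)%R by rewrite exprn_gt0.
have t1 : (1 <= 3 ^+ n :> R)%R by rewrite exprn_ege1// ler1n.
pose al := (1 + 3 ^+ n + 2 * 3 ^+ n / k)%R.
have tk0 : (0 <= 2 * 3 ^+ n / k)%R by rewrite divr_ge0 ?mulr_ge0 ?ltW.
have al1 : (1 + 3 ^+ n <= al)%R by rewrite lerDl.
have al2 : (2 * 3 ^+ n / k <= al)%R by rewrite lerDr addr_ge0// ltW.
have al3 : (1 <= al)%R by apply: le_trans al1; rewrite lerDl ltW.
have al0 : (0 < al)%R by exact: lt_le_trans al3.
pose s1 := (k / (4 * 3 ^+ n))%R; pose s2 := (ga ^+ 2 / (2 * al))%R.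
have s10 : (0 < s1)%R by rewrite divr_gt0// mulr_gt0.
have s20 : (0 < s2)%R by rewrite divr_gt0 ?exprn_gt0// mulr_gt0.
pose s := Num.min s1 s2.
have s0 : (0 < s)%R by rewrite lt_min s10.
have ss1 : (s <= s1)%R by rewrite ge_min lexx.
have ss2 : (s <= s2)%R by rewrite ge_min lexx orbT.
pose K := (3 ^+ n * 4 `^ r * gain_const r)%R.
have K0 : (0 <= K)%R by exact: strong_const_ge0.
pose C1 := (3 ^+ n * gain_const q)%R.
have C10 : (0 <= C1)%R by rewrite mulr_ge0 ?gain_const_ge0// ltW.
pose C := (1 + (C1 + (3 * K + 2)))%R.
have C1' : (1 <= C)%R by rewrite lerDl addr_ge0// addr_ge0// mulr_ge0.
have C0 : (0 < C)%R by exact: lt_le_trans C1'.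
have CC : (C1 + (3 * K + 2) <= C)%R by rewrite lerDr.
exists (C / s)%R; split; first exact: divr_gt0.
have r0 : (0 < r)%R by exact: lt_trans r1.
have ri1 : (r^-1 <= 1)%R by rewrite invf_le1// ltW.
move=> y yi my yr HA yi0 Hga f mf f0 foo Hf b l A l0 HAf N.
have yir := nekvinda_limit_le n_gt0 my yr ga01 yi0 Hga.
have y0 x : (0 <= y x)%R by case/andP: (yr x).
have y1 x : (y x <= 1)%R by case/andP: (yr x) => _ /le_trans; apply.
have y01 x : (0 <= y x <= 1)%R by rewrite y0 y1.
have yi01 : (0 <= yi <= r^-1)%R by rewrite yi0.
have HJy := HJ y my yr HA.
have H1 := @local_maximal_bound R n b l l0 q k y f A al N q1 k01 HJy
  my y01 mf f0 foo Hf HAf al1 al2.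
have H2 := @far_maximal_bound R n b l l0 r r1 y f A yi ga al N my yr yi01 ga01 Hga al3
  mf f0 Hf HAf.
set M := max_mean _ A N in H1 H2 *.
have mM : measurable_fun setT M.
  by apply: measurable_max_mean => i; exact: measurable_cube.
have M0 x : (0 <= M x)%R by exact: max_mean_ge0.
have mlt : measurable_fun setT (fun x => al < M x)%R.
  by apply: measurable_fun_ltr => //; exact: measurable_cst.
have mle : measurable_fun setT (fun x => M x <= al)%R.
  by apply: measurable_fun_ler => //; exact: measurable_cst.
have msM (t : R) : (0 <= t)%R -> measurable_fun setT (fun x => rpow (t * M x) (y x)).
  move=> tt0; apply: measurable_rpow => [|//||//]; first exact: measurable_funM.
  by move=> x; exact: mulr_ge0.
pose g1 x := if (al < M x)%R then rpow (s1 * M x) (y x) else 0.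
pose g2 x := if (M x <= al)%R then rpow (s2 * M x) (y x) else 0.
have mg1 : measurable_fun setT g1.
  by apply: measurable_fun_ifT; [exact: mlt|exact: msM (ltW s10)|exact: measurable_cst].
have mg2 : measurable_fun setT g2.
  by apply: measurable_fun_ifT; [exact: mle|exact: msM (ltW s20)|exact: measurable_cst].
have g10 x : 0 <= g1 x by rewrite /g1; case: ifP => _; [exact: rpow_ge0|exact: lexx].
have g20 x : 0 <= g2 x by rewrite /g2; case: ifP => _; [exact: rpow_ge0|exact: lexx].
have mg12 : measurable_fun setT (fun x => g1 x + g2 x) by exact: emeasurable_funD.
have H12 : \int[mu]_x (g1 x + g2 x) <= C%:E.
  rewrite (@integralDT _ _ R mu _ _ mg1 mg2 g10 g20).
  apply: (le_trans (leeD H1 H2)); rewrite -EFinD lee_fin; exact: CC.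
apply: (@le_trans _ _ (\int[mu]_x ((C^-1)%:E * (g1 x + g2 x)))).
  apply: le_integral_ge0 => x; first exact: rpow_ge0.
  have Cs : (0 < C^-1 <= 1)%R by rewrite invr_gt0 C0 invf_le1.
  have -> : (M x / (C / s) = C^-1 * (s * M x))%R.
    by rewrite invfM invrK mulrC mulrA.
  apply: (le_trans (rpow_scale Cs _ (y01 x))); first by rewrite mulr_ge0 ?M0 ?(ltW s0).
  apply: lee_wpmul2l; first by rewrite lee_fin invr_ge0 ltW.
  rewrite /g1 /g2; case: (leP (M x) al) => _.
    rewrite add0e; apply: le_rpow; [exact: y0|by rewrite mulr_ge0 ?M0 ?(ltW s0)|exact: ler_wpM2r].
  rewrite adde0; apply: le_rpow; [exact: y0|by rewrite mulr_ge0 ?M0 ?(ltW s0)|exact: ler_wpM2r].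
have g120 x : 0 <= g1 x + g2 x by rewrite adde_ge0.
have -> : \int[mu]_x ((C^-1)%:E * (g1 x + g2 x)) = (C^-1)%:E * \int[mu]_x (g1 x + g2 x).
  apply: ge0_integralZl; [exact: measurableT|exact: mg12|by move=> x _; exact: g120|].
  by rewrite lee_fin invr_ge0 ltW.
apply: (@le_trans _ _ ((C^-1)%:E * C%:E)).
  by apply: lee_wpmul2l; [rewrite lee_fin invr_ge0 ltW|exact: H12].
by rewrite -EFinM mulVf// gt_eqF.
Qed.

End modular_bound.

(** * Reciprocals of the exponents *)

Section translation.
Context {R : realType}.
Implicit Types (t z : R) (p q : \bar R).

Lemma epow_rpow t z : (0 <= z)%R -> epow t%:E (z%:E^-1) = rpow t z.
Proof.
move=> z0; rewrite inver /rpow; case: eqP => // _.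
Qed.

Lemma inve_exponent p : 1 <= p -> p^-1 = (fine p)^-1%R%:E /\ (0 <= (fine p)^-1 <= 1)%R.
Proof.
case: p => [r| |] //=; last by rewrite invey invr0 lexx ler01.
rewrite lee_fin => r1; have r0 : (0 < r)%R by exact: lt_le_trans r1.
by rewrite inver gt_eqF// invr_ge0 (ltW r0) invf_le1.
Qed.

Lemma exponentE p : 1 <= p -> p = ((fine p)^-1%R%:E)^-1.
Proof. by move=> /inve_exponent[<- _]; rewrite inveK. Qed.

Lemma conj_exponentE p : 1 <= p -> hoelder_conjugate p = ((1 - (fine p)^-1)%R%:E)^-1.
Proof.
move=> p1; have [pE _] := inve_exponent p1.
have := @hoelder_conjugate_eq1 R p.
have p0 : p != 0 by rewrite gt_eqF// (lt_le_trans _ p1).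
have pN : -oo < p by rewrite (lt_le_trans _ p1)// ltNyr.
move=> /(_ pN p0); rewrite pE => h; apply: (can_inj inveK); rewrite inveK.
by rewrite EFinB -[1%:E]h addeAC -EFinB subrr add0e.
Qed.

Lemma nekvinda_exponentE p q : 1 <= p -> 1 <= q ->
  `|p^-1 - q^-1|^-1 = (`|(fine p)^-1 - (fine q)^-1|%R%:E)^-1.
Proof. by move=> /inve_exponent[-> _] /inve_exponent[-> _]. Qed.

End translation.

Section ae.
Context d (T : measurableType d) (R : realType).
Variable mu : {measure set T -> \bar R}.

(** The smaller function is dominated everywhere after adding [+oo] on a null
    set to the larger one. *)
Lemma le_integral_ae (f g : T -> \bar R) : (forall x, 0 <= f x) -> (forall x, 0 <= g x) ->
  measurable_fun setT g -> (\forall x \ae mu, f x <= g x) ->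
  \int[mu]_x f x <= \int[mu]_x g x.
Proof.
move=> f0 g0 mg [N [mN N0 HN]].
pose i x : \bar R := ((cst +oo) \_ N) x.
have i0 x : 0 <= i x by rewrite /i /patch; case: ifP => _; rewrite ?leey ?lexx.
have mi : measurable_fun setT i.
  by apply/(measurable_restrictT _ mN); exact: measurable_cst.
pose g' x := g x + i x.
have mg' : measurable_fun setT g' by exact: emeasurable_funD.
apply: (@le_trans _ _ (\int[mu]_x g' x)).
  apply: le_integral_ge0 => // x; rewrite /g' /i /patch; case: ifPn => [_|xN].
    by rewrite addey ?leey// gt_eqF// (lt_le_trans _ (g0 x))// ltNyr.
  rewrite adde0; apply: contrapT => nfg; move/negP: xN; apply; rewrite inE; exact: HN.
rewrite le_eqVlt; apply/orP; left; apply/eqP; apply: ge0_ae_eq_integral => //.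
  by move=> x _; rewrite adde_ge0.
exists N; split => // x; rewrite /= /g' /i /patch => H; apply: contrapT => xN.
by apply: H => _; rewrite memNset// adde0.
Qed.

End ae.

(** * From rational cubes to the maximal operator *)

Section rational_cubes.
Context {R : realType} (n : nat).
Local Notation mu := (@lebesgue_n R n).

(** An enumeration of the cubes with rational data; codes without meaning give
    the unit cube, so that all sides are positive. *)
Definition rat_cube (i : nat) : n.-tuple R * R :=
  if unpickle i is Some (a, q) then
    if (0 < q :> rat)%R then
      ([tuple ratr (tnth (a : n.-tuple rat) j) | j < n], ratr q)
    else ([tuple 0%R | _ < n], 1%R)
  else ([tuple 0%R | _ < n], 1%R).

Lemma rat_cube_gt0 i : (0 < (rat_cube i).2)%R.
Proof.
rewrite /rat_cube; case: unpickle => [[a q]|]; last exact: ltr01.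
by case: ifPn => [q0|_]; [rewrite ltr0q|exact: ltr01].
Qed.

Lemma rat_cube_cover (b : n.-tuple R) (L : R) : (0 < L)%R ->
  exists2 i, cube b L `<=` cube (rat_cube i).1 (rat_cube i).2 &
    ((rat_cube i).2 <= 2 * L)%R.
Proof.
move=> L0.
have /choice[a Ha] : forall j : 'I_n, exists q : rat,
    (tnth b j - L / 2 < ratr q < tnth b j)%R.
  move=> j; have [|q] := @rat_in_itvoo R (tnth b j - L / 2)%R (tnth b j).
    by rewrite ltrBlDr ltrDl divr_gt0.
  by rewrite in_itv/= => H; exists q.
have [|q] := @rat_in_itvoo R (3 / 2 * L)%R (2 * L)%R; first by lra.
rewrite in_itv/= => /andP[q1 q2].
have q0 : (0 < q)%R.
  by rewrite -(@ltr0q R); apply: lt_trans q1; rewrite mulr_gt0// divr_gt0.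
exists (pickle ([tuple a j | j < n], q)); rewrite /rat_cube pickleK q0 /=; last exact: ltW.
move=> x H j; rewrite !tnth_mktuple; have /andP[h1 h2] := H j; have /andP[h3 h4] := Ha j.
by apply/andP; split; lra.
Qed.

Local Notation Q := (fun i => cube (rat_cube i).1 (rat_cube i).2 : set (Rn R n)).

(** A cube is contained in a rational cube with at most twice its side, which
    costs the factor [2^n]. *)
Lemma maximal_le_max_mean (F : Rn R n -> \bar R) (A : nat -> R) (lam : R) x :
  (0 <= lam)%R -> (forall i, 0 <= A i)%R -> measurable_fun setT F ->
  (forall i, \int[mu]_(y in Q i) `|F y| <= (lam * (A i * (rat_cube i).2 ^+ n))%:E) ->
  maximal F x <= (2 ^+ n * lam)%:E * ereal_sup (range (fun N => (max_mean Q A N x)%:E)).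
Proof.
move=> lam0 A0 mF; have mabs : measurable_fun setT (fun y => `|F y|).
  exact: measurableT_comp.
move=> HA; apply: ge_ereal_sup => _ [_ [[b [L L0 ->]] Cx] <-].
have [i Ci Li] := rat_cube_cover b L0.
have l0 := rat_cube_gt0 i.
have [mC muC] := lebesgue_cube b (ltW L0).
have [mQ muQ] := lebesgue_cube (rat_cube i).1 (ltW l0).
apply: (@le_trans _ _ ((2 ^+ n * lam)%:E * (max_mean Q A i.+1 x)%:E)); last first.
  apply: lee_wpmul2l; first by rewrite lee_fin mulr_ge0 ?exprn_ge0.
  by apply: ereal_sup_ubound; exists i.+1.
apply: (@le_trans _ _ ((2 ^+ n * lam)%:E * (A i)%:E)); last first.
  apply: lee_wpmul2l; first by rewrite lee_fin mulr_ge0 ?exprn_ge0.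
  rewrite lee_fin; apply: (@le_max_mean _ _ R Q A i.+1 i x); first exact: ltnSn.
  exact: Ci.
have Ln0 : (0 < L ^+ n)%R by rewrite exprn_gt0.
rewrite [X in _ / X](_ : _ = (L ^+ n)%:E)// inver gt_eqF//.
rewrite lee_pdivrMr//.
apply: (@le_trans _ _ (\int[mu]_(y in Q i) `|F y|)).
  apply: ge0_subset_integral; [exact: mC|exact: mQ|exact: measurable_funTS| |exact: Ci].
  by move=> y _; exact: abse_ge0.
apply: (le_trans (HA i)); rewrite -!EFinM lee_fin.
have -> : (2 ^+ n * lam * A i * L ^+ n = lam * (A i * (2 * L) ^+ n))%R.
  by rewrite exprMn; ring.
by rewrite !ler_wpM2l// lerXn2r ?nnegrE ?mulr_ge0 ?(ltW l0) ?(ltW L0).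
Qed.

End rational_cubes.

Section suprema.
Context {R : realType}.

(** The factor 2 makes room for a strict inequality, since the supremum need not
    be attained; if it is infinite, powers with exponent at least 1 are
    unbounded too. *)
Lemma epow_sup (t : \bar R) (c z : R) (u : nat -> R) : 0 <= t -> (0 < c)%R ->
  (0 <= z <= 1)%R -> (forall i, 0 <= u i)%R ->
  t <= c%:E * ereal_sup (range (EFin \o u)) ->
  epow t (z%:E^-1) <= ereal_sup (range (fun i => rpow (2 * c * u i) z)).
Proof.
move=> t0 c0 z01 u0 tc; have /andP[z0 z1] := z01.
have c20 : (0 < 2 * c)%R by rewrite mulr_gt0.
have ub i : rpow (2 * c * u i) z <= ereal_sup (range (fun i => rpow (2 * c * u i) z)).
  by apply: ereal_sup_ubound; exists i.
have ex (s : R) : (0 < s)%R -> (2 * s)%:E <= t -> exists i, (s <= c * u i)%R.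
  move=> s0 st; apply: contrapT => H.
  have : ereal_sup (range (EFin \o u)) <= (s / c)%:E.
    apply: ge_ereal_sup => _ [i _ <-] /=; rewrite lee_fin ler_pdivlMr//.
    by rewrite leNgt; apply/negP => h; apply: H; exists i; rewrite mulrC ltW.
  move=> /(lee_wpmul2l (_ : 0 <= c%:E)); rewrite lee_fin ltW// => /(_ isT) h.
  have := le_trans (le_trans st tc) h.
  rewrite -EFinM lee_fin (_ : c * (s / c) = s)%R; last by field; rewrite gt_eqF.
  lra.
case: t t0 tc ex => [s| |] // t0 tc ex.
  rewrite lee_fin in t0; rewrite epow_rpow//.
  have [s0|s0] := ltP 0%R s; last first.
    have -> : s = 0%R by apply/eqP; rewrite eq_le s0 t0.
    by rewrite rpow0l; apply: le_trans (ub 0%N); exact: rpow_ge0.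
  have [||i Hi] := ex (s / 2)%R; first by rewrite divr_gt0.
    by rewrite lee_fin mulrC divfK.
  apply: le_trans (ub i); apply: le_rpow => //; lra.
rewrite [leRHS](_ : _ = +oo) ?leey//; apply/eqyP => K K0.
have [||i Hi] := ex (1 + K)%R; first by rewrite addr_gt0.
  exact: leey.
apply: le_trans (ub i); apply: (@le_trans _ _ (2 * c * u i)%:E); first by rewrite lee_fin; lra.
by apply: rpow_ge1 => //; lra.
Qed.

Lemma integral_sup_le d (T : measurableType d) (mu : {measure set T -> \bar R})
    (g : nat -> T -> \bar R) (B : \bar R) :
  (forall N, measurable_fun setT (g N)) -> (forall N x, 0 <= g N x) ->
  (forall N x, g N x <= g N.+1 x) -> (forall N, \int[mu]_x g N x <= B) ->
  \int[mu]_x ereal_sup (range (g^~ x)) <= B.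
Proof.
move=> mg g0 ndg gB.
have nd x : {homo g^~ x : N M / (N <= M)%N >-> N <= M}.
  by apply/nondecreasing_seqP => N; exact: ndg.
have -> : \int[mu]_x ereal_sup (range (g^~ x)) = \int[mu]_x limn (g^~ x).
  apply: eq_integral => x _; apply/esym/cvg_lim => //.
  exact: ereal_nondecreasing_cvgn.
rewrite monotone_convergence//.
apply: lime_le; last exact: nearW.
apply: ereal_nondecreasing_is_cvgn => N M NM; apply: le_integral_ge0 => // x.
exact: nd.
Qed.

End suprema.

(** * The Muckenhoupt condition on small cubes *)

Section muckenhoupt_local.
Context d (T : measurableType d) (R : realType).
Variable mu : {measure set T -> \bar R}.

(** Average of [rpow_ln] over the set: the mean of [ln L + y ln v] is
    [ln L + a ln v], and it is at most 1. *)
Lemma rpow_mean_lower (D : set T) (v a L : R) (y : T -> R) :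
  measurable D -> mu D = v%:E -> (0 < v <= 1)%R -> measurable_fun setT y ->
  (forall x, 0 <= y x <= 1)%R -> (0 <= a)%R ->
  \int[mu]_(x in D) (y x)%:E = (a * v)%:E -> (0 < L)%R ->
  \int[mu]_(x in D) rpow L (y x) <= 1 -> (v `^ a / expR 1 <= L^-1)%R.
Proof.
move=> mD muD /andP[v0 v1] my y01 a0 Hy L0 H.
have y0 x : (0 <= y x)%R by case/andP: (y01 x).
have e1 : (1 <= expR 1 :> R)%R by rewrite -[leLHS]expR0 ler_expR.
have [L1|L1] := leP 1%R L; last first.
  apply: (@le_trans _ _ 1%R); last by rewrite invf_ge1// ltW.
  rewrite ler_pdivrMr ?expR_gt0// mul1r; apply: le_trans e1.
  by rewrite -[leRHS](powRr0 v) ger_powR// v0.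
have lnL : (0 <= ln L)%R by exact: ln_ge0.
have lnv : (0 <= - ln v)%R by rewrite oppr_ge0; exact: ln_le0.
have mr : measurable_fun setT (fun x => rpow L (y x)) by apply: measurable_rpowc => //; exact: ltW.
have : \int[mu]_(x in D) (ln L)%:E <=
    \int[mu]_(x in D) (v%:E * rpow L (y x) + (- ln v)%:E * (y x)%:E).
  apply: ge0_le_integral.
  - exact: mD.
  - by move=> x _; rewrite lee_fin.
  - exact: measurable_cst.
  - apply: measurable_funTS; apply: emeasurable_funD; apply: measurable_funeM => //.
    exact/measurable_EFinP.
  - move=> x _; have h := rpow_ln L1 v0 (y01 x).
    rewrite [X in X%:E <= _](_ : _ = (ln L + y x * ln v) + - ln v * y x)%R; last by ring.
    by rewrite EFinD EFinM; exact: leeD.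
rewrite integral_cst// ge0_integralD; last 5 first.
- exact: mD.
- by move=> x _; rewrite mule_ge0 ?rpow_ge0// lee_fin ltW.
- by apply: measurable_funTS; apply: measurable_funeM.
- by move=> x _; rewrite -EFinM lee_fin mulr_ge0.
- by apply: measurable_funTS; apply: measurable_funeM; exact/measurable_EFinP.
rewrite ge0_integralZl; last 4 first.
- exact: mD.
- exact: measurable_funTS.
- by move=> x _; exact: rpow_ge0.
- by rewrite lee_fin ltW.
rewrite ge0_integralZl; last 4 first.
- exact: mD.
- by apply: measurable_funTS; exact/measurable_EFinP.
- by move=> x _; rewrite lee_fin.
- by rewrite lee_fin.
rewrite muD Hy => h.
have {}h : (ln L * v <= v + - ln v * (a * v))%R.
  rewrite -lee_fin; apply: (le_trans h); rewrite EFinD -EFinM; apply: leeD => //.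
  rewrite -[leRHS]mule1; apply: lee_wpmul2l; last exact: H.
  by rewrite lee_fin ltW.
have {}h : (ln L <= 1 - a * ln v)%R.
  rewrite -(ler_pM2r v0); apply: (le_trans h); lra.
rewrite ler_pdivrMr ?expR_gt0// -ler_pdivrMl ?invr_gt0// invrK.
rewrite -ler_ln ?posrE ?mulr_gt0 ?powR_gt0 ?expR_gt0//.
by rewrite lnM ?posrE ?powR_gt0// ln_powR expRK; lra.
Qed.

End muckenhoupt_local.

Section real_substitute.
Context d (T : measurableType d) (R : realType).
Variable mu : {measure set T -> \bar R}.

(** The values to be discarded are those of infinite modular, which form a null
    set. The result is real valued and has a finite power at every point. *)
Lemma real_substitute (g : T -> \bar R) (y0 y : T -> R) :
  measurable_fun setT g -> (forall x, 0 <= g x) ->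
  measurable_fun setT y0 -> (forall x, 0 <= y0 x <= 1)%R ->
  measurable_fun setT y -> (forall x, 0 <= y x)%R ->
  (forall x, y x = 0%R -> y0 x = 0%R) -> (\forall x \ae mu, y0 x = y x) ->
  \int[mu]_x epow (g x) ((y0 x)%:E^-1) <= 1 ->
  exists f : T -> R, [/\ measurable_fun setT f, (forall x, 0 <= f x)%R,
    (forall x, rpow (f x) (y x) < +oo), \int[mu]_x rpow (f x) (y x) <= 1 &
    \forall x \ae mu, g x = (f x)%:E].
Proof.
move=> mg g0 my0 y001 my y0' yy0 aey H.
have y00 x : (0 <= y0 x)%R by case/andP: (y001 x).
pose h x := if g x < +oo then rpow (fine (g x)) (y0 x) else +oo.
have hE x : epow (g x) ((y0 x)%:E^-1) = h x.
  rewrite /h; have := g0 x; case: (g x) => [t| |] // _; first by rewrite ltry epow_rpow.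
  rewrite ltxx inver; case: eqP => // /eqP yn0 /=.
  by rewrite /poweR invr_eq0 (negbTE yn0).
have mfg : measurable_fun setT (fun x => fine (g x)) by exact: measurableT_comp.
have fg0 x : (0 <= fine (g x))%R by exact: fine_ge0.
have mr : measurable_fun setT (fun x => rpow (fine (g x)) (y0 x)) by exact: measurable_rpow.
have mh : measurable_fun setT h.
  apply: measurable_fun_ifT; [|exact: mr|exact: measurable_cst].
  by apply: measurable_fun_lte => //; exact: measurable_cst.
have h0 x : 0 <= h x by rewrite /h; case: ifP => _; [exact: rpow_ge0|exact: leey].
have Hh : \int[mu]_x h x <= 1.
  apply: le_trans H; rewrite le_eqVlt; apply/orP; left; apply/eqP.
  by apply: eq_integral => x _; rewrite hE.
have aeh : \forall x \ae mu, h x < +oo.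
  have ih : mu.-integrable setT h.
    apply/integrableP; split => //; apply: le_lt_trans (ltry 1%R).
    apply: le_trans Hh; rewrite le_eqVlt; apply/orP; left; apply/eqP.
    by apply: eq_integral => x _; rewrite gee0_abs.
  have := integrable_ae measurableT ih; apply: filterS => x /(_ I).
  by rewrite ge0_fin_numE.
pose f x := if h x < +oo then fine (g x) else 0%R.
have hg x : h x < +oo -> g x < +oo by rewrite /h; case: ifP.
have mf : measurable_fun setT f.
  apply: measurable_fun_ifT; [|exact: mfg|exact: measurable_cst].
  by apply: measurable_fun_lte => //; exact: measurable_cst.
have f0 x : (0 <= f x)%R by rewrite /f; case: ifP.
exists f; split.
- exact: mf.
- exact: f0.
- move=> x; have [yx|yx] := eqVneq (y x) 0%R; last first.
    by rewrite rpowE ?ltry// lt_def yx y0'.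
  rewrite yx /f; case: ifPn => [hoo|_]; last by rewrite rpow0l ltry.
  by move: (hoo); rewrite /h (hg _ hoo) (yy0 _ yx).
- apply: le_trans Hh; apply: le_integral_ae => //; first by move=> x; exact: rpow_ge0.
  apply: filterS aey => x yx; rewrite -yx /f; case: ifPn => [hoo|_].
    by rewrite /h (hg _ hoo).
  by rewrite rpow0l.
- apply: filterS aeh => x hoo; rewrite /f hoo fineK// ge0_fin_numE// .
  exact: hg.
Qed.

Lemma measurable_ereal_sup_seq (g : nat -> T -> \bar R) :
  (forall N, measurable_fun setT (g N)) -> (forall N x, g N x <= g N.+1 x) ->
  measurable_fun setT (fun x => ereal_sup (range (g^~ x))).
Proof.
move=> mg ndg; apply: (@emeasurable_fun_cvg _ _ _ _ g) => // x _.
by apply: ereal_nondecreasing_cvgn; apply/nondecreasing_seqP => N; exact: ndg.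
Qed.

Lemma le_ae_exponent (y z : T -> R) (D : set T) (t : R) : measurable D ->
  measurable_fun setT y -> measurable_fun setT z ->
  (forall x, 0 <= y x)%R -> (forall x, 0 <= z x)%R -> (0 <= t)%R ->
  (\forall x \ae mu, y x = z x) ->
  \int[mu]_(x in D) rpow t (y x) = \int[mu]_(x in D) rpow t (z x).
Proof.
move=> mD my mz y0 z0 t0 yz; apply: ge0_ae_eq_integral => //.
- by apply: measurable_funTS; exact: measurable_rpowc.
- by apply: measurable_funTS; exact: measurable_rpowc.
- by move=> x _; exact: rpow_ge0.
- by move=> x _; exact: rpow_ge0.
- by apply: filterS yz => x -> _.
Qed.

End real_substitute.

(** If all members of [S1] were larger than [s], the product of the two infima
    would be larger than [B]. *)
Lemma small_member (R : realType) (S1 S2 : set R) (s t B : R) :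
  (0 <= s)%R -> (0 <= t)%R -> (B < s * t)%R ->
  t%:E <= ereal_inf (EFin @` S2) ->
  ereal_inf (EFin @` S1) * ereal_inf (EFin @` S2) <= B%:E ->
  exists2 l, S1 l & (l <= s)%R.
Proof.
move=> s0 t0 Bst tS H; apply: contrapT => nex.
have sS : s%:E <= ereal_inf (EFin @` S1).
  apply: le_ereal_inf_tmp => _ [l Sl <-]; rewrite lee_fin leNgt; apply/negP => h.
  by apply: nex; exists l => //; exact: ltW.
have : s%:E * t%:E <= B%:E by apply: le_trans H; apply: lee_pmul; rewrite ?lee_fin.
by rewrite -EFinM lee_fin leNgt Bst.
Qed.

Lemma doubled_product (R : realType) (a v K : R) : (0 < v)%R -> (0 < K)%R ->
  (K * v < 2 * expR 1 * K * v `^ a * (v `^ (1 - a) / expR 1))%R.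
Proof.
move=> v0 K0; have vv : (v `^ a * v `^ (1 - a) = v)%R.
  by rewrite -gt0_powRD// addrC subrK powRr1// ltW.
have -> : (2 * expR 1 * K * v `^ a * (v `^ (1 - a) / expR 1) =
  2 * K * (v `^ a * v `^ (1 - a)))%R by field; rewrite gt_eqF ?expR_gt0.
by rewrite vv; have := mulr_gt0 K0 v0; lra.
Qed.

Section muckenhoupt_Rn.
Context {R : realType} (n : nat).
Hypothesis n_gt0 : (0 < n)%N.
Local Notation mu := (@lebesgue_n R n).

Lemma lux_norm_indic (Q : set (Rn R n)) (z z' : Rn R n -> R) : measurable Q ->
  measurable_fun setT z -> measurable_fun setT z' ->
  (forall x, 0 <= z x)%R -> (forall x, 0 <= z' x)%R ->
  (\forall x \ae mu, z x = z' x) ->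
  lux_norm (fun x => (z x)%:E^-1) (EFin \o \1_Q) =
  ereal_inf [set l%:E | l in
    [set l : R | (0 < l)%R /\ \int[mu]_(x in Q) rpow l^-1 (z' x) <= 1]].
Proof.
move=> mQ mz mz' z0 z0' zz'; congr ereal_inf.
have E (l : R) : (0 < l)%R -> modular (fun x => (z x)%:E^-1)
    (fun x => (EFin \o \1_Q) x / l%:E) = \int[mu]_(x in Q) rpow l^-1 (z' x).
  move=> l0; have li0 : (0 <= l^-1)%R by rewrite invr_ge0 ltW.
  transitivity (\int[mu]_(x in Q) rpow l^-1 (z x)); last first.
    exact: (@le_ae_exponent _ _ R mu z z' Q l^-1 mQ mz mz' z0 z0' li0 zz').
  rewrite /modular [RHS]integral_mkcond; apply: eq_integral => x _.
  rewrite /patch /= indicE inver gt_eqF//; case: ifPn => xQ.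
    by rewrite -EFinM mul1r /= ger0_norm// epow_rpow.
  by rewrite -EFinM mul0r /= normr0 epow_rpow// rpow0l.
apply/seteqP; split => _ [l [l0 Hl] <-]; exists l => //; split => //.
  by rewrite -E.
by rewrite E.
Qed.

(** Both norms of the indicator are bounded from below by [rpow_mean_lower];
    since their product is at most [K |Q|], each of them is bounded from above by
    a multiple of the same power of [|Q|]. *)
Lemma muckenhoupt_local (p : Rn R n -> \bar R) (y : Rn R n -> R) (r K : R) :
  (1 < r)%R -> (1 <= K)%R -> measurable_fun setT y -> (forall x, 0 <= y x <= r^-1)%R ->
  (forall x, 1 <= p x) -> measurable_fun setT (fun x => (fine (p x))^-1)%R ->
  (\forall x \ae mu, (fine (p x))^-1%R = y x) ->
  muckenhoupt_const p <= K%:E ->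
  local_muckenhoupt (2 * expR 1 * K)^-1 r y.
Proof.
move=> r1 K1 my yr p1 my0 aey HK b L L0 L1.
pose y0 x := ((fine (p x))^-1)%R.
have y001 x : (0 <= y0 x <= 1)%R by have [] := inve_exponent (p1 x).
have y00 x : (0 <= y0 x)%R by case/andP: (y001 x).
have y0'0 x : (0 <= 1 - y0 x)%R by rewrite subr_ge0; case/andP: (y001 x).
have r0 : (0 < r)%R by exact: lt_trans r1.
have ri1 : (r^-1 <= 1)%R by rewrite invf_le1// ltW.
have ri0 : (0 <= r^-1)%R by rewrite invr_ge0 ltW.
have yy0 x : (0 <= y x)%R by case/andP: (yr x).
have yyr x : (y x <= r^-1)%R by case/andP: (yr x).
have yy1 x : (y x <= 1)%R by exact: le_trans (yyr x) ri1.
have y01 x : (0 <= y x <= 1)%R by rewrite yy0 yy1.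
have y'0 x : (0 <= 1 - y x)%R by rewrite subr_ge0.
have y'01 x : (0 <= 1 - y x <= 1)%R by rewrite y'0/= gerBl; exact: yy0.
have y'1 x : (1 - y x <= 1)%R by case/andP: (y'01 x).
have my' : measurable_fun setT (fun x => 1 - y x)%R by exact: measurable_funB.
have my0' : measurable_fun setT (fun x => 1 - y0 x)%R by exact: measurable_funB.
have aey' : \forall x \ae mu, (1 - y0 x = 1 - y x)%R by apply: filterS aey => x <-.
have K0 : (0 < K)%R by exact: lt_le_trans K1.
have e0 : (0 < expR 1 :> R)%R by exact: expR_gt0.
set v := (L ^+ n)%R in L1 *.
have v0 : (0 < v)%R by rewrite exprn_gt0.
have v01 : (0 < v <= 1)%R by rewrite v0.
have s0 (s : R) : (0 < 2 * expR 1 * K * v `^ s)%R by rewrite !mulr_gt0 ?powR_gt0.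
have c0 (s : R) : (0 <= (2 * expR 1 * K)^-1 * v `^ (- s))%R.
  by rewrite powRN -invfM invr_ge0 ltW.
have t0 (s : R) : (0 < v `^ s / expR 1)%R by rewrite divr_gt0 ?powR_gt0.
have mQ : measurable (cube b L : set (Rn R n)) by exact: measurable_cube.
set Q := (cube b L : set (Rn R n)) in mQ *.
have muQ : mu Q = v%:E by have [] := lebesgue_cube b (ltW L0).
have yfin := @integral_le1_fin _ _ R mu Q v y mQ muQ my yy0 yy1.
have yint0 : 0 <= \int[mu]_(x in Q) (y x)%:E.
  by apply: integral_ge0 => x _; rewrite lee_fin.
pose a := (fine (\int[mu]_(x in Q) (y x)%:E) / v)%R.
have a0 : (0 <= a)%R by rewrite divr_ge0 ?fine_ge0// ltW.
have aE : \int[mu]_(x in Q) (y x)%:E = (a * v)%:E.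
  by rewrite /a divfK ?gt_eqF// fineK// ge0_fin_numE.
have cstE (s : R) : \int[mu]_(x in Q) ((fun=> s : R) x)%:E = (s * v)%:E.
  by rewrite integral_cst// [X in _ * X](_ : _ = v%:E)// -EFinM.
have ar : (a <= r^-1)%R.
  rewrite -(ler_pM2r v0) -lee_fin -aE -cstE.
  by apply: (@le_integral_EFin _ _ R mu Q); [exact: mQ|exact: my|exact: measurable_cst|exact: yy0|exact: yyr].
have a1 : (a <= 1)%R by exact: le_trans ar ri1.
have a'0 : (0 <= 1 - a)%R by rewrite subr_ge0.
have a'E : \int[mu]_(x in Q) (1 - y x)%R%:E = ((1 - a) * v)%:E.
  have fin : \int[mu]_(x in Q) (1 - y x)%R%:E < +oo.
    exact: (@integral_le1_fin _ _ R mu Q v _ mQ muQ my' y'0 y'1).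
  have sum := @integral_sum_EFin _ _ R mu Q y (fun x => 1 - y x)%R (fun=> 1%R) mQ my my' yy0 y'0.
  rewrite aE cstE in sum.
  have i0 : 0 <= \int[mu]_(x in Q) (1 - y x)%R%:E.
    by apply: integral_ge0 => x _; rewrite lee_fin.
  have h1 x : 1%R = (y x + (1 - y x))%R by ring.
  have {}sum := sum h1.
  move: sum fin i0; case: (\int[mu]_(x in Q) (1 - y x)%R%:E) => [s| |] // H _ _.
  have h : (1 * v = a * v + s)%R by apply: EFin_inj; rewrite EFinD.
  by congr EFin; rewrite mulrBl h addrC addKr.
pose S1 := [set l : R | (0 < l)%R /\ \int[mu]_(x in Q) rpow l^-1 (y x) <= 1].
pose S2 := [set l : R | (0 < l)%R /\ \int[mu]_(x in Q) rpow l^-1 (1 - y x) <= 1].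
have N1 : lux_norm p (EFin \o \1_Q) = ereal_inf (EFin @` S1).
  rewrite [in LHS](_ : p = (fun x => (y0 x)%:E^-1)); last first.
    by apply/funext => x; exact: exponentE.
  exact: (lux_norm_indic mQ my0 my y00 yy0 aey).
have N2 : lux_norm (conj_exponent p) (EFin \o \1_Q) = ereal_inf (EFin @` S2).
  rewrite (_ : conj_exponent p = (fun x => (1 - y0 x)%R%:E^-1)); last first.
    by apply/funext => x; exact: conj_exponentE.
  exact: (lux_norm_indic mQ my0' my' y0'0 y'0 aey').
have prod : ereal_inf (EFin @` S1) * ereal_inf (EFin @` S2) <= (K * v)%:E.
  rewrite EFinM -(lee_pdivrMr _ _ v0); apply: le_trans HK.
  apply: ereal_sup_ubound; exists Q; first by exists b; exists L.
  by rewrite N1 N2 [mu _]muQ inver gt_eqF.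
have low1 : (v `^ a / expR 1)%:E <= ereal_inf (EFin @` S1).
  apply: le_ereal_inf_tmp => _ [l [l0 Hl] <-]; rewrite lee_fin -[leRHS]invrK.
  by apply: (rpow_mean_lower mQ muQ v01 my y01 a0 aE); [rewrite invr_gt0|exact: Hl].
have low2 : (v `^ (1 - a) / expR 1)%:E <= ereal_inf (EFin @` S2).
  apply: le_ereal_inf_tmp => _ [l [l0 Hl] <-]; rewrite lee_fin -[leRHS]invrK.
  by apply: (rpow_mean_lower mQ muQ v01 my' y'01 a'0 a'E); [rewrite invr_gt0|exact: Hl].
have ex1 : exists2 l, S1 l & (l <= 2 * expR 1 * K * v `^ a)%R.
  exact: (small_member (ltW (s0 a)) (ltW (t0 _)) (doubled_product a v0 K0) low2 prod).
have ex2 : exists2 l, S2 l & (l <= 2 * expR 1 * K * v `^ (1 - a))%R.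
  rewrite muleC in prod.
  have dp := doubled_product (1 - a) v0 K0; rewrite subKr in dp.
  exact: (small_member (ltW (s0 _)) (ltW (t0 _)) dp low1 prod).
have conc (s : R) (z : Rn R n -> R) (l : R) : measurable_fun setT z -> (forall x, 0 <= z x)%R ->
    (0 < l)%R -> (l <= 2 * expR 1 * K * v `^ s)%R ->
    \int[mu]_(x in Q) rpow l^-1 (z x) <= 1 ->
    \int[mu]_(x in Q) rpow ((2 * expR 1 * K)^-1 * v `^ (- s)) (z x) <= 1.
  move=> mz z0 l0 ll Hl; apply: le_trans Hl.
  have cl : ((2 * expR 1 * K)^-1 * v `^ (- s) <= l^-1)%R.
    by rewrite powRN -invfM lef_pV2 ?posrE; [exact: ll|exact: s0|exact: l0].
  exact: (@le_integral_rpow _ _ R mu Q Q z _ _ mQ mQ (@subset_refl _ _) mz z0 (c0 s) cl).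
exists a; split.
- by rewrite a0.
- by have [l [l0 Hl] ll] := ex1; exact: conc my yy0 l0 ll Hl.
- by have [l [l0 Hl] ll] := ex2; exact: conc my' y'0 l0 ll Hl.
Qed.

End muckenhoupt_Rn.

(** * The modular inequality *)

Lemma measurable_abse_div d (T : measurableType d) (R : realType) (F : T -> \bar R)
    (lam : R) : measurable_fun setT F -> (0 < lam)%R ->
  measurable_fun setT (fun x => `|F x / lam%:E|).
Proof.
move=> mF lam0; apply: measurableT_comp => //; rewrite inver gt_eqF//.
rewrite (_ : (fun x => F x * (lam^-1)%:E) = (fun x => (lam^-1)%:E * F x)).
  exact: measurable_funeM.
by apply/funext => x; rewrite muleC.
Qed.

Section final_bound.
Context {R : realType} (n : nat).
Hypothesis n_gt0 : (0 < n)%N.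
Local Notation mu := (@lebesgue_n R n).
Implicit Types (p F : Rn R n -> \bar R).

(** [1/p' = 1 - 1/p] is bounded away from 0 when [1/p] is bounded away from 1. *)
Lemma conj_exponent_bounded p : (forall x, 1 <= p x) -> 1 < ess_inf mu p ->
  ess_sup mu (conj_exponent p) < +oo.
Proof.
move=> p1 H.
have [m [m1 mi]] : exists m : R, (1 < m)%R /\ m%:E <= ess_inf mu p.
  case: (ess_inf mu p) H => [m| |] //.
    by rewrite lte_fin => m1; exists m.
  by move=> _; exists 2%R; rewrite ltr1n leey.
have m0 : (0 < m)%R by exact: lt_trans m1.
have mi1 : (0 < 1 - m^-1)%R by rewrite subr_gt0 invf_lt1.
apply: (@le_lt_trans _ _ ((1 - m^-1)^-1)%:E); last exact: ltry.
apply/ess_supP; move/ess_infP : mi; apply: filterS => x mp.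
rewrite /conj_exponent conj_exponentE//.
have : ((fine (p x))^-1 <= m^-1)%R.
  have := p1 x; case: (p x) mp => [s| |] //= ms s1.
    by rewrite lef_pV2 ?posrE// ?(lt_le_trans m0)// -lee_fin.
  by rewrite invr0 invr_ge0 ltW.
move=> h; have h0 : (0 < 1 - (fine (p x))^-1)%R by lra.
rewrite inver gt_eqF// lee_fin lef_pV2 ?posrE//; lra.
Qed.

Lemma exponent_le_conj p (u : \bar R) x : 1 <= p x -> u < +oo ->
  hoelder_conjugate (p x) <= u ->
  ((fine (p x))^-1 <= 1 - (Num.max (fine u) 2)^-1)%R.
Proof.
move=> p1 uoo; rewrite conj_exponentE//; have [_ /andP[y0 y1]] := inve_exponent p1.
set y := ((fine (p x))^-1)%R in y0 y1 *.
have y10 : (0 <= 1 - y)%R by rewrite subr_ge0.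
case: u uoo => [s| |] // _; last first.
  by rewrite leeNy_eq inve_eqNy.
rewrite inver; case: eqP => // /eqP yn; have {yn}yp : (0 < 1 - y)%R by rewrite lt_def yn.
rewrite lee_fin /= => h; have P0 : (0 < Num.max s 2)%R by rewrite lt_max ltr0n orbT.
rewrite lerBrDl -lerBrDr -[leRHS]invrK lef_pV2 ?posrE ?invr_gt0//.
by rewrite le_max h.
Qed.

Lemma maximal_ge0 F x : 0 <= maximal F x.
Proof.
have C0 : cube x 1%R x by exact: cube_center.
apply: (@le_trans _ _ ((\int[mu]_(y in cube x 1%R) `|F y|) / mu (cube x 1%R))).
  by rewrite mule_ge0 ?inve_ge0 ?integral_ge0.
apply: ereal_sup_ubound; exists (cube x 1%R) => //; split => //.
by exists x; exists 1%R.
Qed.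

(** [F / lam] is replaced by a real function with the same means, for which the
    finite maxima over rational cubes have modular at most 1; these increase to
    a function above the maximal function, up to [2^n] and the factor 2 of
    [epow_sup]. *)
Lemma maximal_modular p (y : Rn R n -> R) (r C lam : R) F :
  (1 < r)%R -> (forall x, 1 <= p x) -> measurable_fun setT (fun x => (fine (p x))^-1)%R ->
  measurable_fun setT y -> (forall x, 0 <= y x <= r^-1)%R ->
  (forall x, y x = 0%R -> (fine (p x))^-1 = 0)%R ->
  (\forall x \ae mu, (fine (p x))^-1%R = y x) ->
  (0 < C)%R ->
  means_bounded C y ->
  measurable_fun setT F -> (0 < lam)%R ->
  modular p (fun x => F x / lam%:E) <= 1 ->
  modular p (fun x => maximal F x / (2 ^+ n * (2 * C) * lam)%:E) <= 1.
Proof.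
move=> r1 p1 my0 my yr yy0 aey C0 HC mF lam0 HF.
have r0 : (0 < r)%R by exact: lt_trans r1.
have ri1 : (r^-1 <= 1)%R by rewrite invf_le1// ltW.
have y0 x : (0 <= y x)%R by case/andP: (yr x).
have y1 x : (y x <= 1)%R by case/andP: (yr x) => _ /le_trans; apply.
have y001 x : (0 <= (fine (p x))^-1 <= 1)%R by have [] := inve_exponent (p1 x).
pose g x := `|F x / lam%:E|.
have lamV : (lam%:E^-1 : \bar R) = (lam^-1)%:E by rewrite inver gt_eqF.
have mg : measurable_fun setT g.
  exact: measurable_abse_div.
have g0 x : 0 <= g x by exact: abse_ge0.
have Hg : \int[mu]_x epow (g x) (((fine (p x))^-1)%R%:E^-1) <= 1.
  apply: le_trans HF; rewrite le_eqVlt; apply/orP; left; apply/eqP.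
  by apply: eq_integral => x _; rewrite -exponentE.
have [f [mf f0 foo Hf aef]] := @real_substitute _ _ R mu g (fun x => (fine (p x))^-1)%R y
  mg g0 my0 y001 my y0 yy0 aey Hg.
have Fg x : `|F x| = lam%:E * g x.
  rewrite /g abseM lamV /= gtr0_norm ?invr_gt0// muleCA -EFinM divff ?gt_eqF//.
  by rewrite mule1.
pose b i := (@rat_cube R n i).1; pose l i := (@rat_cube R n i).2.
have l0 i : (0 < l i)%R by exact: rat_cube_gt0.
have v0 i : (0 < l i ^+ n)%R by rewrite exprn_gt0.
have mQ i : measurable (cube (b i) (l i) : set (Rn R n)) by exact: measurable_cube.
have muQ i : mu (cube (b i) (l i)) = (l i ^+ n)%:E.
  by have [] := lebesgue_cube (b i) (ltW (l0 i)).
have mr : measurable_fun setT (fun x => rpow (f x) (y x)) by exact: measurable_rpow.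
have foo' i : \int[mu]_(x in cube (b i) (l i)) (f x)%:E < +oo.
  apply: (@le_lt_trans _ _ (l i ^+ n + 1)%:E); last exact: ltry.
  have := integral_add1 (mQ i) (muQ i) mr (fun x => rpow_ge0 _ _) Hf; apply: le_trans.
  apply: ge0_le_integral; [exact: mQ|by move=> x _; rewrite lee_fin| | |].
  - by apply: measurable_funTS; exact/measurable_EFinP.
  - by apply: measurable_funTS; exact: emeasurable_funD.
  - move=> x _; have [h1|h1] := leP (f x) 1%R.
      by apply: (@le_trans _ _ 1); rewrite ?lee_fin// leeDl// rpow_ge0.
    apply: (@le_trans _ _ (rpow (f x) (y x))); last by rewrite leeDr.
    by apply: rpow_ge1 => //; rewrite y0 y1.
have [A [A0 HA]] := @exists_means _ _ R mu (fun i => cube (b i) (l i)) (fun i => l i ^+ n)%R f v0 f0 foo'.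
have HN := HC f mf f0 foo Hf b l A l0 HA.
have mabs : measurable_fun setT (fun x => `|F x|) by exact: measurableT_comp.
have HAF i : \int[mu]_(x in cube (b i) (l i)) `|F x| <= (lam * (A i * l i ^+ n))%:E.
  rewrite -(@integralZ_EFin _ _ R mu _ lam _ f (mQ i) mf f0 (ltW lam0) (HA i)).
  rewrite le_eqVlt; apply/orP; left; apply/eqP; apply: ge0_ae_eq_integral.
  - exact: mQ.
  - exact: measurable_funTS.
  - by apply: measurable_funTS; apply/measurable_EFinP; exact: measurable_funM.
  - by move=> x _; exact: abse_ge0.
  - by move=> x _; rewrite lee_fin mulr_ge0// ltW.
  - by apply: filterS aef => x gf _; rewrite Fg gf.
pose M N x := max_mean (fun i => cube (b i) (l i) : set (Rn R n)) A N x.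
have M0 N x : (0 <= M N x)%R by exact: max_mean_ge0.
pose G N x := rpow (M N x / C) (y x).
have mM N : measurable_fun setT (M N) by exact: measurable_max_mean.
have mG N : measurable_fun setT (G N).
  apply: measurable_rpow => [|//|x|//]; last by rewrite divr_ge0// ltW.
  exact: measurable_funM.
have G0 N x : 0 <= G N x by exact: rpow_ge0.
have ndG N x : G N x <= G N.+1 x.
  apply: le_rpow => //; first by rewrite divr_ge0// ltW.
  by rewrite ler_pM2r ?invr_gt0// /M /= le_max lexx.
have supG : \int[mu]_x ereal_sup (range (G^~ x)) <= 1.
  exact: integral_sup_le mG G0 ndG HN.
have msup := @measurable_ereal_sup_seq _ _ R G mG ndG.
apply: le_trans supG; apply: le_integral_ae.
- move=> x; rewrite (exponentE (p1 x)) /epow; case: (_^-1) => [s| |]; first exact: poweR_ge0.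
    by case: ifP => // _; exact: leey.
  by case: ifP => // _; exact: leey.
- by move=> x; apply: le_trans (G0 0%N x) _; apply: ereal_sup_ubound; exists 0%N.
- exact: msup.
apply: filterS aey => x yx.
rewrite (exponentE (p1 x)) yx.
(* [epow_sup] doubles this factor to [1/C] *)
pose cc := ((2 * C)^-1)%R.
have cc0 : (0 < cc)%R by rewrite invr_gt0 mulr_gt0.
have D0 : (0 < 2 ^+ n * (2 * C) * lam)%R by rewrite !mulr_gt0// exprn_gt0.
have sup0 : 0 <= ereal_sup (range (EFin \o M^~ x)).
  by apply: (@le_trans _ _ (M 0%N x)%:E); [rewrite lee_fin|apply: ereal_sup_ubound; exists 0%N].
have y01 : (0 <= y x <= 1)%R by rewrite y0 y1.
have tle : `|maximal F x / (2 ^+ n * (2 * C) * lam)%:E| <= cc%:E * ereal_sup (range (EFin \o M^~ x)).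
  rewrite gee0_abs; last by rewrite mule_ge0 ?maximal_ge0// inve_ge0 lee_fin ltW.
  rewrite inver gt_eqF// lee_pdivrMr// muleC muleA -EFinM.
  apply: (le_trans (@maximal_le_max_mean R n F A lam x (ltW lam0) A0 mF HAF)).
  rewrite le_eqVlt; apply/orP; left; apply/eqP; congr (_%:E * _).
  by rewrite /cc; field; rewrite gt_eqF.
have := epow_sup (abse_ge0 _) cc0 y01 (fun i => M0 i x) tle.
rewrite (_ : (fun i => rpow (2 * cc * M i x) (y x)) = G^~ x)//.
apply/funext => i; rewrite /G; congr (rpow _ _).
by rewrite /cc; field; rewrite gt_eqF.
Qed.

End final_bound.

Theorem theorem1p1 (R : realType) (n : nat) (n_gt0 : (0 < n)%N) :
  exists c : \bar R -> \bar R -> \bar R -> R,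
    (forall u v w : \bar R, (0 < c u v w)%R) /\
    forall p : Rn R n -> \bar R,
      variable_exponent p -> muckenhoupt p -> nekvinda p ->
      1 < ess_inf (@lebesgue_n R n) p ->
      forall f : Rn R n -> \bar R, Lvar p f ->
        lux_norm p (maximal f) <=
          (c (ess_sup (@lebesgue_n R n) (conj_exponent p))
             (muckenhoupt_const p) (nekvinda_const p))%:E * lux_norm p f.
Proof.
pose P (u : \bar R) := Num.max (fine u) 2%R.
pose r u := ((1 - (P u)^-1)^-1)%R.
pose K (v : \bar R) := Num.max (fine v) 1%R.
pose ga (w : \bar R) := ((`|fine w| + 1)^-1)%R.
have P2 u : (2 <= P u)%R by rewrite le_max lexx orbT.
have P0 u : (0 < P u)%R by exact: lt_le_trans (P2 u).
have P1 u : (0 < 1 - (P u)^-1)%R.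
  by rewrite subr_gt0 invf_lt1// (lt_le_trans _ (P2 u))// ltr1n.
have r1 u : (1 < r u)%R.
  by rewrite invf_gt1// gtrBl invr_gt0.
have K1 v : (1 <= K v)%R by rewrite le_max lexx orbT.
have c01 v : (0 < (2 * expR 1 * K v)^-1 <= 1)%R.
  have e1 : (1 <= expR 1 :> R)%R by rewrite -[leLHS]expR0 ler_expR.
  have : (1 <= 2 * expR 1 * K v)%R.
    by rewrite mulr_ege1// mulr_ege1// ler1n.
  by move=> h; rewrite invr_gt0 invf_le1 (lt_le_trans _ h).
have ga01 w : (0 < ga w <= 1)%R.
  have h : (1 <= `|fine w| + 1)%R by rewrite lerDr.
  by rewrite invr_gt0 invf_le1 (lt_le_trans _ h).
have /choice[C HC] := fun t : \bar R * \bar R * \bar R =>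
  max_mean_modular n_gt0 (r1 t.1.1) (c01 t.1.2) (ga01 t.2).
exists (fun u v w => 2 ^+ n * (2 * C (u, v, w)))%R; split.
  by move=> u v w; have [C0 _] := HC (u, v, w); rewrite !mulr_gt0// exprn_gt0.
move=> p [mp p1] Hmu Hne Hinf f [mf _].
set u := ess_sup _ _; set v := muckenhoupt_const p; set w := nekvinda_const p.
have [C0 {}HC] := HC (u, v, w); move: HC C0 => /=; set c := C _ => HC C0.
have uoo : u < +oo by exact: conj_exponent_bounded.
have my0 : measurable_fun setT (fun x => (fine (p x))^-1)%R.
  rewrite (_ : (fun x => _) = (fun x => fine (p x) `^ (-1))%R).
    apply: measurableT_comp (measurable_powR (-1)) _.
    exact: measurableT_comp.
  apply/funext => x; rewrite powR_inv1//; apply: fine_ge0.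
  by apply: le_trans (p1 x); exact: lee01.
have y001 x : (0 <= (fine (p x))^-1 <= 1)%R by have [] := inve_exponent (p1 x).
have ri0 : (0 < (r u)^-1)%R by rewrite invr_gt0 (lt_trans _ (r1 u)).
(* the bound [1/r] holds almost everywhere; truncation makes it hold everywhere *)
pose y x := (Num.min (fine (p x))^-1 (r u)^-1)%R.
have my : measurable_fun setT y by apply: measurable_minr => //; exact: measurable_cst.
have yr x : (0 <= y x <= (r u)^-1)%R.
  by rewrite le_min (ltW ri0) andbT ge_min lexx orbT andbT; case/andP: (y001 x).
have yy0 x : y x = 0%R -> ((fine (p x))^-1 = 0)%R.
  by rewrite /y; case: leP => // _ h; move: ri0; rewrite h ltxx.
have aey : \forall x \ae @lebesgue_n R n, (fine (p x))^-1%R = y x.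
  have := ess_sup_ge (@lebesgue_n R n) (conj_exponent p); apply: filterS => x h.
  apply/esym/min_idPl; rewrite /r invrK.
  exact: exponent_le_conj.
have v0 : v <= (K v)%:E.
  have : v < +oo by exact: Hmu.
  by rewrite /K; case: (v) => [s| |] //= _; rewrite ?leNye// lee_fin le_max lexx.
have HA := muckenhoupt_local (r1 u) (K1 v) my yr p1 my0 aey v0.
have [q1 [_ qoo]] := getPex Hne.
set q := get _ in q1 qoo; have [qE /andP[yi0 _]] := inve_exponent q1.
pose yi := ((fine q)^-1)%R.
have Hga : \int[@lebesgue_n R n]_x rpow (ga w) `|y x - yi|%R <= 1.
  have w0 : 0 <= w.
    by apply: le_ereal_inf_tmp => _ [l [l0 _] <-]; rewrite lee_fin ltW.
  have wE : w = (fine w)%:E by rewrite fineK// ge0_fin_numE.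
  (* the infimum need not be attained, whence the increment 1 *)
  have /ereal_inf_lt[_ [l [l0 Hl] <-]] : w < (`|fine w| + 1)%:E.
    by rewrite [ltLHS]wE lte_fin (le_lt_trans (ler_norm _))// ltrDl.
  rewrite lte_fin => lw.
  have gl : (ga w <= l^-1)%R.
    by rewrite /ga lef_pV2 ?posrE// ?ltW// (lt_trans _ lw).
  apply: le_trans Hl.
  have [ga0 _] : (0 < ga w /\ ga w <= 1)%R by case/andP: (ga01 w).
  have li0 : (0 <= l^-1)%R by rewrite invr_ge0 ltW.
  apply: (@le_trans _ _ (\int[@lebesgue_n R n]_x rpow l^-1 `|(fine (p x))^-1 - yi|%R)).
    apply: le_integral_ae.
    - by move=> x; exact: rpow_ge0.
    - by move=> x; exact: rpow_ge0.
    - exact: (@measurable_rpow_dist _ _ R (fun x => (fine (p x))^-1)%R yi l^-1 my0 li0).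
    - apply: filterS aey => x ->; apply: le_rpow; [exact: normr_ge0|exact: ltW|exact: gl].
  rewrite le_eqVlt; apply/orP; left; apply/eqP; apply: eq_integral => x _.
  rewrite /nekvinda_exponent nekvinda_exponentE// inver gt_eqF// -EFinM mul1r /= (ger0_norm li0).
  by rewrite epow_rpow; [|exact: normr_ge0].
have HCy := HC y yi my yr HA yi0 Hga.
have key (l : R) : (0 < l)%R -> modular p (fun x => f x / l%:E) <= 1 ->
    modular p (fun x => maximal f x / (2 ^+ n * (2 * c) * l)%:E) <= 1.
  move=> l0 Hl.
  exact: (maximal_modular (r1 u) p1 my0 my yr yy0 aey C0 HCy mf l0 Hl).
have c0 : (0 < 2 ^+ n * (2 * c))%R by rewrite !mulr_gt0// exprn_gt0.
rewrite muleC -lee_pdivrMr//; apply: le_ereal_inf_tmp => _ [l [l0 Hl] <-].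
rewrite lee_pdivrMr// -EFinM; apply: ereal_inf_lbound.
exists (2 ^+ n * (2 * c) * l)%R; last by rewrite mulrC.
by split; [rewrite mulr_gt0|exact: key].
Qed.
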